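(* Let $q$ and $q_n$, $n\ge 1$, belong to $H^{-1}_{unif}(\mathbb{R})$. Suppose that $q_n\to q$ in $H^{-1}_{unif}(\mathbb{R})$ as $n\to\infty$, or, equivalently, that there are representations $q=Q'+\tau$, $q_n=Q_n'+\tau_n$ with $Q,Q_n\in L^2_{unif}(\mathbb{R})$, $\tau,\tau_n\in L^1_{unif}(\mathbb{R})$ such that $Q_n\to Q$ in $L^2_{unif}(\mathbb{R})$ and $\tau_n\to\tau$ in $L^1_{unif}(\mathbb{R})$. Then the operators $\mathrm{S}(q_n)$ converge to $\mathrm{S}(q)$ in the norm resolvent sense: the resolvent set of $\mathrm{S}(q)$ is nonempty and for every $\lambda$ in the resolvent set of $\mathrm{S}(q)$ one has that $\lambda$ belongs to the resolvent set of $\mathrm{S}(q_n)$ for all sufficiently large $n$ and $$\left\|(\mathrm{S}(q)-\lambda\,\mathrm{Id})^{-1}-(\mathrm{S}(q_n)-\lambda\,\mathrm{Id})^{-1}\right\|\to 0,\qquad n\to\infty .$$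
   Context: All functions are complex-valued. For $1\le p<\infty$ the Stepanov space $L^p_{unif}(\mathbb{R})$ consists of $f\in L^p_{loc}(\mathbb{R})$ with $\|f\|_{L^p_{unif}(\mathbb{R})}^p:=\sup_{t\in\mathbb{R}}\int_t^{t+1}|f(s)|^p\,ds<\infty$. $H^{-1}_{unif}(\mathbb{R})$ is the space of distributions $q$ on $\mathbb{R}$ that can be represented (not uniquely) as $q=Q'+\tau$ (distributional derivative) with $Q\in L^2_{unif}(\mathbb{R})$, $\tau\in L^1_{unif}(\mathbb{R})$; it is normed (up to equivalence of norms) by $\|q\|=\inf\{\|Q\|_{L^2_{unif}(\mathbb{R})}+\|\tau\|_{L^1_{unif}(\mathbb{R})}: q=Q'+\tau\}$. For $q=Q'+\tau\in H^{-1}_{unif}(\mathbb{R})$ the operator $\mathrm{S}(q)$ in $L^2(\mathbb{R})$ is defined by $\mathrm{S}(q)y=l[y]:=-(y'-Qy)'-Qy'+\tau y$ on $\mathrm{Dom}(\mathrm{S}(q))=\{y\in L^2(\mathbb{R}) : y,\ y'-Qy\in\mathrm{AC}_{loc}(\mathbb{R}),\ l[y]\in L^2(\mathbb{R})\}$, where $\mathrm{AC}_{loc}(\mathbb{R})$ is the space of locally absolutely continuous functions. It does not depend on the choice of the representation $q=Q'+\tau$. *)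

(* Defs.v *)
From HB Require Import structures.
From mathcomp Require Import all_boot all_order all_algebra.
From mathcomp Require Import all_classical all_reals all_analysis.
From mathcomp Require Import complex.
Import Order.TTheory GRing.Theory Num.Theory numFieldNormedType.Exports.

Set Implicit Arguments.
Unset Strict Implicit.
Unset Printing Implicit Defensive.

Local Open Scope classical_set_scope.
Local Open Scope ring_scope.

Section ComplexFunctions.
Context {R : realType}.
Implicit Types f g : R -> R[i].

Definition re f : R -> R := fun x => complex.Re (f x).
Definition im f : R -> R := fun x => complex.Im (f x).

(* Real-valued modulus; the norm `|_| of the ring R[i] takes values in R[i]. *)
Definition cmod f : R -> R := fun x => ComplexField.Normc.normc (f x).

Definition cmeasurable f :=
  measurable_fun [set: R] (re f) /\ measurable_fun [set: R] (im f).

Definition cintegral f : R[i] :=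
  Complex (\int[lebesgue_measure]_x re f x) (\int[lebesgue_measure]_x im f x).

(* Pointwise n-th derivative, taken componentwise. It has a junk value at the
   points where f is not differentiable. *)
Definition cderiven (n : nat) f : R -> R[i] :=
  fun x => Complex (derive1n n (re f) x) (derive1n n (im f) x).

Definition cderive f : R -> R[i] := cderiven 1 f.

Definition cae_eq f g := f = g %[ae (@lebesgue_measure R)].

Definition AC_loc f :=
  forall a b e : R, a <= b -> 0 < e -> exists2 d : R, 0 < d &
    forall (n : nat) (s t : 'I_n -> R),
      (forall i, a <= s i /\ s i <= t i /\ t i <= b) ->
      trivIset [set: 'I_n] (fun i => `]s i, t i[%classic) ->
      \sum_(i < n) (t i - s i) < d ->
      \sum_(i < n) ComplexField.Normc.normc (f (t i) - f (s i)) < e.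

End ComplexFunctions.

Section FunctionSpaces.
Context {R : realType}.
Implicit Types f : R -> R[i].
Local Notation mu := (@lebesgue_measure R).

Definition L2norm f : \bar R := ('N[mu]_(2%:E) [EFin \o cmod f])%E.

(* Elements of L^2 are handled through (Borel measurable) representatives, and
   equality in L^2 is cae_eq. *)
Definition L2 f := cmeasurable f /\ (L2norm f < +oo)%E.

Definition Lp_loc (p : R) f := cmeasurable f /\
  forall a b : R, (\int[mu]_(x in `[a, b]) (cmod f x `^ p)%:E < +oo)%E.

Definition Lunif_norm (p : R) f : \bar R :=
  (ereal_sup [set \int[mu]_(x in `[t, (t + 1)%R]) (cmod f x `^ p)%:E | t in [set: R]]
     `^ p^-1)%E.

Definition Lunif (p : R) f := Lp_loc p f /\ (Lunif_norm p f < +oo)%E.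

End FunctionSpaces.

Section Distributions.
Context {R : realType}.

Definition test_function (phi : R -> R[i]) :=
  (forall (n : nat) (x : R),
     derivable (derive1n n (re phi)) x 1 /\ derivable (derive1n n (im phi)) x 1) /\
  (exists K : R, forall x, K < `|x| -> phi x = 0).

(* A distribution is a complex-linear functional on test functions, continuous
   for the usual topology of D(R): on test functions supported in [-K, K] it is
   bounded by a constant multiple of a C^m-norm (B below stands for an upper
   bound on this norm). Only the values of T on test functions are meaningful. *)
Definition is_distribution (T : (R -> R[i]) -> R[i]) :=
  (forall (a : R[i]) (phi psi : R -> R[i]),
     test_function phi -> test_function psi ->
     T (fun x => a * phi x + psi x) = a * T phi + T psi) /\
  (forall K : R, exists (c : R) (m : nat), forall (phi : R -> R[i]) (B : R),
     test_function phi -> (forall x, K < `|x| -> phi x = 0) ->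
     (forall (j : nat) (x : R), (j <= m)%N -> cmod (cderiven j phi) x <= B) ->
     ComplexField.Normc.normc (T phi) <= c * B).

(* q = Q' + tau in the sense of distributions. *)
Definition represents (q : (R -> R[i]) -> R[i]) (Q tau : R -> R[i]) :=
  forall phi, test_function phi ->
    q phi = - cintegral (fun x => Q x * cderive phi x)
            + cintegral (fun x => tau x * phi x).

Definition Hm1_rep (q : (R -> R[i]) -> R[i]) (Q tau : R -> R[i]) :=
  [/\ Lunif 2 Q, Lunif 1 tau & represents q Q tau].

Definition Hm1_unif (q : (R -> R[i]) -> R[i]) :=
  is_distribution q /\ exists Q tau, Hm1_rep q Q tau.

Definition Hm1_norm (q : (R -> R[i]) -> R[i]) : \bar R :=
  ereal_inf [set z | exists Q tau,
    Hm1_rep q Q tau /\ z = (Lunif_norm 2 Q + Lunif_norm 1 tau)%E].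

End Distributions.

(* A linear operator in L^2 is given by its graph: T y f means that y belongs
   to the domain of T and T y = f, both as classes modulo cae_eq. *)
Definition operator (R : realType) := (R -> R[i]) -> (R -> R[i]) -> Prop.

Section Schrodinger.
Context {R : realType}.

(* y0 and u are the locally absolutely continuous representatives of y and of
   the quasi-derivative y' - Q y, so that f = l[y] = - u' - Q y' + tau y. *)
Definition S_graph (Q tau : R -> R[i]) : operator R := fun y f =>
  [/\ L2 y, L2 f & exists y0 u : R -> R[i],
    [/\ AC_loc y0, AC_loc u, cae_eq y y0,
        cae_eq u (fun x => cderive y0 x - Q x * y0 x) &
        cae_eq f (fun x => - cderive u x - Q x * cderive y0 x
                           + tau x * y0 x)]].

(* The graph does not depend on the representation q = Q' + tau, so the
   existential quantifier selects any one of them. *)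
Definition schrodinger (q : (R -> R[i]) -> R[i]) : operator R := fun y f =>
  exists Q tau, Hm1_rep q Q tau /\ S_graph Q tau y f.

End Schrodinger.

Section Resolvent.
Context {R : realType}.
Implicit Types (T : operator R) (lambda : R[i]).

(* The graph of T - lambda Id. *)
Definition op_shift T lambda : operator R := fun y f =>
  exists2 g, T y g & L2 f /\ cae_eq f (fun x => g x - lambda * y x).

(* T - lambda Id is a bijection from its domain onto L^2 and its inverse is
   bounded. *)
Definition resolvent_set T : set R[i] := [set lambda |
  [/\ forall f, L2 f -> exists y, op_shift T lambda y f,
      forall y1 y2 f, op_shift T lambda y1 f -> op_shift T lambda y2 f ->
        cae_eq y1 y2 &
      exists M : R, forall y f, op_shift T lambda y f ->
        (L2norm y <= M%:E * L2norm f)%E]].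

(* (T - lambda Id)^-1; for lambda in the resolvent set and f in L^2 it chooses a
   representative of the class of the solution y of (T - lambda Id) y = f. *)
Definition resolvent T lambda : (R -> R[i]) -> (R -> R[i]) :=
  fun f => xget (fun=> 0) [set y | op_shift T lambda y f].

Definition opnorm (A : (R -> R[i]) -> (R -> R[i])) : \bar R :=
  ereal_sup [set L2norm (A f) | f in [set f | L2 f /\ (L2norm f <= 1)%E]].

End Resolvent.

(* Main.v *)
(** Put u = y' - Q y. For lambda0 = - nu^2 the equation (S(q) - lambda0) y = f is the first-order
    system p' = nu p + Hp - f, m' = - nu m + Hm + f for p = nu y + u and m = nu y - u, where Hp and
    Hm are linear in (p, m) with coefficients Q and b = (tau - Q^2) / (2 nu). Solving for p from
    +oo and for m from -oo gives a fixed-point problem with kernel exp(- nu |x - s|). For nu large,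
    depending only on the uniform local bounds of Q and tau, the integrals of
    exp(- (nu - 1) |x - s|) (|Q| + 2 |b|) are at most 1/12, and the fixed point exists with
    |p|, |m| <= 4 F, where F(x) = int exp(- |x - s|) |f(s)| ds; this F absorbs the kernels because
    F(s) <= exp |x - s| F(x), and ||F|| <= 2 ||f|| in L^2. The same weight controls the dependence
    on (Q, tau), so the resolvents at lambda0 exist and converge in norm. A nonzero solution of the
    homogeneous system stays away from 0 on a half-line, hence is not in L^2. A Neumann iteration
    then carries the convergence from lambda0 to every lambda in the resolvent set of S(q).
    Two representations of q satisfy Q2 - Q1 = W with W' = tau1 - tau2 (du Bois-Reymond), and
    u2 = u1 - W y shows that they define the same operator. *)

Require Import Defs.
From HB Require Import structures.
From mathcomp Require Import all_boot all_order all_algebra.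
From mathcomp Require Import all_classical all_reals all_analysis.
From mathcomp Require Import measurable_realfun complex ring lra.
Import Order.TTheory GRing.Theory Num.Theory numFieldNormedType.Exports.
Set Implicit Arguments.
Unset Strict Implicit.
Unset Printing Implicit Defensive.
Local Open Scope classical_set_scope.
Local Open Scope ring_scope.

(** * Chains and total variation *)

(** The coefficients are complex and [S(q)] need not be self-adjoint, so no half-plane is known in
    advance to lie in the resolvent set. This is why the spectral parameter is pushed far along the
    negative axis, to a point that depends only on bounds shared by [q] and all late [q_n]. The
    coordinates [p] and [m] diagonalize the free system y' = u, u' = nu^2 y, and [b] collects what
    remains of u' = tau y - Q (u + Q y) - g once y is written as (p + m) / (2 nu). Multiplication by
    a locally square integrable [Q] is unbounded on L^2, so the iteration is run on pointwise bounds
    by multiples of F, and L^2 norms are taken only at the end.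

    A second obstacle is regularity. [AC_loc] is an epsilon-delta condition and [cderive] is a
    pointwise derivative with junk values, so the equation cannot be integrated until an absolutely
    continuous function is known to be the integral of its almost everywhere derivative. Total
    variation and the Radon-Nikodym theorem give this. Afterwards the equation is handled through
    the relation [cprim] between a function and a density of it. *)

Section Chains.
Context {R : realType}.
Implicit Types (F V : R -> R) (l : seq (R * R)).

(** Ordered lists replace the unordered indexed families of [AC_loc], so that cutting, concatenating
    and refining families of intervals become operations on lists. Degenerate intervals are
    allowed. *)
Fixpoint chain (a : R) l (b : R) : bool :=
  if l is st :: l' then [&& a <= st.1, st.1 <= st.2 & chain st.2 l' b]
  else a <= b.

Definition clen l : R := \sum_(i <- l) (i.2 - i.1).
Definition cvar F l : R := \sum_(i <- l) `|F i.2 - F i.1|.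

Definition chainAC F (a b : R) := forall e, 0 < e -> exists2 d, 0 < d &
  forall l, chain a l b -> clen l < d -> cvar F l < e.

Lemma clen_cons s l : clen (s :: l) = (s.2 - s.1) + clen l.
Proof. by rewrite /clen big_cons. Qed.

Lemma cvar_cons F s l : cvar F (s :: l) = `|F s.2 - F s.1| + cvar F l.
Proof. by rewrite /cvar big_cons. Qed.

Lemma clen_cat l1 l2 : clen (l1 ++ l2) = clen l1 + clen l2.
Proof. by rewrite /clen big_cat. Qed.

Lemma cvar_cat F l1 l2 : cvar F (l1 ++ l2) = cvar F l1 + cvar F l2.
Proof. by rewrite /cvar big_cat. Qed.

Lemma chain_le a l b : chain a l b -> a <= b.
Proof.
elim: l a => //= st l IH a /and3P[h1 h2 /IH h3].
exact: le_trans (le_trans h1 h2) h3.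
Qed.

Lemma chain_weak a a' l b b' : a' <= a -> b <= b' -> chain a l b -> chain a' l b'.
Proof.
elim: l a a' => /= [|st l IH] a a' h1 h2; first by move=> h; lra.
move=> /and3P[h3 h4 h5]; apply/and3P; split => //; first lra.
exact: IH h5.
Qed.

Lemma chain_cat a l1 b l2 c : chain a l1 b -> chain b l2 c -> chain a (l1 ++ l2) c.
Proof.
elim: l1 a => /= [|st l IH] a; first by move=> h; apply: chain_weak.
by move=> /and3P[h3 h4 h5] h6; apply/and3P; split => //; exact: IH.
Qed.

Lemma clen_ge0 a l b : chain a l b -> 0 <= clen l <= b - a.
Proof.
elim: l a => /= [|st l IH] a; first by rewrite /clen big_nil => h; lra.
by move=> /and3P[h3 h4 /IH]; rewrite clen_cons; lra.
Qed.

Lemma chain_mem a l b st : chain a l b -> st \in l -> a <= st.1 /\ st.1 <= st.2 /\ st.2 <= b.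
Proof.
elim: l a => //= s l IH a /and3P[h1 h2 h3]; rewrite inE => /orP[/eqP ->|].
  by split => //; split => //; exact: chain_le h3.
by move=> /(IH _ h3) [? [? ?]]; split => //; lra.
Qed.

Lemma chain_lt a l b i j : chain a l b -> (i < j < size l)%N ->
  (nth (0, 0) l i).2 <= (nth (0, 0) l j).1.
Proof.
elim: l a i j => [|s l IH] a i j; first by rewrite ltn0 andbF.
move=> /= /and3P[h1 h2 h3]; case: j => // j; rewrite ltnS; case: i => [/= jl|i /=]; last by rewrite ltnS; exact: IH h3.
by have [] := chain_mem h3 (mem_nth (0, 0) jl).
Qed.

(** An interval that straddles [x] is cut at [x]. This preserves the total length and, by the
    triangle inequality, can only increase the variation. *)
Lemma chain_split F a l b x : a <= x -> x <= b -> chain a l b ->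
  exists l1 l2, [/\ chain a l1 x, chain x l2 b, clen l = clen l1 + clen l2 &
     cvar F l <= cvar F l1 + cvar F l2].
Proof.
move=> + xb; elim: l a => /= [|st l IH] a ax.
  by move=> _; exists [::], [::]; rewrite /= /cvar /clen !big_nil !addr0; split.
move=> /and3P[h1 h2 h3].
have [tx|xt] := leP st.2 x.
  have [l1 [l2 [c1 c2 c3 c4]]] := IH _ tx h3.
  exists (st :: l1), l2; split => //=; first by apply/and3P.
    by rewrite !clen_cons c3 addrA.
  by rewrite !cvar_cons -addrA lerD2l.
have [sx|xs] := leP st.1 x.
  exists [:: (st.1, x)], ((x, st.2) :: l); split => /=.
  - by rewrite h1 sx lexx.
  - by rewrite lexx (ltW xt).
  - by rewrite !clen_cons /= /clen big_nil; lra.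
  - rewrite !cvar_cons /= {2}/cvar big_nil addr0 addrA lerD2r.
    by rewrite -(subrKA (F x)) [leRHS]addrC ler_normD.
exists [::], (st :: l); split => //=; first by rewrite h2 h3 (ltW xs).
  by rewrite /clen big_nil add0r.
by rewrite {2}/cvar big_nil add0r.
Qed.

(** Splitting off one piece of length [d] at a time costs [e] per piece. The bound has [n.+1] rather
    than [n] because the degenerate case [n = 0] already spends one [e]. *)
Lemma cvar_chop F a d e : 0 <= d -> (forall x l, chain x l (x + d) -> a <= x -> cvar F l <= e) ->
  forall n l, chain a l (a + d *+ n) -> cvar F l <= e *+ n.+1.
Proof.
move=> d0 H; elim=> [|n IH] l.
  rewrite mulr0n addr0 mulr1n => h; apply: (H a) => //.
  by apply: chain_weak h; lra.
move=> h; have n1 : a <= a + d *+ n by rewrite lerDl mulrn_wge0.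
have n2 : a + d *+ n <= a + d *+ n.+1 by rewrite lerD2l mulrS; lra.
have [l1 [l2 [c1 c2 _ c4]]] := chain_split F n1 n2 h.
apply: (le_trans c4).

rewrite [e *+ n.+2]mulrSr lerD//; first exact: IH.
apply: (H (a + d *+ n)); last by rewrite lerDl mulrn_wge0.
by rewrite -addrA -mulrSr.
Qed.

(** With [d] chosen for tolerance 1, a chain inside a piece of length [d / 2] has variation at most
    1, and finitely many such pieces cover the interval. *)
Lemma chainAC_bounded F a b : a <= b -> chainAC F a b ->
  exists M, forall l, chain a l b -> cvar F l <= M.
Proof.
move=> ab /(_ 1 ltr01)[d d0 H].
pose n := Num.truncn ((b - a) / (d / 2)).
exists (1 *+ n.+2) => l cl.
(* The uniform pieces overshoot [b]; freezing [F] at its value in [b] makes the overshoot contribute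
   no variation. *)
pose G x := F (Num.min x b).
have -> : cvar F l = cvar G l.
  rewrite /cvar; apply: eq_big_seq => st /(chain_mem cl)[? [? ?]].
  by rewrite /G !min_l//; lra.
apply: (@cvar_chop G a (d / 2) 1 _ _ n.+1); first lra.
  move=> x l' c' ax.
  have [xb|bx] := leP x b; last first.
    rewrite /cvar big1_seq// => st /= /(chain_mem c')[? [? ?]].
    by rewrite /G !min_r ?subrr ?normr0//; lra.
  have [l1 [l2 [c1 c2 c3 c4]]] : exists l1 l2, [/\ chain x l1 (Num.min b (x + d / 2)), chain (Num.min b (x + d/2)) l2 (x + d / 2), clen l' = clen l1 + clen l2 & cvar G l' <= cvar G l1 + cvar G l2].
    by apply: chain_split => //; rewrite ?le_min ?ge_min ?lexx ?orbT ?andbT ?xb//; lra.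
  apply: (le_trans c4).
  have -> : cvar G l2 = 0.
    rewrite /cvar big1_seq// => st /= /(chain_mem c2)[h1 [h2 h3]].
    move: h1; rewrite ge_min => /orP[h1|h1]; first by rewrite /G !min_r ?subrr ?normr0//; lra.
    have -> : st.1 = st.2 by apply/eqP; rewrite eq_le h2 /=; lra.
    by rewrite subrr normr0.
  rewrite addr0.
  have -> : cvar G l1 = cvar F l1.
    rewrite /cvar; apply: eq_big_seq => st /(chain_mem c1)[? [? ]].
    by rewrite le_min => /andP[? ?]; rewrite /G !min_l//; lra.
  apply/ltW/H.
    by apply: chain_weak c1; rewrite ?ge_min ?lexx.
  have := clen_ge0 c1; have : Num.min b (x + d / 2) <= x + d / 2 by rewrite ge_min lexx orbT.
  by lra.
apply: chain_weak cl => //.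
have : (b - a) / (d / 2) < n.+1%:R by rewrite truncnS_gt.
by rewrite ltr_pdivrMr; [rewrite mulrC mulr_natr; lra|lra].
Qed.

(** The open intervals of an ordered chain are pairwise disjoint, so a chain is a special case of
    the families in the definition of absolute continuity. *)
Lemma chainAC_of_AC F a b : a <= b ->
  (forall e : R, 0 < e -> exists2 d : R, 0 < d &
    forall (n : nat) (s t : 'I_n -> R),
      (forall i, a <= s i /\ s i <= t i /\ t i <= b) ->
      trivIset [set: 'I_n] (fun i => `]s i, t i[%classic) ->
      \sum_(i < n) (t i - s i) < d ->
      \sum_(i < n) `|F (t i) - F (s i)| < e) ->
  chainAC F a b.
Proof.
move=> ab H e e0; have [d d0 {}H] := H e e0; exists d => // l cl ld.
have := H (size l) (fun i => (nth (0, 0) l i).1) (fun i => (nth (0, 0) l i).2).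
rewrite /cvar /clen !(big_nth (0, 0)) !big_mkord in ld *; apply => //.
- by move=> i; apply: (chain_mem cl); exact: mem_nth.
- apply/trivIsetP => i j _ _ ij.
  wlog {ij}: i j / (i < j)%N.
    move=> W; move: ij; rewrite -val_eqE neq_ltn => /orP[/W//|/W].
    by rewrite setIC.
  move=> ij; rewrite -subset0 => x [] /=; rewrite !in_itv /=.
  have := @chain_lt _ _ _ i j cl; rewrite ij ltn_ord => /(_ isT).
  lra.
Qed.

Definition tvar F a x : R := sup [set cvar F l | l in [set l | chain a l x]].

Section TotalVariation.
Variables (F : R -> R) (a b : R).
Hypotheses (ab : a <= b) (FAC : chainAC F a b).

Let tvar_has_sup x y : a <= x -> x <= y -> y <= b ->
  has_sup [set cvar F l | l in [set l | chain x l y]].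
Proof.
move=> ax xy yb; have [M HM] := chainAC_bounded ab FAC; split.
  by exists (cvar F [::]), [::].
by exists M => _ [l /= cl <-]; apply: HM; exact: chain_weak cl.
Qed.

Lemma cvar_tvar x y l : a <= x -> x <= y -> y <= b -> chain x l y -> cvar F l <= tvar F x y.
Proof.
move=> ax xy yb cl; apply: sup_upper_bound; first exact: tvar_has_sup.
by exists l.
Qed.

Lemma norm_tvar x y : a <= x -> x <= y -> y <= b -> `|F y - F x| <= tvar F x y.
Proof.
move=> ax xy yb; have := @cvar_tvar x y [:: (x, y)] ax xy yb.
rewrite /= /cvar big_seq1 /= => -> //; by rewrite !lexx xy.
Qed.

Lemma tvar_adherent x y e : a <= x -> x <= y -> y <= b -> 0 < e ->
  exists2 l, chain x l y & tvar F x y - e < cvar F l.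
Proof.
move=> ax xy yb e0; have [_ [l cl <-] h] := sup_adherent e0 (tvar_has_sup ax xy yb).
by exists l.
Qed.

Lemma tvarD x y z : a <= x -> x <= y -> y <= z -> z <= b ->
  tvar F x z = tvar F x y + tvar F y z.
Proof.
move=> ax xy yz zb; apply/eqP; rewrite eq_le; apply/andP; split.
  apply: ge_sup; first by exists (cvar F [::]), [::] => //=; exact: le_trans yz.
  move=> _ [l /= cl <-].
  have [l1 [l2 [c1 c2 _ c4]]] := chain_split F xy yz cl.
  apply: (le_trans c4); apply: lerD; apply: cvar_tvar => //; lra.
apply/ler_addgt0Pr => e e0.
have [||l1 c1 h1] := @tvar_adherent x y (e / 2) ax xy; [lra|lra|].
have [|||l2 c2 h2] := @tvar_adherent y z (e / 2) _ yz; [lra|lra|lra|].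
have := @cvar_tvar x z (l1 ++ l2) ax (le_trans xy yz) zb (chain_cat c1 c2).
rewrite cvar_cat; lra.
Qed.

(** Each interval is replaced by a chain inside it that nearly attains the variation there. The
    error budget is halved at every step, so the total error stays below [e] whatever the number of
    intervals, and the total length does not grow. *)
Lemma chain_refine l x y e : a <= x -> y <= b -> chain x l y -> 0 < e ->
  exists l', [/\ chain x l' y, clen l' <= clen l &
    \sum_(i <- l) (tvar F a i.2 - tvar F a i.1) <= cvar F l' + e].
Proof.
elim: l x e => [|st l IH] x e ax yb.
  by move=> /= xy e0; exists [::]; split => //; rewrite /cvar !big_nil add0r ltW.
move=> /= /and3P[h1 h2 h3] e0; have ye := chain_le h3.
have [l2 [c2 le2 v2]] := IH st.2 (e / 2) ltac:(lra) yb h3 ltac:(lra).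
have [|||l1 c1 v1] := @tvar_adherent st.1 st.2 (e / 2) _ h2; [lra|lra|lra|].
exists (l1 ++ l2); split.
- apply: chain_cat c2; exact: chain_weak c1.
- rewrite clen_cat clen_cons lerD//; have := clen_ge0 c1; lra.
- rewrite big_cons cvar_cat (@tvarD a st.1 st.2)//; lra.
Qed.

(** The [d] that [F] admits for [e / 2] serves for the variation function with tolerance [e]: refine
    the chain by [chain_refine] and spend the other half on the refinement error. *)
Lemma tvar_chainAC : chainAC (tvar F a) a b.
Proof.
move=> e e0; have [d d0 H] := FAC (divr_gt0 e0 (ltr0n _ 2)).
exists d => // l cl ld.
have [||//|l' [c1 c2 c3]] := @chain_refine l a b (e / 2) _ _ cl _ => //; first lra.
have -> : cvar (tvar F a) l = \sum_(i <- l) (tvar F a i.2 - tvar F a i.1).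
  apply: eq_big_seq => st /(chain_mem cl)[? [? ?]].
  rewrite ger0_norm// (@tvarD a st.1 st.2)// addrAC subrr add0r.
  by apply: le_trans (norm_tvar _ _ _).
have := H l' c1 (le_lt_trans c2 ld); lra.
Qed.

End TotalVariation.

Lemma chainAC_lin F G a b : chainAC F a b -> chainAC G a b ->
  chainAC (fun x => F x - G x) a b.
Proof.
move=> HF HG e e0; have e2 : 0 < e / 2 by lra.
have [d1 d10 {}HF] := HF _ e2; have [d2 d20 {}HG] := HG _ e2.
exists (Num.min d1 d2); first by rewrite lt_min d10.
move=> l cl; rewrite lt_min => /andP[l1 l2].
apply: (@le_lt_trans _ _ (cvar F l + cvar G l)).
  rewrite -big_split /=; apply: ler_sum => st _.
  have -> : F st.2 - G st.2 - (F st.1 - G st.1) = (F st.2 - F st.1) - (G st.2 - G st.1) by ring.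
  exact: ler_normB.
have := HF l cl l1; have := HG l cl l2; lra.
Qed.

End Chains.

(** * Stieltjes measures and densities of absolutely continuous functions *)

Section StieltjesAC.
Context {R : realType}.
Notation mu := (@lebesgue_measure R).

Lemma grid_chain (a h : R) (P : pred nat) m n : 0 <= h ->
  chain (a + h *+ m) [seq (a + h *+ k, a + h *+ k.+1) | k <- iota m n & P k] (a + h *+ (m + n)).
Proof.
move=> h0; elim: n m => [|n IH] m /=; first by rewrite addn0.
have step : a + h *+ m <= a + h *+ m.+1 by rewrite lerD2l mulrS; lra.
case: (P m) => /=; last first.
  by rewrite addnS -addSn; apply: chain_weak (IH m.+1).
by rewrite lexx step /= addnS -addSn; exact: IH.
Qed.

Section Measure.
Variables (V : R -> R) (a b : R).
Hypotheses (ab : a < b)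
  (ndV : forall x y, a <= x -> x <= y -> y <= b -> V x <= V y)
  (acV : chainAC V a b).

(** Composition with this retraction makes [V] constant on either side of [a, b], hence a cumulative
    function on the whole line as the Stieltjes construction requires. *)
Definition clamp (x : R) := Num.max a (Num.min x b).

Lemma clamp_itv x : a <= clamp x <= b.
Proof. by rewrite /clamp le_max lexx ge_max ge_min lexx (ltW ab) orbT. Qed.

Lemma clamp_id x : a <= x -> x <= b -> clamp x = x.
Proof. by move=> ax xb; rewrite /clamp min_l// max_r. Qed.

Lemma clamp_homo x y : x <= y -> clamp x <= clamp y.
Proof. by move=> xy; rewrite /clamp /Num.max /Num.min; repeat case: ifP; lra. Qed.

Lemma clamp_dist x y : x <= y -> clamp y - clamp x <= y - x.
Proof.
move=> xy; rewrite /clamp /Num.max /Num.min.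
by repeat case: ifP; lra.
Qed.

Definition Vclamp x := V (clamp x).

Lemma Vclamp_nd : nondecreasing Vclamp.
Proof.
move=> x y xy; have /andP[? _] := clamp_itv x; have /andP[_ ?] := clamp_itv y.
by apply: ndV => //; exact: clamp_homo.
Qed.

Lemma Vclamp_cont : continuous Vclamp.
Proof.
move=> x; apply/cvgrPdist_lt => e e0; have [d d0 H] := acV e0.
have K y z : y <= z -> z - y < d -> `|Vclamp z - Vclamp y| < e.
  move=> yz zyd; have := H [:: (clamp y, clamp z)].
  rewrite /= /clen /cvar !big_seq1 /=; apply.
    have /andP[-> _] := clamp_itv y; have /andP[_ ->] := clamp_itv z.
    by rewrite clamp_homo.
  exact: le_lt_trans (clamp_dist yz) zyd.
near=> y.
have xyd : `|x - y| < d by near: y; exact: cvgr_dist_lt.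
have [xy|/ltW yx] := leP x y.
  rewrite distrC; apply: K => //; move: xyd; rewrite distrC ger0_norm//; lra.
apply: K => //; move: xyd; rewrite ger0_norm//; lra.
Unshelve. all: by end_near. Qed.

Let Vcum : cumulative R R :=
  HB.pack Vclamp (isCumulative.Build R _ R Vclamp Vclamp_nd
    (right_continuousW Vclamp_cont)).

Let nu := lebesgue_stieltjes_measure Vcum.

Let nuE x y : x <= y -> nu `]x, y]%classic = (Vclamp y - Vclamp x)%:E.
Proof.
move=> xy; rewrite /nu /lebesgue_stieltjes_measure /measure_extension.
by rewrite measurable_mu_extE/=; [rewrite wlength_itv_bnd|exact: is_ocitv].
Qed.

Let muE (x y : R) : x <= y -> mu `]x, y]%classic = (y - x)%:E.
Proof.
move=> xy; rewrite lebesgue_measure_itv /= lte_fin.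
by case: ltgtP xy => // -> _; rewrite subrr.
Qed.

Let cell n k : set R := `]a + ((b - a) / n.+1%:R) *+ k, a + ((b - a) / n.+1%:R) *+ k.+1]%classic.

Let cellP n k x : cell n k x <->
  a + ((b - a) / n.+1%:R) *+ k < x <= a + ((b - a) / n.+1%:R) *+ k.+1.
Proof. by rewrite /cell /mkset in_itv. Qed.

Let cell_triv n : trivIset [set: 'I_n.+1] (fun k : 'I_n.+1 => cell n k).
Proof.
apply/trivIsetP => i j _ _ ij.
wlog {ij}: i j / (i < j)%N.
  move=> W; move: ij; rewrite -val_eqE neq_ltn => /orP[/W//|/W].
  by rewrite setIC.
move=> ij; rewrite -subset0 => x [/cellP/andP[_ h1] /cellP/andP[h2 _]].
have : a + (b - a) / n.+1%:R *+ i.+1 <= a + (b - a) / n.+1%:R *+ j.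
  by rewrite lerD2l ler_wpMn2l// divr_ge0// subr_ge0 ltW.
by move=> h3; have := lt_le_trans h2 (le_trans h1 h3); rewrite ltxx.
Qed.

Let cell_le n k : a + (b - a) / n.+1%:R *+ k <= a + (b - a) / n.+1%:R *+ k.+1.
Proof. by rewrite lerD2l ler_wpMn2l// divr_ge0// subr_ge0 ltW. Qed.

Let mu_cell n k : mu (cell n k) = (a + (b - a) / n.+1%:R *+ k.+1 - (a + (b - a) / n.+1%:R *+ k))%:E.
Proof. exact: muE. Qed.

Let nu_cell n k : nu (cell n k) = (Vclamp (a + (b - a) / n.+1%:R *+ k.+1) - Vclamp (a + (b - a) / n.+1%:R *+ k))%:E.
Proof. exact: nuE. Qed.

(** The cells of a uniform grid that lie inside [U] form a chain of length below [d], so absolute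
    continuity bounds their Stieltjes mass by [e]. As the mesh tends to 0 these cells exhaust the
    open set, and continuity from below concludes. *)
Let U_bound (U : set R) d e : open U -> (mu (U `&` `]a, b]) < d%:E)%E ->
  (forall l, chain a l b -> clen l < d -> cvar V l < e) ->
  (nu (U `&` `]a, b]) <= e%:E)%E.
Proof.
move=> oU muU H.
pose S n : set R := \big[setU/set0]_(k < n.+1 | `[< cell n k `<=` U >]) cell n k.
have mcell n k : measurable (cell n k) by exact: measurable_itv.
have mS n : measurable (S n) by apply: bigsetU_measurable => k _; exact: mcell.
have step n : 0 <= (b - a) / n.+1%:R by rewrite divr_ge0// subr_ge0 ltW.
have endb n : a + (b - a) / n.+1%:R *+ n.+1 = b.
  by rewrite -mulr_natr divfK ?pnatr_eq0// addrC subrK.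
have cell_sub n (k : 'I_n.+1) : cell n k `<=` `]a, b].
  move=> x /cellP/andP[h1 h2]; rewrite /mkset in_itv /=; apply/andP; split.
    by apply: le_lt_trans h1; rewrite lerDl mulrn_wge0.
  by apply: (le_trans h2); rewrite -[leRHS](endb n) lerD2l ler_wpMn2l.
have SU n : S n `<=` U `&` `]a, b].
  rewrite /S => x; rewrite -bigcup_seq_cond => -[k /= /andP[_ /asboolP kU] xk].
  by split; [exact: kU|exact: cell_sub xk].
have nuS n : (nu (S n) <= e%:E)%E.
  pose l := [seq (a + (b - a) / n.+1%:R *+ k, a + (b - a) / n.+1%:R *+ k.+1) | k <- index_iota 0 n.+1 & `[< cell n k `<=` U >]].
  have cl : chain a l b.
    by rewrite /l /index_iota subn0; have := @grid_chain a ((b - a) / n.+1%:R) (fun k => `[< cell n k `<=` U >]) 0 n.+1 (step n);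
      rewrite mulr0n addr0 add0n endb.
  have lelen : clen l < d.
    rewrite -lte_fin; apply: le_lt_trans muU.
    have E : mu (S n) = (\sum_(i < n.+1 | `[< cell n i `<=` U >]) (a + (b - a) / n.+1%:R *+ i.+1 - (a + (b - a) / n.+1%:R *+ i)))%:E.
      rewrite -sumEFin; apply: eq_trans (measure_bigsetU_ord mu _ (fun=> mcell _ _) (@cell_triv n)) _.
      by apply: eq_bigr => k _; exact: mu_cell.
    have -> : clen l = \sum_(i < n.+1 | `[< cell n i `<=` U >]) (a + (b - a) / n.+1%:R *+ i.+1 - (a + (b - a) / n.+1%:R *+ i)).
      by rewrite /clen /l big_map big_filter big_mkord.
    rewrite -E; apply: le_measure; rewrite ?inE//; first exact: mS.
    by apply: measurableI => //; exact: open_measurable.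
  have /ltW := H l cl lelen; rewrite -lee_fin; apply: le_trans.
  have -> : nu (S n) = (\sum_(i < n.+1 | `[< cell n i `<=` U >]) (Vclamp (a + (b - a) / n.+1%:R *+ i.+1) - Vclamp (a + (b - a) / n.+1%:R *+ i)))%:E.
    rewrite -sumEFin; apply: eq_trans (measure_bigsetU_ord nu _ (fun=> mcell _ _) (@cell_triv n)) _.
    by apply: eq_bigr => k _; exact: nu_cell.
  rewrite lee_fin.
  rewrite /cvar /l big_map big_filter big_mkord.
  apply: ler_sum => k _.
  rewrite /= /Vclamp !clamp_id ?ler_norm ?lerDl ?mulrn_wge0//.
    by rewrite -[leRHS](endb n) lerD2l ler_wpMn2l// ltnW.
  by rewrite -[leRHS](endb n) lerD2l ler_wpMn2l.
(* Consecutive grids are not nested, so [S n] need not increase with [n]; the tail intersections do,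
   and they still exhaust the set. *)
pose T n : set R := \bigcap_(m in [set m | (n <= m)%N]) S m.
have mT n : measurable (T n) by apply: bigcap_measurable => [|m _]; [by exists n => /=|exact: mS].
have TS n : T n `<=` S n by apply: bigcap_inf => /=.
have UT : U `&` `]a, b] = \bigcup_n T n.
  rewrite eqEsubset; split => x; last by move=> [n _ /TS/SU].
  move=> [Ux xab]; have /nbhs_ballP[r /= r0 rU] : nbhs x U by apply: open_nbhs_nbhs.
  have r0' : 0 < r by [].
  (* From this index on the mesh is smaller than the radius [r] of a ball around [x] inside [U], so
     the cell containing [x] lies in [U]. *)
  exists (Num.truncn ((b - a) / r)) => // m /= nm.
  pose h := (b - a) / m.+1%:R.
  have h0 : 0 < h by rewrite divr_gt0 ?subr_gt0.
  have hr : h < r.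
    rewrite /h ltr_pdivrMr// mulrC -ltr_pdivrMr//.
    by apply: lt_le_trans (truncnS_gt _) _; rewrite ler_nat ltnS.
  move: xab; rewrite /mkset in_itv /= => /andP[ax xb].
  have [k km /andP[k1 k2]] : exists2 k, (k < m.+1)%N & a + h *+ k < x <= a + h *+ k.+1.
    have ex : exists k, x <= a + h *+ k.+1 by exists m; rewrite /h endb.
    exists (ex_minn ex); case: ex_minnP => k xk kmin.
      by rewrite ltnS; apply: kmin; rewrite /h endb.
    rewrite xk andbT; case: k xk kmin => [|k] xk kmin; first by rewrite mulr0n addr0.
    by rewrite ltNge; apply/negP => /kmin; rewrite ltnn.
  rewrite /S -bigcup_seq_cond; exists (Ordinal km) => /=.
    rewrite mem_index_enum /=; apply/asboolP => y /cellP/andP[y1 y2]; apply: rU.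
    rewrite /ball /=; move: y1 y2 k1 k2; rewrite -/h !mulrS => y1 y2 k1 k2.
    by rewrite ltr_distl; apply/andP; split; lra.
  by apply/cellP; rewrite -/h k1.
have ndT n m : (n <= m)%N -> T n `<=` T m.
  by move=> nm x Tx k mk; apply: Tx; exact: leq_trans nm mk.
have Tcvg : nu \o T @ \oo --> nu (\bigcup_n T n).
  apply: nondecreasing_cvg_mu => //; first by apply: bigcup_measurable => k _; exact: mT.
  by move=> n m nm; apply/subsetPset; exact: ndT.
rewrite UT -(cvg_lim _ Tcvg)//; apply: lime_le; first by apply/cvg_ex; eexists; exact: Tcvg.
apply: nearW => n; apply: le_trans (nuS n); apply: le_measure; rewrite ?inE//; first exact: mT.
exact: mS.
Qed.

(* The Stieltjes measure of F is absolutely continuous with respect to Lebesgue measure; the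
   density comes from the Radon-Nikodym theorem. *)
Lemma nondecreasing_AC_integral : exists f : R -> R,
  mu.-integrable [set: R] (EFin \o f) /\
  forall x, a <= x <= b -> V x - V a = \int[mu]_(t in `[a, x]) f t.
Proof.
have mab : measurable (`]a, b]%classic : set (measurableTypeR R)) by exact: measurable_itv.
have nuab : (nu `]a, b]%classic < +oo)%E by rewrite nuE ?ltry// ltW.
pose nuf := mfrestr mab nuab.
have dom : nuf `<< mu.
  apply/null_content_dominatesP => A mA A0.
  rewrite /nuf /mfrestr /mrestr; apply/eqP; rewrite eq_le measure_ge0 andbT.
  apply/lee_addgt0Pr => e e0; rewrite add0e.
  have [d d0 H] := acV e0.
  have muA : (mu A < +oo)%E by rewrite A0.
  (* A null set carries no chain of intervals of its own; it is first enlarged to an open set of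
     measure below [d]. *)
  have [U [oU AU Ue]] := lebesgue_regularity_outer mA muA d0.
  apply: (@le_trans _ _ (nu (U `&` `]a, b]))).
    apply: le_measure; rewrite ?inE.
    - exact: measurableI.
    - by apply: measurableI => //; exact: open_measurable.
    - by apply: setSI.
  apply: (U_bound oU _ H); apply: le_lt_trans Ue.
  apply: (@le_trans _ _ (mu U)).
    apply: le_measure; rewrite ?inE//.
      by apply: measurableI => //; exact: open_measurable.
    exact: open_measurable.
  have mU : measurable U by exact: open_measurable.
  rewrite -{1}(setDKU AU) measureU0//; exact: measurableD.
have [f [f0 ff fint fE]] := @radon_nikodym_sigma_finite _ _ _ mu nuf dom.
exists (fine \o f).
have fEf : EFin \o (fine \o f) = f by apply/funext => x; rewrite /= fineK.
rewrite fEf; split => // x /andP[ax xb].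
have : nuf `]a, x]%classic = (V x - V a)%:E.
  rewrite /nuf /mfrestr /mrestr setIidl; last first.
    by move=> y /=; rewrite !in_itv /= => /andP[-> h]; exact: le_trans h _.
  by rewrite nuE// /Vclamp !clamp_id// ltW.
move=> h; have := etrans (esym (fE _ (measurable_itv `]a, x]))) h.
rewrite integral_itv_obnd_cbnd; last first.
  by case/integrableP : fint => mf _; apply: measurable_funS mf.
move=> h2; have -> : \int[mu]_(t in `[a, x]) (fine \o f) t = fine (\int[mu]_(t in `[a, x]) f t)%E.
  by congr fine; apply: eq_integral => y _; rewrite /= fineK.
by rewrite h2.
Qed.

End Measure.

(** Jordan decomposition: [F] is the difference of the nondecreasing functions [V] and [V - F], both
    absolutely continuous, and each of them has a density. *)
Lemma chainAC_integral (F : R -> R) a b : a < b -> chainAC F a b ->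
  exists f : R -> R, mu.-integrable [set: R] (EFin \o f) /\
  forall x, a <= x <= b -> F x - F a = \int[mu]_(t in `[a, x]) f t.
Proof.
move=> ab acF; pose V := tvar F a; pose W x := V x - F x.
have acV : chainAC V a b by apply: tvar_chainAC => //; exact: ltW.
have acW : chainAC W a b by exact: chainAC_lin.
have dV x y : a <= x -> x <= y -> y <= b -> V y - V x = tvar F x y.
  by move=> ax xy yb; rewrite /V (@tvarD _ F a b (ltW ab) acF a x y)// addrAC subrr add0r.
have ndV x y : a <= x -> x <= y -> y <= b -> V x <= V y.
  move=> ax xy yb; rewrite -subr_ge0 dV//.
  by apply: le_trans (norm_tvar (ltW ab) acF ax xy yb).
have ndW x y : a <= x -> x <= y -> y <= b -> W x <= W y.
  move=> ax xy yb; rewrite /W -subr_ge0.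
  have := norm_tvar (ltW ab) acF ax xy yb; rewrite -dV// ler_norml; lra.
have [f [fi fE]] := nondecreasing_AC_integral ab ndV acV.
have [g [gi gE]] := nondecreasing_AC_integral ab ndW acW.
exists (f \- g); split.
  exact: (integrableB measurableT fi gi).
move=> x axb; rewrite RintegralB//; first last.
- by apply: integrableS gi.
- by apply: integrableS fi.
by rewrite -fE// -gE// /W; ring.
Qed.

End StieltjesAC.

(** * Locally absolutely continuous functions *)

Section Primitives.
Context {R : realType}.
Notation mu := (@lebesgue_measure R).
Implicit Types F G g h : R -> R.

Lemma ae_imply (P Q : R -> Prop) : (forall x, P x -> Q x) ->
  {ae mu, forall x, P x} -> {ae mu, forall x, Q x}.
Proof. by move=> PQ; apply: (@filterS _ _ (ae_filter_ringOfSetsType mu)). Qed.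

Lemma ae_imply2 (P1 P2 Q : R -> Prop) : (forall x, P1 x -> P2 x -> Q x) ->
  {ae mu, forall x, P1 x} -> {ae mu, forall x, P2 x} -> {ae mu, forall x, Q x}.
Proof. by move=> PQ; apply: (@filterS2 _ _ (ae_filter_ringOfSetsType mu)). Qed.

Lemma ae_all (P : R -> Prop) : (forall x, P x) -> {ae mu, forall x, P x}.
Proof. by move=> H; apply: (@filterE _ _ (ae_filter_ringOfSetsType mu)). Qed.

Lemma lebesgue_itvoo (x y : R) : x <= y -> mu `]x, y[%classic = (y - x)%:E.
Proof.
move=> xy; rewrite lebesgue_measure_itv /= lte_fin.
by case: ltgtP xy => // -> _; rewrite subrr.
Qed.

Definition rAC F := forall a b e : R, a <= b -> 0 < e -> exists2 d : R, 0 < d &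
    forall (n : nat) (s t : 'I_n -> R),
      (forall i, a <= s i /\ s i <= t i /\ t i <= b) ->
      trivIset [set: 'I_n] (fun i => `]s i, t i[%classic) ->
      \sum_(i < n) (t i - s i) < d ->
      \sum_(i < n) `|F (t i) - F (s i)| < e.

(** Working form of local absolute continuity, with the density as explicit data; [rprim_AC] and
    [rAC_primitive] pass between it and the epsilon-delta form. *)
Definition rprim F g := [/\ measurable_fun [set: R] g,
  forall a b : R, mu.-integrable `[a, b] (EFin \o g) &
  forall a b : R, a <= b -> F b - F a = \int[mu]_(t in `[a, b]) g t].

Lemma rAC_chainAC F a b : a <= b -> rAC F -> chainAC F a b.
Proof. by move=> ab FAC; apply: chainAC_of_AC => // e; exact: FAC. Qed.

Lemma rAC_continuous F : rAC F -> continuous F.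
Proof.
move=> FAC x; apply/cvgrPdist_lt => e e0.
have [d d0 H] := @rAC_chainAC F (x - 1) (x + 1) ltac:(lra) FAC e e0.
have K y z : x - 1 <= y -> z <= x + 1 -> y <= z -> z - y < d -> `|F z - F y| < e.
  move=> xy zx yz zyd; have := H [:: (y, z)].
  by rewrite /= /clen /cvar !big_seq1 /=; apply => //; rewrite xy yz.
near=> y.
have xyd : `|x - y| < d by near: y; exact: cvgr_dist_lt.
have xy1 : `|x - y| < 1 by near: y; exact: cvgr_dist_lt.
move: xyd xy1; have [xy|/ltW yx] := leP x y.
  by rewrite !(distrC x) (distrC (F x)) ger0_norm ?subr_ge0// => ? ?; apply: K => //; lra.
by rewrite ger0_norm ?subr_ge0// => ? ?; apply: K => //; lra.
Unshelve. all: by end_near. Qed.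

Lemma integrable_ae_eq (D : set R) (f h : R -> R) : measurable D ->
  mu.-integrable D (EFin \o f) -> measurable_fun D h ->
  {ae mu, forall x, D x -> f x = h x} -> mu.-integrable D (EFin \o h).
Proof.
move=> mD /integrableP[mf fi] mh fh; apply/integrableP; split.
  exact/measurable_EFinP.
rewrite (_ : integral _ _ _ = \int[mu]_(x in D) `|(EFin \o f) x|)%E//.
apply: ae_eq_integral => //.
- by apply: measurableT_comp => //; exact/measurable_EFinP.
- by apply: measurableT_comp.
- by apply: ae_imply fh => x fh Dx; rewrite /= fh.
Qed.

Lemma Rintegral_ae (D : set R) (f h : R -> R) : measurable D ->
  measurable_fun D f -> measurable_fun D h ->
  {ae mu, forall x, D x -> f x = h x} -> \int[mu]_(x in D) f x = \int[mu]_(x in D) h x.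
Proof.
move=> mD mf mh fh; congr fine; apply: ae_eq_integral => //; try exact/measurable_EFinP.
by apply: ae_imply fh => x fh Dx; rewrite /= fh.
Qed.

Lemma rprim_ae F g h : rprim F g -> measurable_fun [set: R] h ->
  {ae mu, forall x, g x = h x} -> rprim F h.
Proof.
move=> [mg gi gE] mh gh; split => // [a b|a b ab].
  apply: (@integrable_ae_eq _ g) => //; first exact: measurable_funTS.
  by apply: ae_imply gh => x ->.
rewrite gE//; apply: Rintegral_ae => //; try exact: measurable_funTS.
by apply: ae_imply gh => x ->.
Qed.

Lemma rprim_locally F g : rprim F g -> locally_integrable [set: R] g.
Proof.
move=> [mg gi gE]; split => //; first exact: openT.
move=> K _ cK.
have [M [_ HM]] := compact_bounded cK.
pose N := `|M| + 1.
have KN : K `<=` `[- N, N]%classic.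
  move=> x Kx; rewrite /mkset in_itv /=; rewrite -ler_norml.
  by apply: (HM _ _ x Kx); rewrite /N (le_lt_trans (ler_norm _))// ltrDl.
have /integrableP[_] := gi (- N) N.
apply: le_lt_trans; apply: ge0_subset_integral => //=.
- exact: compact_measurable.
- apply/measurable_EFinP; apply: measurableT_comp => //; exact: measurable_funTS.
Qed.

Lemma near_addc_derive F G (c x : R) : (\near x, c + G x = F x) ->
  derivable G x 1 -> derivable F x 1 /\ derive1 F x = derive1 G x.
Proof.
move=> nr dG; have dc := derivableD (derivable_cst c x 1) dG.
split; first by apply: near_eq_derivable dc.
rewrite !derive1E -(near_eq_derive _ nr); apply: etrans (deriveD (derivable_cst c x 1) dG) _.
by rewrite derive_cst add0r.
Qed.

(** Lebesgue differentiation needs a starting point for the integral. Starting at -n covers the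
    points to the right of -n, and countably many null sets are discarded. *)
Lemma rprim_derive F g : rprim F g -> {ae mu, forall x, derivable F x 1 /\ derive1 F x = g x}.
Proof.
move=> Fg; have locg := rprim_locally Fg; have [mg gi gE] := Fg.
have : forall n : nat, {ae mu, forall x, - n%:R < x -> derivable F x 1 /\ derive1 F x = g x}.
  move=> n; have := @FTC1 R g (BLeft (- n%:R)) (gi (- n%:R)) locg.
  apply: ae_imply => x H nx.
  have [|dx ex] := H; first by rewrite lte_fin.
  have nr : \near x, F (- n%:R) + \int[mu]_(t in `[(- n%:R), x]) g t = F x.
    near=> y; have <- := gE (- n%:R) y; first by rewrite addrC subrK.
    by near: y; exact: lt_le_nbhsr.
  by have [? ->] := near_addc_derive nr dx.
move=> /ae_foralln; apply: ae_imply => x H; apply: (H (Num.truncn `|x|).+1).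
by rewrite ltrNl (le_lt_trans (ler_norm _))// normrN truncnS_gt.
Unshelve. all: by end_near. Qed.

Lemma rprim_AC F g : rprim F g -> rAC F.
Proof.
move=> [mg gi gE] a b e ab e0.
(* Cutting [g] off makes it integrable on the whole line, where absolute continuity of the integral
   is available. *)
pose f := g \_ `[a, b].
have fi : mu.-integrable setT (EFin \o f).
  by rewrite /f -restrict_EFin; apply/integrable_restrict => //; rewrite setTI.
have [d [d0 H]] := integral_normr_continuous fi e0.
exists d => // n s t sab tri sd.
pose A := \big[setU/set0]_(i < n) `]s i, t i[%classic.
have mI (i : 'I_n) : measurable (`]s i, t i[%classic : set R) by exact: measurable_itv.
have mA : measurable A by exact: bigsetU_measurable.
have muA : mu A = (\sum_(i < n) (t i - s i))%:E.
  rewrite -sumEFin; apply: eq_trans (measure_bigsetU_ord mu _ mI tri) _.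
  by apply: eq_bigr => i _; apply: lebesgue_itvoo; have [_ []] := sab i.
have muAd : (mu A < d%:E)%E by rewrite muA lte_fin.
have := H A mA muAd; apply: le_lt_trans.
have fin (i : 'I_n) : mu.-integrable `]s i, t i[ (EFin \o (fun x => `|f x|)).
  have : mu.-integrable setT (abse \o (EFin \o f)) by exact: integrable_abse.
  by apply: integrableS.
have -> : \int[mu]_(x in A) `|f x| = \sum_(i < n) \int[mu]_(x in `]s i, t i[) `|f x|.
  rewrite /Rintegral ge0_integral_bigsetU//=.
  - by rewrite -sum_fine// => i _; apply: integrable_fin_num => //; exact: fin.
  - exact: index_enum_uniq.
  - by apply: sub_trivIset tri.
  - apply/measurable_EFinP; apply: measurableT_comp => //.
    by case/integrableP : fi => /measurable_EFinP + _; exact: measurable_funTS.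
apply: ler_sum => i _; have [as_ [st tb]] := sab i.
have sub : `[s i, t i] `<=` `[a, b].
  by move=> x; rewrite /mkset !in_itv /= => /andP[h1 h2]; apply/andP; split; lra.
have -> : \int[mu]_(x in `]s i, t i[) `|f x| = \int[mu]_(x in `[s i, t i]) `|g x|.
  have gii : mu.-integrable `[s i, t i] (EFin \o (fun x => `|g x|)).
    have : mu.-integrable `[s i, t i] (abse \o (EFin \o g)) by exact: integrable_abse.
    by [].
  rewrite -Rintegral_itv_obnd_cbnd; last by apply: integrableS gii => //; apply: subset_itvr; rewrite bnd_simp.
  rewrite -Rintegral_itv_bndo_bndc; last by apply: integrableS gii => //; apply: subset_itv; rewrite bnd_simp.
  apply: eq_Rintegral => x; rewrite inE => xst; rewrite /f patchE ifT// inE.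
  by apply: sub; move: xst; rewrite /mkset !in_itv /= => /andP[/ltW -> /ltW ->].
by rewrite gE//; apply: le_normr_Rintegral => //.
Qed.

(** The densities given by [chainAC_integral] depend on the interval. The upper limit of difference
    quotients along 1/(n+1) is a single measurable function that equals the derivative wherever it
    exists, hence agrees almost everywhere with each of these densities. *)
Lemma rAC_primitive F : rAC F -> exists g, rprim F g.
Proof.
move=> FAC; have cF := rAC_continuous FAC.
pose D (n : nat) (x : R) : \bar R := (n.+1%:R * (F (x + n.+1%:R^-1) - F x))%:E.
have mD n : measurable_fun [set: R] (D n).
  apply/measurable_EFinP; apply: continuous_measurable_fun => x.
  apply: cvgM; first exact: cvg_cst.
  apply: cvgB; last exact: cF.
  by apply: (@cvg_comp _ _ _ (fun x => x + n.+1%:R^-1) F); [apply: cvgD; [exact: cvg_id|exact: cvg_cst]|exact: cF].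
pose g x := fine (limn_esup (D ^~ x)).
have mg : measurable_fun [set: R] g.
  apply: measurableT_comp; first exact: fine_measurable.
  exact: measurable_fun_limn_esup.
have gderiv x : derivable F x 1 -> g x = derive1 F x.
  move=> dF; rewrite /g.
  have Dx : D ^~ x @ \oo --> (derive1 F x)%:E.
    apply/cvg_EFin; first by apply: nearW.
    have /cvg_ex[l Hl] := dF.
    have -> : derive1 F x = l by rewrite derive1E; apply: cvg_lim.
    have hd : @harmonic R @ \oo --> 0^'.
      move=> A /= [e /= e0 HA]; suff : \forall n \near \oo, A (harmonic n) by [].
      near=> n; apply: HA => //=.
      rewrite sub0r normrN; near: n.
      by apply: cvgr0_norm_lt => //; exact: cvg_harmonic.
    have := cvg_comp _ _ hd Hl.
    apply: cvg_trans; apply: near_eq_cvg; apply: nearW => n /=.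
    by rewrite /D /= invrK /GRing.scale /= mulr1 [_ + x]addrC.
  by have [_ ->] := cvg_limn_einf_sup Dx.
have key a b : a < b -> exists f, [/\ mu.-integrable [set: R] (EFin \o f),
    F b - F a = \int[mu]_(t in `[a, b]) f t & {ae mu, forall x, `[a, b]%classic x -> f x = g x}].
  (* One unit of margin on both sides puts every point of [a, b], endpoints included, in the
     interior, where the primitive can be differentiated. *)
  move=> ab; have ab1 : a - 1 < b + 1 by lra.
  have [f [fi fE]] := chainAC_integral ab1 (rAC_chainAC (ltW ab1) FAC).
  exists f; split => //.
    have -> : F b - F a = (F b - F (a - 1)) - (F a - F (a - 1)) by ring.
    rewrite !fE; try by apply/andP; split; lra.
    rewrite Rintegral_itvB; try (by rewrite bnd_simp; lra).
      rewrite Rintegral_itv_obnd_cbnd//; exact: integrableS fi.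
    exact: integrableS fi.
  have fiS y : mu.-integrable [set` Interval (BLeft (a - 1)) (BRight y)] (EFin \o f) by apply: integrableS fi.
  have := @FTC1 R f (BLeft (a - 1)) fiS (open_integrable_locally openT fi).
  apply: ae_imply => x H; rewrite /mkset in_itv /= => /andP[ax xb].
  have [|dx ex] := H; first by rewrite lte_fin; lra.
  have nr : \near x, F (a - 1) + \int[mu]_(t in `[a - 1, x]) f t = F x.
    near=> y; have <- := fE y; first by rewrite addrC subrK.
    apply/andP; split; near: y; [apply: lt_le_nbhsr|apply: lt_le_nbhsl]; lra.
  by have [dF dFE] := near_addc_derive nr dx; rewrite gderiv// dFE ex.
have keyi a b : mu.-integrable `[a, b] (EFin \o g).
  have [ab|ba] := ltP a b.
    have [f [fi fE fg]] := key a b ab.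
    apply: (@integrable_ae_eq _ f) => //; last exact: measurable_funTS.
    by apply: integrableS fi.
  apply/integrableP; split; first by apply/measurable_EFinP; exact: measurable_funTS.
  rewrite (@integral_Sset1 _ _ _ a)// => x; rewrite /mkset in_itv /= => /andP[ax xb].
  by apply/eqP; rewrite eq_le ax (le_trans xb ba).
exists g; split => // a b; rewrite le_eqVlt => /orP[/eqP <-|ab].
  by rewrite set_itv1 Rintegral_set1 subrr.
have [f [fi fE fg]] := key a b ab.
rewrite fE; apply: Rintegral_ae => //; last exact: measurable_funTS.
by case/integrableP : fi => /measurable_EFinP + _; exact: measurable_funTS.
Unshelve. all: by end_near. Qed.

Lemma rprimD F G g h : rprim F g -> rprim G h -> rprim (fun x => F x + G x) (fun x => g x + h x).
Proof.
move=> [mg gi gE] [mh hi hE]; split.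
- exact: measurable_funD.
- by move=> a b; apply: (integrableD _ (gi a b) (hi a b)).
- by move=> a b ab; rewrite RintegralD// -gE// -hE//; ring.
Qed.

Lemma rprimZ F g c : rprim F g -> rprim (fun x => c * F x) (fun x => c * g x).
Proof.
move=> [mg gi gE]; split.
- exact: measurable_funM.
- by move=> a b; apply: (integrableZl _ c (gi a b)).
- by move=> a b ab; rewrite RintegralZl// -gE//; ring.
Qed.

Lemma rAC_mul F G : rAC F -> rAC G -> rAC (fun x => F x * G x).
Proof.
move=> HF HG a b e ab e0.
have cF := rAC_continuous HF; have cG := rAC_continuous HG.
have bnd (H : R -> R) : continuous H -> exists2 M, 0 < M & forall x, a <= x <= b -> `|H x| <= M.
  move=> cH; have [|c _ Hc] := @EVT_max R (fun x => `|H x|) a b ab.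
    by apply: continuous_subspaceT => x; apply: cvg_norm; exact: cH.
  exists (`|H c| + 1); first by rewrite ltr_wpDl.
  by move=> x xab; apply: (le_trans (Hc x _)); rewrite ?in_itv// lerDl.
have [M M0 FM] := bnd F cF; have [N N0 GN] := bnd G cG.
have [d1 d10 {}HF] := HF a b (e / (2 * N)) ab ltac:(by rewrite divr_gt0// mulr_gt0).
have [d2 d20 {}HG] := HG a b (e / (2 * M)) ab ltac:(by rewrite divr_gt0// mulr_gt0).
exists (Num.min d1 d2); first by rewrite lt_min d10.
move=> n s t st tri; rewrite lt_min => /andP[l1 l2].
have := HF n s t st tri l1; have := HG n s t st tri l2.
set SG := \sum_(i < n) `|G _ - _|; set SF := \sum_(i < n) `|F _ - _| => hG hF.
apply: (@le_lt_trans _ _ (M * SG + N * SF)).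
  rewrite /SG /SF !mulr_sumr -big_split /=; apply: ler_sum => i _.
  have [h1 [h2 h3]] := st i.
  have -> : F (t i) * G (t i) - F (s i) * G (s i) = F (t i) * (G (t i) - G (s i)) + (F (t i) - F (s i)) * G (s i) by ring.
  apply: (le_trans (ler_normD _ _)); rewrite !normrM; apply: lerD.
    by apply: ler_wpM2r => //; apply: FM; apply/andP; split => //; lra.
  by rewrite mulrC; apply: ler_wpM2r => //; apply: GN; apply/andP; split => //; lra.
have -> : e = M * (e / (2 * M)) + N * (e / (2 * N)).
  by field; apply/andP; split; rewrite gt_eqF.
by apply: ltrD; rewrite ltr_pM2l.
Qed.

(** The product is absolutely continuous, so it has some density; the pointwise product rule at
    almost every point identifies it. *)
Lemma rprimM F G g h : rprim F g -> rprim G h ->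
  rprim (fun x => F x * G x) (fun x => g x * G x + F x * h x).
Proof.
move=> Fg Gh; have [k Hk] := rAC_primitive (rAC_mul (rprim_AC Fg) (rprim_AC Gh)).
have mc H j : rprim H j -> measurable_fun [set: R] H.
  by move=> /rprim_AC/rAC_continuous; exact: continuous_measurable_fun.
apply: (rprim_ae Hk).
  have [mg _ _] := Fg; have [mh _ _] := Gh.
  apply: measurable_funD; apply: measurable_funM => //; [exact: mc Gh|exact: mc Fg].
have H1 := rprim_derive Fg; have H2 := rprim_derive Gh; have H3 := rprim_derive Hk.
have : {ae mu, forall x, (derivable F x 1 /\ derive1 F x = g x) /\ (derivable G x 1 /\ derive1 G x = h x)}.
  by apply: ae_imply2 H1 H2 => x.
move=> H12; apply: ae_imply2 H12 H3 => x [[dF <-] [dG <-]] [_ <-].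
rewrite !derive1E; apply: etrans (deriveM dF dG) _.
by rewrite /GRing.scale /= addrC mulrC.
Qed.

End Primitives.

(** * Complex-valued primitives *)

Section ComplexPrimitives.
Context {R : realType}.
Notation mu := (@lebesgue_measure R).
Notation C := (R[i]).
Implicit Types (z w : C) (F G g h : R -> C).

(* A submultiplicative real norm that splits integrals into real and imaginary parts. *)
Definition n1 z : R := `|complex.Re z| + `|complex.Im z|.

Lemma n1_ge0 z : 0 <= n1 z.
Proof. by rewrite /n1 addr_ge0. Qed.

Lemma n10 : n1 0 = 0.
Proof. by rewrite /n1 /= normr0 addr0. Qed.

Lemma n1N z : n1 (- z) = n1 z.
Proof. by case: z => a b; rewrite /n1 /= !normrN. Qed.

Lemma n1D z w : n1 (z + w) <= n1 z + n1 w.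
Proof. by case: z => a b; case: w => c d; rewrite /n1 /= addrACA lerD// ler_normD. Qed.

Lemma n1B z w : n1 (z - w) <= n1 z + n1 w.
Proof. by rewrite -(n1N w) n1D. Qed.

Lemma n1M z w : n1 (z * w) <= n1 z * n1 w.
Proof.
case: z => a b; case: w => c d; rewrite /n1 /=.
have h1 : `|a * c - b * d| <= `|a| * `|c| + `|b| * `|d| by rewrite -!normrM ler_normB.
have h2 : `|a * d + b * c| <= `|a| * `|d| + `|b| * `|c| by rewrite -!normrM ler_normD.
lra.
Qed.

Lemma n1_real (a : R) z : n1 ((a%:C)%C * z) = `|a| * n1 z.
Proof.
by case: z => c d; rewrite /n1 /= !mul0r subr0 addr0 !normrM mulrDr.
Qed.

Lemma n1_eq0 z : n1 z = 0 -> z = 0.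
Proof.
case: z => a b; rewrite /n1 /= => /eqP; rewrite paddr_eq0// !normr_eq0.
by move=> /andP[/eqP -> /eqP ->].
Qed.

Lemma normc_n1 z : ComplexField.Normc.normc z <= n1 z.
Proof.
case: z => a b; rewrite /n1 /=.
have h : 0 <= `|a| + `|b| by rewrite addr_ge0.
rewrite -[leRHS](ger0_norm h) -sqrtr_sqr ler_wsqrtr// sqrrD !real_normK ?num_real//.
by rewrite addrAC lerDl mulrn_wge0// mulr_ge0.
Qed.

Lemma n1_normc z : n1 z <= 2 * ComplexField.Normc.normc z.
Proof.
case: z => a b; rewrite /n1 /=.
have h1 : `|a| <= Num.sqrt (a ^+ 2 + b ^+ 2) by rewrite -sqrtr_sqr ler_wsqrtr// lerDl sqr_ge0.
have h2 : `|b| <= Num.sqrt (a ^+ 2 + b ^+ 2) by rewrite -sqrtr_sqr ler_wsqrtr// lerDr sqr_ge0.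
lra.
Qed.

Lemma n1_sq_normc z : n1 z ^+ 2 <= 2 * ComplexField.Normc.normc z ^+ 2.
Proof.
case: z => a b; rewrite /n1 /= sqr_sqrtr ?addr_ge0 ?sqr_ge0//.
rewrite -[a ^+ 2]real_normK ?num_real// -[b ^+ 2]real_normK ?num_real//.
have := sqr_ge0 (`|a| - `|b|); rewrite !expr2; lra.
Qed.

Definition cprim F g := rprim (re F) (re g) /\ rprim (im F) (im g).

Lemma AC_locP F : AC_loc F <-> rAC (re F) /\ rAC (im F).
Proof.
split.
  move=> HF; split => a b e ab e0; have [d d0 {}HF] := HF a b e ab e0; exists d => // n s t st tri l.
    apply: le_lt_trans (HF n s t st tri l); apply: ler_sum => i _.
    have -> : re F (t i) - re F (s i) = complex.Re (F (t i) - F (s i)) by rewrite /re; case: (F _) => ? ?; case: (F _).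
    by case: (F (t i) - F (s i)) => p q /=; rewrite -sqrtr_sqr ler_wsqrtr// lerDl sqr_ge0.
  apply: le_lt_trans (HF n s t st tri l); apply: ler_sum => i _.
  have -> : im F (t i) - im F (s i) = complex.Im (F (t i) - F (s i)) by rewrite /im; case: (F _) => ? ?; case: (F _).
  by case: (F (t i) - F (s i)) => p q /=; rewrite -sqrtr_sqr ler_wsqrtr// lerDr sqr_ge0.
move=> [H1 H2] a b e ab e0.
have [d1 d10 {}H1] := H1 a b (e / 2) ab ltac:(lra).
have [d2 d20 {}H2] := H2 a b (e / 2) ab ltac:(lra).
exists (Num.min d1 d2); first by rewrite lt_min d10.
move=> n s t st tri; rewrite lt_min => /andP[l1 l2].
apply: (@le_lt_trans _ _ (\sum_(i < n) `|re F (t i) - re F (s i)| + \sum_(i < n) `|im F (t i) - im F (s i)|)).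
  rewrite -big_split /=; apply: ler_sum => i _; apply: (le_trans (normc_n1 _)).
  by rewrite /n1 /re /im; case: (F _) => ? ?; case: (F _) => ? ?.
have := H1 n s t st tri l1; have := H2 n s t st tri l2; lra.
Qed.

Lemma cprim_AC F g : cprim F g -> AC_loc F.
Proof. by move=> [H1 H2]; apply/AC_locP; split; [exact: rprim_AC H1|exact: rprim_AC H2]. Qed.

Lemma cprim_derive F g : cprim F g -> {ae mu, forall x, cderive F x = g x}.
Proof.
move=> [/rprim_derive H1 /rprim_derive H2]; apply: ae_imply2 H1 H2 => x [_ e1] [_ e2].
by rewrite /cderive /cderiven /= e1 e2 /re /im; case: (g x).
Qed.

Lemma AC_cprim F : AC_loc F -> exists g, cprim F g.
Proof.
move=> /AC_locP[/rAC_primitive[g1 H1] /rAC_primitive[g2 H2]].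
by exists (fun x => Complex (g1 x) (g2 x)).
Qed.

Lemma cprim_ae F g h : cprim F g -> cmeasurable h -> {ae mu, forall x, g x = h x} -> cprim F h.
Proof.
move=> [H1 H2] [m1 m2] gh; split; [apply: rprim_ae H1 m1 _|apply: rprim_ae H2 m2 _];
  by apply: ae_imply gh => x; rewrite /re /im => ->.
Qed.

Lemma cprimD F G g h : cprim F g -> cprim G h -> cprim (fun x => F x + G x) (fun x => g x + h x).
Proof.
move=> [H1 H2] [K1 K2]; split.
  have := rprimD H1 K1; congr (rprim _ _); apply/funext => x; rewrite /re;
  [case: (F x); case: (G x)|case: (g x); case: (h x)]; by [].
have := rprimD H2 K2; congr (rprim _ _); apply/funext => x; rewrite /im;
  [case: (F x); case: (G x)|case: (g x); case: (h x)]; by [].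
Qed.

Lemma rprim_cst (c : R) : rprim (fun=> c) (fun=> 0).
Proof.
split; first exact: measurable_cst.
  by move=> a b; apply: integrable0.
by move=> a b ab; rewrite subrr /Rintegral integral0.
Qed.

Lemma cprim_cst z : cprim (fun=> z) (fun=> 0).
Proof. by split; exact: rprim_cst. Qed.

Lemma cprimM F G g h : cprim F g -> cprim G h ->
  cprim (fun x => F x * G x) (fun x => g x * G x + F x * h x).
Proof.
move=> [H1 H2] [K1 K2]; split.
  have := rprimD (rprimM H1 K1) (rprimZ (-1) (rprimM H2 K2)).
  congr (rprim _ _); apply/funext => x; rewrite /re /im;
  by case: (F x); case: (G x); case: (g x); case: (h x) => *; rewrite /=; ring.
have := rprimD (rprimM H1 K2) (rprimM H2 K1).
congr (rprim _ _); apply/funext => x; rewrite /re /im;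
  by case: (F x); case: (G x); case: (g x); case: (h x) => *; rewrite /=; ring.
Qed.

Lemma cprimZ F g z : cprim F g -> cprim (fun x => z * F x) (fun x => z * g x).
Proof.
move=> H; have := cprimM (cprim_cst z) H; congr (cprim _ _).
by apply/funext => x; rewrite mul0r add0r.
Qed.

Lemma cmeasurableD F G : cmeasurable F -> cmeasurable G -> cmeasurable (fun x => F x + G x).
Proof.
move=> [a b] [c d]; split.
  have := measurable_funD a c; congr (measurable_fun _ _); apply/funext => x /=.
  by rewrite /re; case: (F x); case: (G x).
have := measurable_funD b d; congr (measurable_fun _ _); apply/funext => x /=.
by rewrite /im; case: (F x); case: (G x).
Qed.

Lemma cmeasurableN F : cmeasurable F -> cmeasurable (fun x => - F x).
Proof.
move=> [a b]; split.
  have := measurable_funN a; congr (measurable_fun _ _); apply/funext => x /=.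
  by rewrite /re; case: (F x).
have := measurable_funN b; congr (measurable_fun _ _); apply/funext => x /=.
by rewrite /im; case: (F x).
Qed.

Lemma cmeasurableB F G : cmeasurable F -> cmeasurable G -> cmeasurable (fun x => F x - G x).
Proof. by move=> mF /cmeasurableN mG; exact: cmeasurableD. Qed.

Lemma cmeasurableM F G : cmeasurable F -> cmeasurable G -> cmeasurable (fun x => F x * G x).
Proof.
move=> [a b] [c d]; split.
  have := measurable_funB (measurable_funM a c) (measurable_funM b d).
  congr (measurable_fun _ _); apply/funext => x /=.
  by rewrite /re /im; case: (F x); case: (G x).
have := measurable_funD (measurable_funM a d) (measurable_funM b c).
congr (measurable_fun _ _); apply/funext => x /=.
by rewrite /im /re; case: (F x); case: (G x).
Qed.

Lemma cmeasurable_cst z : cmeasurable (fun _ : R => z).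
Proof. by split; exact: measurable_cst. Qed.

Lemma measurable_n1 F : cmeasurable F -> measurable_fun [set: R] (fun x => n1 (F x)).
Proof.
by move=> [a b]; apply: measurable_funD; apply: measurableT_comp.
Qed.

Lemma cprim_measurable F g : cprim F g -> cmeasurable F.
Proof.
by move=> [/rprim_AC/rAC_continuous H1 /rprim_AC/rAC_continuous H2]; split; exact: continuous_measurable_fun.
Qed.

(** Real and imaginary parts are estimated separately and added; since [n1] is exactly their sum,
    the inequality holds with constant 1. *)
Lemma cprim_n1 F g (a b : R) : cprim F g -> a <= b ->
  ((n1 (F b - F a))%:E <= \int[mu]_(x in `[a, b]) (n1 (g x))%:E)%E.
Proof.
move=> [[m1 i1 E1] [m2 i2 E2]] ab.
have -> : n1 (F b - F a) = `|re F b - re F a| + `|im F b - im F a|.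
  by rewrite /n1 /re /im; case: (F b) => ? ?; case: (F a) => ? ?.
rewrite E1// E2// EFinD /n1.
under eq_integral do rewrite EFinD.
rewrite ge0_integralD//=; first last.
- by apply/measurable_EFinP/measurable_funTS; apply: measurableT_comp.
- by apply/measurable_EFinP/measurable_funTS; apply: measurableT_comp.
by apply: leeD; rewrite EFin_normr_Rintegral//; apply: le_abse_integral => //;
  apply/measurable_EFinP; exact: measurable_funTS.
Qed.

End ComplexPrimitives.

(** * The kernel exp(-nu |x - s|) *)

Section ExpKernel.
Context {R : realType}.
Notation mu := (@lebesgue_measure R).
Implicit Types (w v : R -> R) (nu x y s t : R).

Lemma ge0_integralM (D : set R) (c : R) (f : R -> R) : measurable D ->
  measurable_fun D f -> (forall x, 0 <= f x) -> 0 <= c ->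
  (\int[mu]_(x in D) (c * f x)%:E = c%:E * \int[mu]_(x in D) (f x)%:E)%E.
Proof.
move=> mD mf f0 c0; under eq_integral do rewrite EFinM.
rewrite ge0_integralZl//; first exact/measurable_EFinP.
by move=> x _; rewrite lee_fin.
Qed.

Definition kexp nu w x : \bar R := (\int[mu]_s (expR (- (nu * `|x - s|)) * w s)%:E)%E.

Lemma kexp_sym_measurable nu w : measurable_fun [set: R] w ->
  measurable_fun [set: R * R] (fun z : R * R => (expR (- (nu * `|z.1 - z.2|)) * w z.2)%:E).
Proof.
move=> mw; apply/measurable_EFinP; apply: measurable_funM.
  apply: measurableT_comp => //; apply: measurable_funN; apply: measurable_funM => //.
  by apply: measurableT_comp => //; apply: measurable_funB.
by apply: measurableT_comp.
Qed.

Lemma measurable_kexp_integrand nu w x : measurable_fun [set: R] w ->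
  measurable_fun [set: R] (fun s => expR (- (nu * `|x - s|)) * w s).
Proof.
move=> mw; apply: measurable_funM => //.
apply: measurableT_comp => //; apply: measurable_funN; apply: measurable_funM => //.
by apply: measurableT_comp => //; apply: measurable_funB.
Qed.

Lemma kexp_ge0 nu w x : (forall s, 0 <= w s) -> (0 <= kexp nu w x)%E.
Proof. by move=> w0; apply: integral_ge0 => s _; rewrite lee_fin mulr_ge0 ?expR_ge0. Qed.

Lemma measurable_kexp nu w : measurable_fun [set: R] w -> (forall s, 0 <= w s) ->
  measurable_fun [set: R] (kexp nu w).
Proof.
move=> mw w0; apply: (@measurable_fun_fubini_tonelli_F _ _ _ _ R mu _ (kexp_sym_measurable nu mw)).
by move=> z; rewrite lee_fin mulr_ge0 ?expR_ge0.
Qed.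

Lemma kexp_le nu w v x : measurable_fun [set: R] w -> measurable_fun [set: R] v ->
  (forall s, 0 <= w s <= v s) -> (kexp nu w x <= kexp nu v x)%E.
Proof.
move=> mw mv wv; apply: ge0_le_integral => //.
- by move=> s _; have /andP[w0 _] := wv s; rewrite lee_fin mulr_ge0 ?expR_ge0.
- by apply/measurable_EFinP; exact: measurable_kexp_integrand.
- by apply/measurable_EFinP; exact: measurable_kexp_integrand.
- by move=> s _; have /andP[_ ?] := wv s; rewrite lee_fin ler_wpM2l ?expR_ge0.
Qed.

Lemma kexp_nu nu nu' w x : measurable_fun [set: R] w -> (forall s, 0 <= w s) -> nu <= nu' ->
  (kexp nu' w x <= kexp nu w x)%E.
Proof.
move=> mw w0 nn; apply: ge0_le_integral => //.
- by move=> s _; rewrite lee_fin mulr_ge0 ?expR_ge0.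
- by apply/measurable_EFinP; exact: measurable_kexp_integrand.
- by apply/measurable_EFinP; exact: measurable_kexp_integrand.
- by move=> s _; rewrite lee_fin ler_wpM2r// ler_expR lerN2 ler_wpM2r.
Qed.

Lemma kexpD nu w v x : measurable_fun [set: R] w -> measurable_fun [set: R] v ->
  (forall s, 0 <= w s) -> (forall s, 0 <= v s) ->
  (kexp nu (fun s => w s + v s)%R x = kexp nu w x + kexp nu v x)%E.
Proof.
move=> mw mv w0 v0; rewrite /kexp -ge0_integralD//=.
- by apply: eq_integral => s _; rewrite -EFinD mulrDr.
- by move=> s _; rewrite lee_fin mulr_ge0 ?expR_ge0.
- by apply/measurable_EFinP; exact: measurable_kexp_integrand.
- by move=> s _; rewrite lee_fin mulr_ge0 ?expR_ge0.
- by apply/measurable_EFinP; exact: measurable_kexp_integrand.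
Qed.

Lemma kexpZ nu w x c : measurable_fun [set: R] w -> (forall s, 0 <= w s) -> 0 <= c ->
  (kexp nu (fun s => c * w s)%R x = c%:E * kexp nu w x)%E.
Proof.
move=> mw w0 c0; rewrite /kexp -ge0_integralZl//=.
- by apply: eq_integral => s _; rewrite -EFinM mulrCA.
- by apply/measurable_EFinP; exact: measurable_kexp_integrand.
- by move=> s _; rewrite lee_fin mulr_ge0 ?expR_ge0.
Qed.

Lemma integral_translate (G : R -> R) c : continuous G -> (forall x, 0 <= G x) ->
  (\int[mu]_x (G x)%:E = \int[mu]_x (G (x + c))%:E)%E.
Proof.
move=> cG G0; pose F x := x + c.
have dF x : is_derive x 1 F 1.
  by rewrite /F -[X in is_derive _ _ _ X]addr0; apply: is_deriveD.
have F1 : derive1 F = cst 1.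
  by apply/funext => x; rewrite derive1E; have [_ ->] := dF x.
rewrite (@increasing_ge0_integration_by_substitutionT R F G)//.
- by apply: eq_integral => x _; rewrite F1 /= mulr1.
- by move=> x y xy; rewrite /F ltrD2r.
- by rewrite F1 => x; exact: cvg_cst.
- by rewrite F1; exact: is_cvg_cst.
- by rewrite F1; exact: is_cvg_cst.
- apply/cvgrNyPle => A; near=> x; rewrite /F -lerBrDr.
  by near: x; apply: nbhs_ninfty_le; exact: num_real.
- apply/cvgryPge => A; near=> x; rewrite /F -lerBlDr.
  by near: x; apply: nbhs_pinfty_ge; exact: num_real.
Unshelve. all: by end_near. Qed.

Lemma integral_exp_abs nu : 0 < nu -> (\int[mu]_s (expR (- (nu * `|s|)))%:E = (2 / nu)%:E)%E.
Proof.
move=> nu0.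
have c : continuous (fun s => expR (- (nu * `|s|))).
  move=> s; apply: continuous_comp; last exact: continuous_expR.
  by apply: cvgN; apply: cvgM; [exact: cvg_cst|apply: cvg_norm; exact: cvg_id].
rewrite ge0_symfun_integralT//; last by move=> s /=; rewrite normrN.
rewrite -set_itvcy.
have -> : (\int[mu]_(x in `[0%R, +oo[) (expR (- (nu * `|x|)))%:E = (nu^-1)%:E * \int[mu]_(x in `[0%R, +oo[) (exponential_pdf nu x)%:E)%E.
  rewrite -ge0_integralZl//=.
  - apply: eq_integral => s; rewrite inE /= in_itv /= andbT => s0.
    rewrite exponential_pdfE// -EFinM mulrA mulVf ?gt_eqF// mul1r.
    by rewrite ger0_norm// mulNr.
  - by apply/measurable_EFinP; apply: measurable_funTS; exact: measurable_exponential_pdf.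
  - by move=> s _; rewrite lee_fin exponential_pdf_ge0// ltW.
  - by rewrite lee_fin invr_ge0 ltW.
have -> : (\int[mu]_(x in `[0%R, +oo[) (exponential_pdf nu x)%:E = 1)%E.
  rewrite -(integral_exponential_pdf nu0) [LHS]integral_mkcond; apply: eq_integral => s _.
  rewrite patchE; case: ifPn => //; rewrite notin_setE /= in_itv /= andbT => /negP; rewrite -ltNge => s0.
  by rewrite lt0_exponential_pdf.
by rewrite mule1 -EFinM.
Qed.

Lemma integral_exp_shift nu x : 0 < nu -> (\int[mu]_s (expR (- (nu * `|x - s|)))%:E = (2 / nu)%:E)%E.
Proof.
move=> nu0; rewrite -(integral_exp_abs nu0).
rewrite [RHS](@integral_translate _ (- x)).
- by apply: eq_integral => s _; rewrite distrC.
- move=> s; apply: continuous_comp; last exact: continuous_expR.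
  by apply: cvgN; apply: cvgM; [exact: cvg_cst|apply: cvg_norm; exact: cvg_id].
- by move=> s; exact: expR_ge0.
Qed.

Lemma kexp1 nu x : 0 < nu -> kexp nu (fun=> 1) x = (2 / nu)%:E.
Proof.
by move=> nu0; rewrite -(integral_exp_shift x nu0); apply: eq_integral => s _; rewrite mulr1.
Qed.

(** The triangle inequality inside the exponential. It makes a convolution with the kernel vary by
    at most a factor exp |x - y|, which is the defining property of a [weight]. *)
Lemma kexp_shift w x y : measurable_fun [set: R] w -> (forall s, 0 <= w s) ->
  (kexp 1 w y <= (expR `|x - y|)%:E * kexp 1 w x)%E.
Proof.
move=> mw w0; rewrite -ge0_integralZl//=; last 2 first.
- by apply/measurable_EFinP; exact: measurable_kexp_integrand.
- by move=> s _; rewrite lee_fin mulr_ge0 ?expR_ge0.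
under [leRHS]eq_integral do rewrite -EFinM.
apply: ge0_le_integral => //.
- by move=> s _; rewrite lee_fin mulr_ge0 ?expR_ge0.
- by apply/measurable_EFinP; exact: measurable_kexp_integrand.
- by apply/measurable_EFinP; apply: measurable_funM => //; exact: measurable_kexp_integrand.
- move=> s _; rewrite lee_fin mulrA ler_wpM2r// -expRD ler_expR !mul1r.
  have : `|x - s| <= `|x - y| + `|y - s| by rewrite -[x - s](subrKA y) ler_normD.
  lra.
Qed.

Definition strip w x (z : R * R) : R :=
  expR (- `|x - z.1|) * w z.2 * \1_[set z : R * R | z.1 <= z.2 <= z.1 + 1] z.

Lemma measurable_strip w x : measurable_fun [set: R] w ->
  measurable_fun [set: R * R] (EFin \o strip w x).
Proof.
move=> mw; apply/measurable_EFinP; apply: measurable_funM.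
  apply: measurable_funM; last by apply: measurableT_comp.
  apply: measurableT_comp => //; apply: measurable_funN; apply: measurableT_comp => //.
  by apply: measurable_funB.
apply: measurable_indic.
have -> : [set z : R * R | z.1 <= z.2 <= z.1 + 1] = (fun z : R * R => (z.1 <= z.2) && (z.2 <= z.1 + 1)) @^-1` [set true].
  by apply/seteqP; split => z /=; [move=> ->|move=> ->].
rewrite -[X in measurable X]setTI.
have : measurable_fun [set: R * R] (fun z : R * R => (z.1 <= z.2) && (z.2 <= z.1 + 1)).
  apply: measurable_and; apply: measurable_fun_ler => //.
  by apply: measurable_funD.
by apply.
Qed.

Lemma strip_ge0 w x z : (forall s, 0 <= w s) -> (0 <= (EFin \o strip w x) z)%E.
Proof. by move=> w0; rewrite lee_fin /strip mulr_ge0// mulr_ge0// expR_ge0. Qed.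

Lemma strip_integral_s w x t : (\int[mu]_s (EFin \o strip w x) (t, s) =
  \int[mu]_(s in `[t, (t + 1)%R]) (expR (- `|x - t|) * w s)%:E)%E.
Proof.
have indE s : (\1_[set z : R * R | z.1 <= z.2 <= z.1 + 1] (t, s) : R) = \1_(`[t, t + 1]%classic) s.
  by rewrite !indicE; congr (_%:R); congr nat_of_bool; apply/idP/idP; rewrite !inE /= in_itv.
rewrite [RHS]integral_mkcond; apply: eq_integral => s _.
rewrite /strip /= indE patchE indicE; case: ifPn => _; first by rewrite mulr1.
by rewrite mulr0.
Qed.

Lemma strip_integral_t w x s : (\int[mu]_t (EFin \o strip w x) (t, s) =
  \int[mu]_(t in `[(s - 1)%R, s]) (expR (- `|x - t|) * w s)%:E)%E.
Proof.
have indE t : (\1_[set z : R * R | z.1 <= z.2 <= z.1 + 1] (t, s) : R) = \1_(`[s - 1, s]%classic) t.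
  rewrite !indicE; congr (_%:R); congr nat_of_bool; apply/idP/idP; rewrite !inE /= in_itv /=;
  by move=> /andP[? ?]; apply/andP; split; lra.
rewrite [RHS]integral_mkcond; apply: eq_integral => t _.
rewrite /strip /= indE patchE indicE; case: ifPn => _; first by rewrite mulr1.
by rewrite mulr0.
Qed.

Lemma measurable_exp_abs x : measurable_fun [set: R] (fun t => expR (- `|x - t|)).
Proof.
have := @measurable_kexp_integrand 1 (fun=> 1) x (measurable_cst _).
by under eq_fun do rewrite mulr1 mul1r.
Qed.

(** For fixed t the inner integral of [w] runs over a unit interval and is at most [N]; the
    remaining integral of exp(- |x - t|) is 2. *)
Lemma strip_upper w N x : measurable_fun [set: R] w -> (forall s, 0 <= w s) -> 0 <= N ->
  (forall t, (\int[mu]_(s in `[t, (t + 1)%R]) (w s)%:E <= N%:E)%E) ->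
  (\int[mu]_t \int[mu]_s (EFin \o strip w x) (t, s) <= (2 * N)%:E)%E.
Proof.
move=> mw w0 N0 wN.
have me := measurable_exp_abs x.
apply: (@le_trans _ _ (\int[mu]_t (expR (- `|x - t|) * N)%:E)%E).
  apply: ge0_le_integral; first exact: measurableT.
  - by move=> t _; apply: integral_ge0 => s _; exact: strip_ge0.
  - apply: (@measurable_fun_fubini_tonelli_F _ _ _ _ R mu _ (measurable_strip x mw)) => z.
    exact: strip_ge0.
  - by apply/measurable_EFinP; apply: measurable_funM.
  - move=> t _; rewrite strip_integral_s ge0_integralM ?expR_ge0//; last exact: measurable_funTS.
    by rewrite EFinM lee_wpmul2l// lee_fin expR_ge0.
under eq_integral do rewrite mulrC.
rewrite (ge0_integralM measurableT me (fun=> expR_ge0 _) N0).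
have := @integral_exp_shift 1 x ltr01; under eq_integral do rewrite mul1r.
by move=> ->; rewrite -EFinM lee_fin divr1 mulrC.
Qed.

(** For t in [s - 1, s], replacing |x - t| by |x - s| costs at most a factor exp(-1), and this
    interval has length 1. *)
Lemma strip_lower w x s : 0 <= w s ->
  ((expR (-1) * (expR (- (1 * `|x - s|)) * w s))%:E <=
  \int[mu]_t (EFin \o strip w x) (t, s))%E.
Proof.
move=> w0; rewrite strip_integral_t.
have -> : (expR (-1) * (expR (- (1 * `|x - s|)) * w s))%:E = (\int[mu]_(t in `[(s - 1)%R, s]) (expR (-1) * (expR (- (1 * `|x - s|)) * w s))%:E)%E.
  rewrite integral_cst//= lebesgue_measure_itv /= lte_fin.
  rewrite ifT; last by rewrite ltrBlDr ltrDl.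
  by rewrite -EFinD (_ : s - (s - 1) = 1) ?mule1//; ring.
apply: ge0_le_integral; first exact: measurable_itv.
- by move=> t _; rewrite lee_fin mulr_ge0 ?expR_ge0// mulr_ge0 ?expR_ge0.
- exact: measurable_cst.
- apply/measurable_EFinP; apply: measurable_funTS; apply: measurable_funM => //.
  exact: measurable_exp_abs.
- move=> t; rewrite /mkset in_itv /= => /andP[t1 t2]; rewrite lee_fin mulrA ler_wpM2r// -expRD ler_expR mul1r.
  have : `|x - t| <= `|x - s| + `|s - t| by rewrite -[x - t](subrKA s) ler_normD.
  have : `|s - t| <= 1 by rewrite ger0_norm; lra.
  lra.
Qed.

(* Tonelli, applied to e^{-|x-t|} w(s) on the strip t <= s <= t+1, trades the supremum over unit
   intervals for an integral against the kernel. *)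
Lemma kexp_unif w N x : measurable_fun [set: R] w -> (forall s, 0 <= w s) ->
  (forall t, (\int[mu]_(s in `[t, (t + 1)%R]) (w s)%:E <= N%:E)%E) ->
  (kexp 1 w x <= (2 * expR 1 * N)%:E)%E.
Proof.
move=> mw w0 wN.
have N0 : 0 <= N.
  by rewrite -lee_fin; apply: le_trans (wN 0); apply: integral_ge0 => s _; rewrite lee_fin.
have := strip_upper x mw w0 N0 wN.
rewrite (@fubini_tonelli _ _ _ _ R mu mu _ (measurable_strip x mw) (fun z => strip_ge0 x z w0)) => up.
have low : ((expR (-1))%:E * kexp 1 w x <= \int[mu]_s \int[mu]_t (EFin \o strip w x) (t, s))%E.
  rewrite -ge0_integralM ?expR_ge0//; last 2 first.
  - exact: measurable_kexp_integrand.
  - by move=> s; rewrite mulr_ge0 ?expR_ge0.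
  apply: ge0_le_integral; first exact: measurableT.
  - by move=> s _; rewrite lee_fin mulr_ge0 ?expR_ge0// mulr_ge0 ?expR_ge0.
  - by apply/measurable_EFinP; apply: measurable_funM => //; exact: measurable_kexp_integrand.
  - apply: (@measurable_fun_fubini_tonelli_G _ _ _ _ R mu _ (measurable_strip x mw)) => z.
    exact: strip_ge0.
  - by move=> s _; exact: strip_lower.
have := le_trans low up.
rewrite muleC -lee_pdivlMr ?expR_gt0// => /le_trans; apply.
by rewrite expRN invrK -EFinM lee_fin; lra.
Qed.

(** Cauchy-Schwarz obtained from w <= a / 2 + w^2 / (2 a) with a free parameter a > 0. The kernel
    has total mass 2, which is the constant on the right. *)
Lemma kexp_sq w x : measurable_fun [set: R] w -> (forall s, 0 <= w s) ->
  (kexp 1 w x * kexp 1 w x <= 2%:E * kexp 1 (fun s => w s ^+ 2)%R x)%E.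
Proof.
move=> mw w0.
have mw2 : measurable_fun [set: R] (fun s => w s ^+ 2) by exact: measurable_funX.
have am (a : R) : 0 < a -> (kexp 1 w x <= a%:E + (a^-1 / 2)%:E * kexp 1 (fun s => w s ^+ 2)%R x)%E.
  move=> a0; have -> : a%:E = kexp 1 (fun=> a / 2) x.
    have := @kexpZ 1 (fun=> 1) x (a / 2) (measurable_cst _) (fun=> ler01) ltac:(by rewrite divr_ge0// ltW).
    under [in X in X = _]eq_fun do rewrite mulr1.
    by move=> ->; rewrite kexp1// -EFinM; congr EFin; field.
  have a2 : 0 <= a^-1 / 2 by rewrite divr_ge0// invr_ge0 ltW.
  rewrite -kexpZ//; last by move=> s; exact: sqr_ge0.
  rewrite -kexpD//; last 3 first.
  - exact: measurable_funM.
  - by move=> s; rewrite divr_ge0// ltW.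
  - by move=> s; rewrite mulr_ge0// sqr_ge0.
  apply: kexp_le => //.
    by apply: measurable_funD => //; exact: measurable_funM.
  move=> s; rewrite w0 /=.
  have h : 0 <= a^-1 / 2 * (w s - a) ^+ 2 by rewrite mulr_ge0// sqr_ge0.
  have h2 : a^-1 / 2 * (w s - a) ^+ 2 = a / 2 + a^-1 / 2 * w s ^+ 2 - w s by field; rewrite gt_eqF.
  by rewrite -subr_ge0 -h2.
have := @kexp_ge0 1 w x w0; have := @kexp_ge0 1 _ x (fun s => sqr_ge0 (w s)).
case: (kexp 1 (fun s => _ ^+ 2) x) am => [b||] am //; last first.
  by move=> _ _; rewrite mulry gtr0_sg// mul1e leey.
rewrite lee_fin => b0.
case: (kexp 1 w x) am => [a||] am //; last by have := am 1 ltr01; rewrite -EFinM -EFinD leye_eq.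
rewrite lee_fin le_eqVlt => /orP[/eqP <-|a0]; first by rewrite mul0e -EFinM lee_fin mulr_ge0.
(* Half the value of the left-hand integral is the choice of parameter that turns the family [am]
   into the quadratic inequality. *)
have := am (a / 2) ltac:(lra); rewrite -!EFinM -EFinD !lee_fin => h.
have h2 : a / 2 <= (a / 2)^-1 / 2 * b by lra.
have h3 : a * ((a / 2)^-1 / 2 * b) = b by field; rewrite gt_eqF.
by have := ler_wpM2l (ltW a0) h2; rewrite h3; lra.
Qed.

(* Schur test: Cauchy-Schwarz against the kernel, then Tonelli. *)
Lemma kexp_L2 w : measurable_fun [set: R] w -> (forall s, 0 <= w s) ->
  (\int[mu]_x (kexp 1 w x * kexp 1 w x) <= 4%:E * \int[mu]_s (w s ^+ 2)%:E)%E.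
Proof.
move=> mw w0.
have mw2 : measurable_fun [set: R] (fun s => w s ^+ 2) by exact: measurable_funX.
have w20 s : 0 <= w s ^+ 2 by exact: sqr_ge0.
apply: (@le_trans _ _ (\int[mu]_x (2%:E * kexp 1 (fun s => w s ^+ 2)%R x))%E).
  apply: ge0_le_integral => //.
  - by move=> x _; rewrite mule_ge0// kexp_ge0.
  - by apply: emeasurable_funM; exact: measurable_kexp.
  - by apply: emeasurable_funM => //; exact: measurable_kexp.
  - by move=> x _; exact: kexp_sq.
rewrite ge0_integralZl//=; last 2 first.
- exact: measurable_kexp.
- by move=> x _; exact: kexp_ge0.
have := @fubini_tonelli _ _ _ _ R mu mu _ (kexp_sym_measurable 1 mw2) _.
move=> ->; last by move=> z; rewrite lee_fin mulr_ge0 ?expR_ge0.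
rewrite /fubini_G /=.
have -> : (\int[mu]_s \int[mu]_x (expR (- (1 * `|x - s|)) * w s ^+ 2)%:E = \int[mu]_s (2%:E * (w s ^+ 2)%:E))%E.
  apply: eq_integral => s _.
  under eq_integral do rewrite mulrC.
  have me : measurable_fun [set: R] (fun x => expR (- (1 * `|x - s|))).
    have := @measurable_kexp_integrand 1 (fun=> 1) s (measurable_cst _).
    by under eq_fun do rewrite mulr1 distrC.
  rewrite (ge0_integralM measurableT me (fun=> expR_ge0 _) (w20 s)).
  rewrite muleC; congr (_ * _)%E.
  have := @integral_exp_shift 1 s ltr01; rewrite divr1 => <-.
  by apply: eq_integral => x _; rewrite distrC.
rewrite ge0_integralZl//=; last by move=> x _; rewrite lee_fin.
  by rewrite muleA -EFinM (_ : 2 * 2 = 4 :> R)//; ring.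
by apply/measurable_EFinP.
Qed.

Lemma kexp_lty w x : measurable_fun [set: R] w -> (forall s, 0 <= w s) ->
  (\int[mu]_s (w s ^+ 2)%:E < +oo)%E -> (kexp 1 w x < +oo)%E.
Proof.
move=> mw w0 wfin.
have mw2 : measurable_fun [set: R] (fun s => w s ^+ 2) by exact: measurable_funX.
have : (kexp 1 (fun s => w s ^+ 2)%R x < +oo)%E.
  apply: le_lt_trans wfin; apply: ge0_le_integral => //.
  - by move=> s _; rewrite lee_fin mulr_ge0 ?expR_ge0// sqr_ge0.
  - by apply/measurable_EFinP; exact: measurable_kexp_integrand.
  - by apply/measurable_EFinP.
  - by move=> s _; rewrite lee_fin ler_piMl ?sqr_ge0// expR_le1 mul1r oppr_le0.
have := kexp_sq x mw w0; have := @kexp_ge0 1 w x w0.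
case: (kexp 1 w x) => [a||] //; first by rewrite ltry.
move=> _ + b; rewrite mulyy leye_eq => /eqP h.
have : (2%:E * kexp 1 (fun s => w s ^+ 2)%R x < +oo)%E.
  by apply: lte_mul_pinfty.
by rewrite h.
Qed.

End ExpKernel.

(** * Half-line integral solutions of the scalar first-order equations *)

Section HalfLine.
Context {R : realType}.
Notation mu := (@lebesgue_measure R).
Implicit Types (h w : R -> R) (nu x y s t : R).

Lemma rprim_C1 (F f : R -> R) : continuous f -> (forall x, is_derive x (1 : R) F (f x)) -> rprim F f.
Proof.
move=> cf dF; split; first exact: continuous_measurable_fun.
  by move=> a b; apply: continuous_compact_integrable;
    [exact: segment_compact|exact: continuous_subspaceT].
move=> a b; rewrite le_eqVlt => /orP[/eqP <-|ab]; first by rewrite subrr set_itv1 Rintegral_set1.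
rewrite /Rintegral (@continuous_FTC2 R f F)//.
- exact: continuous_subspaceT.
- split.
  + by move=> x _; have [] := dF x.
  + apply: cvg_at_right_filter; apply: differentiable_continuous; apply/derivable1_diffP.
    by have [] := dF a.
  + apply: cvg_at_left_filter; apply: differentiable_continuous; apply/derivable1_diffP.
    by have [] := dF b.
- by move=> x _; rewrite derive1E; have [_ ->] := dF x.
Qed.

Lemma rprim_exp nu : rprim (fun x => expR (nu * x)) (fun x => nu * expR (nu * x)).
Proof.
apply: rprim_C1.
  move=> x; apply: cvgM; first exact: cvg_cst.
  apply: continuous_comp; last exact: continuous_expR.
  by apply: cvgM; [exact: cvg_cst|exact: cvg_id].
move=> x; have H : is_derive x 1 (fun x => nu * x) nu.
  rewrite -[X in is_derive _ _ _ X]mulr1; apply: is_deriveZ.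
have := is_derive1_comp (is_derive_expR (nu * x)) H.
by rewrite mulrC.
Qed.

Lemma integrable_scale (D : set R) (c : R) (f : R -> R) : measurable D ->
  mu.-integrable D (EFin \o f) -> mu.-integrable D (EFin \o (fun x => c * f x)).
Proof. by move=> mD fi; apply: (@integrableZl _ (measurableTypeR R) R mu D mD c (EFin \o f) fi). Qed.

(* Solutions of F' = nu F - h (from +oo) and F' = - nu F + h (from -oo). *)
Definition Up nu h x := \int[mu]_(s in `[x, +oo[) (expR (- (nu * (s - x))) * h s).
Definition Dn nu h x := \int[mu]_(s in `]-oo, x]) (expR (- (nu * (x - s))) * h s).

Section Fixed.
Variables (nu : R) (h : R -> R).
Hypotheses (mh : measurable_fun [set: R] h)
  (hfin : forall x, (kexp nu (fun s => `|h s|)%R x < +oo)%E).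

Let mnh : measurable_fun [set: R] (fun s => `|h s|)%R.
Proof. exact: measurableT_comp. Qed.

Let meh (g : R -> R) : measurable_fun [set: R] g -> measurable_fun [set: R] (fun s => expR (g s) * h s).
Proof. by move=> mg; apply: measurable_funM => //; apply: measurableT_comp. Qed.

Let up_abs x : (\int[mu]_(s in `[x, +oo[) `|(expR (- (nu * (s - x))) * h s)%:E| <= kexp nu (fun s => `|h s|)%R x)%E.
Proof.
rewrite integral_mkcond; apply: ge0_le_integral; first exact: measurableT.
- by move=> s _; rewrite patchE; case: ifP.
- apply/(measurable_restrictT _ _).1 => //; apply: measurable_funTS; apply: measurableT_comp => //.
  apply/measurable_EFinP; apply: meh => //; apply: measurable_funN; apply: measurable_funM => //.
  exact: measurable_funB.
- by apply/measurable_EFinP; exact: measurable_kexp_integrand.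
- move=> s _; rewrite patchE; case: ifPn => [|_]; last by rewrite lee_fin mulr_ge0 ?expR_ge0.
  rewrite inE /= in_itv /= andbT => xs.
  by rewrite lee_fin normrM (ger0_norm (expR_ge0 _)) (distrC x s) (ger0_norm (_ : 0 <= s - x)) ?subr_ge0.
Qed.

Let dn_abs x : (\int[mu]_(s in `]-oo, x]) `|(expR (- (nu * (x - s))) * h s)%:E| <= kexp nu (fun s => `|h s|)%R x)%E.
Proof.
rewrite integral_mkcond; apply: ge0_le_integral; first exact: measurableT.
- by move=> s _; rewrite patchE; case: ifP.
- apply/(measurable_restrictT _ _).1 => //; apply: measurable_funTS; apply: measurableT_comp => //.
  apply/measurable_EFinP; apply: meh => //; apply: measurable_funN; apply: measurable_funM => //.
  exact: measurable_funB.
- by apply/measurable_EFinP; exact: measurable_kexp_integrand.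
- move=> s _; rewrite patchE; case: ifPn => [|_]; last by rewrite lee_fin mulr_ge0 ?expR_ge0.
  rewrite inE /= in_itv /= => xs.
  by rewrite lee_fin normrM (ger0_norm (expR_ge0 _)) (ger0_norm (_ : 0 <= x - s)) ?subr_ge0.
Qed.

Lemma up_integrable x : mu.-integrable `[x, +oo[ (EFin \o (fun s => expR (- (nu * (s - x))) * h s)).
Proof.
apply/integrableP; split.
  apply: measurable_funTS; apply/measurable_EFinP; apply: meh => //; apply: measurable_funN; apply: measurable_funM => //.
  exact: measurable_funB.
by apply: le_lt_trans (hfin x); exact: up_abs.
Qed.

Lemma dn_integrable x : mu.-integrable `]-oo, x] (EFin \o (fun s => expR (- (nu * (x - s))) * h s)).
Proof.
apply/integrableP; split.
  apply: measurable_funTS; apply/measurable_EFinP; apply: meh => //; apply: measurable_funN; apply: measurable_funM => //.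
  exact: measurable_funB.
by apply: le_lt_trans (hfin x); exact: dn_abs.
Qed.

Lemma Up_le x : (`|Up nu h x|%:E <= kexp nu (fun s => `|h s|)%R x)%E.
Proof.
rewrite EFin_normr_Rintegral//; last exact: up_integrable.
apply: le_trans (up_abs x); apply: le_abse_integral => //.
by have /integrableP[] := up_integrable x.
Qed.

Lemma Dn_le x : (`|Dn nu h x|%:E <= kexp nu (fun s => `|h s|)%R x)%E.
Proof.
rewrite EFin_normr_Rintegral//; last exact: dn_integrable.
apply: le_trans (dn_abs x); apply: le_abse_integral => //.
by have /integrableP[] := dn_integrable x.
Qed.

(** Factoring exp(nu x) out of the integral leaves a primitive of -exp(-nu s) h(s), so the product
    rule applies and no differentiation under the integral sign occurs. *)
Lemma Up_rprim : rprim (Up nu h) (fun x => nu * Up nu h x - h x).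
Proof.
pose phi s := expR (- (nu * s)) * h s.
have mphi : measurable_fun [set: R] phi.
  by apply: meh => //; apply: measurable_funN; apply: measurable_funM.
have iphi x : mu.-integrable `[x, +oo[ (EFin \o phi).
  have := integrable_scale (expR (- (nu * x))) (measurable_itv `[x, +oo[) (up_integrable x).
  apply: eq_integrable => // s _ /=; rewrite mulrA -expRD.
  by congr ((expR _) * _)%:E; ring.
pose Phi x := \int[mu]_(s in `[x, +oo[) phi s.
have PhiP : rprim Phi (fun x => -1 * phi x).
  split; first by apply: measurable_funM.
    move=> a b; apply: integrable_scale => //.
    by apply: integrableS (iphi a) => //; apply: subset_itvl.
  move=> a b ab; rewrite RintegralZl//; last by apply: integrableS (iphi a) => //; apply: subset_itvl.
  have := @Rintegral_itvB R phi (BLeft a) +oo%O b (iphi a).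
  rewrite !bnd_simp => /(_ ab isT).
  rewrite Rintegral_itv_obnd_cbnd; last by apply: integrableS (iphi b) => //; apply: subset_itvr; rewrite bnd_simp.
  by rewrite -/(Phi a) -/(Phi b) => <-; ring.
have UpE x : Up nu h x = expR (nu * x) * Phi x.
  rewrite /Phi -RintegralZl//; apply: eq_Rintegral => s _; rewrite /phi mulrA -expRD.
  by congr ((expR _) * _); ring.
have := rprimM (rprim_exp nu) PhiP; congr (rprim _ _); apply/funext => x //.
rewrite UpE /phi mulrA [X in _ + X]mulrA mulrN1 mulNr mulrA -expRD addrN expR0 mul1r.
by rewrite -mulrA.
Qed.

Lemma Dn_rprim : rprim (Dn nu h) (fun x => - nu * Dn nu h x + h x).
Proof.
pose phi s := expR (nu * s) * h s.
have mphi : measurable_fun [set: R] phi by apply: meh => //; apply: measurable_funM.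
have iphi x : mu.-integrable `]-oo, x] (EFin \o phi).
  have := integrable_scale (expR (nu * x)) (measurable_itv `]-oo, x]) (dn_integrable x).
  apply: eq_integrable => // s _ /=; rewrite mulrA -expRD.
  by congr ((expR _) * _)%:E; ring.
pose Phi x := \int[mu]_(s in `]-oo, x]) phi s.
have PhiP : rprim Phi phi.
  split => //.
    by move=> a b; apply: integrableS (iphi b) => //; apply: subset_itvr.
  move=> a b ab; have := @Rintegral_itvB R phi -oo%O (BRight b) a (iphi b).
  rewrite !bnd_simp => /(_ isT ab).
  rewrite Rintegral_itv_obnd_cbnd; first by [].
  by apply: integrableS (iphi b) => //; apply: subset_itvr.
have DnE x : Dn nu h x = expR (- nu * x) * Phi x.
  rewrite /Phi -RintegralZl//; apply: eq_Rintegral => s _; rewrite /phi mulrA -expRD.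
  by congr ((expR _) * _); ring.
have := rprimM (rprim_exp (- nu)) PhiP; congr (rprim _ _); apply/funext => x //.
by rewrite DnE /phi [X in _ + X]mulrA -expRD !mulNr addNr expR0 mul1r !mulrA.
Qed.

End Fixed.

Lemma UpB nu h1 h2 x : measurable_fun [set: R] h1 -> measurable_fun [set: R] h2 ->
  (forall x, (kexp nu (fun s => `|h1 s|)%R x < +oo)%E) ->
  (forall x, (kexp nu (fun s => `|h2 s|)%R x < +oo)%E) ->
  Up nu (fun s => h1 s - h2 s) x = Up nu h1 x - Up nu h2 x.
Proof.
move=> m1 m2 f1 f2; rewrite /Up -RintegralB//; try exact: up_integrable.
by apply: eq_Rintegral => s _; rewrite mulrBr.
Qed.

Lemma DnB nu h1 h2 x : measurable_fun [set: R] h1 -> measurable_fun [set: R] h2 ->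
  (forall x, (kexp nu (fun s => `|h1 s|)%R x < +oo)%E) ->
  (forall x, (kexp nu (fun s => `|h2 s|)%R x < +oo)%E) ->
  Dn nu (fun s => h1 s - h2 s) x = Dn nu h1 x - Dn nu h2 x.
Proof.
move=> m1 m2 f1 f2; rewrite /Dn -RintegralB//; try exact: dn_integrable.
by apply: eq_Rintegral => s _; rewrite mulrBr.
Qed.

End HalfLine.

(** * Half-line solutions for complex data *)

Section ComplexHalfLine.
Context {R : realType}.
Notation mu := (@lebesgue_measure R).
Implicit Types (h g : R -> R[i]) (nu x : R).

Definition cUp nu h x : R[i] := Complex (Up nu (re h) x) (Up nu (im h) x).
Definition cDn nu h x : R[i] := Complex (Dn nu (re h) x) (Dn nu (im h) x).
Definition ckexp nu h x := kexp nu (fun s => n1 (h s)) x.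

Section Fixed.
Variables (nu : R) (h : R -> R[i]).
Hypotheses (mh : cmeasurable h) (hfin : forall x, (ckexp nu h x < +oo)%E).

Let mre : measurable_fun [set: R] (fun s => `|re h s|)%R.
Proof. by case: mh => m _; exact: measurableT_comp. Qed.
Let mim : measurable_fun [set: R] (fun s => `|im h s|)%R.
Proof. by case: mh => _ m; exact: measurableT_comp. Qed.

Lemma ckexp_split x : (ckexp nu h x = kexp nu (fun s => `|re h s|)%R x + kexp nu (fun s => `|im h s|)%R x)%E.
Proof. by rewrite -kexpD. Qed.

Lemma re_kexp_fin x : (kexp nu (fun s => `|re h s|)%R x < +oo)%E.
Proof. by apply: le_lt_trans (hfin x); rewrite ckexp_split leeDl// kexp_ge0. Qed.

Lemma im_kexp_fin x : (kexp nu (fun s => `|im h s|)%R x < +oo)%E.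
Proof. by apply: le_lt_trans (hfin x); rewrite ckexp_split leeDr// kexp_ge0. Qed.

Lemma cUp_le x : ((n1 (cUp nu h x))%:E <= ckexp nu h x)%E.
Proof.
have [m1 m2] := mh; rewrite ckexp_split /n1 /= EFinD leeD//; apply: Up_le => //.
  exact: re_kexp_fin.
exact: im_kexp_fin.
Qed.

Lemma cDn_le x : ((n1 (cDn nu h x))%:E <= ckexp nu h x)%E.
Proof.
have [m1 m2] := mh; rewrite ckexp_split /n1 /= EFinD leeD//; apply: Dn_le => //.
  exact: re_kexp_fin.
exact: im_kexp_fin.
Qed.

Lemma cUp_cprim : cprim (cUp nu h) (fun x => (nu%:C)%C * cUp nu h x - h x).
Proof.
have [m1 m2] := mh; split.
  have := Up_rprim m1 re_kexp_fin; congr (rprim _ _); apply/funext => x.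
  by rewrite /re /=; case: (h x) => a b /=; rewrite mul0r subr0.
have := Up_rprim m2 im_kexp_fin; congr (rprim _ _); apply/funext => x.
by rewrite /im /=; case: (h x) => a b /=; rewrite mul0r addr0.
Qed.

Lemma cDn_cprim : cprim (cDn nu h) (fun x => - (nu%:C)%C * cDn nu h x + h x).
Proof.
have [m1 m2] := mh; split.
  have := Dn_rprim m1 re_kexp_fin; congr (rprim _ _); apply/funext => x.
  by rewrite /re /=; case: (h x) => a b /=; rewrite oppr0 mul0r subr0.
have := Dn_rprim m2 im_kexp_fin; congr (rprim _ _); apply/funext => x.
by rewrite /im /=; case: (h x) => a b /=; rewrite oppr0 mul0r addr0.
Qed.

End Fixed.

Lemma cUpB nu h g x : cmeasurable h -> cmeasurable g ->
  (forall x, (ckexp nu h x < +oo)%E) -> (forall x, (ckexp nu g x < +oo)%E) ->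
  cUp nu h x - cUp nu g x = cUp nu (fun s => h s - g s) x.
Proof.
move=> mh mg fh fg; have [mh1 mh2] := mh; have [mg1 mg2] := mg.
rewrite /cUp (_ : re (fun s => h s - g s) = (fun s => re h s - re g s)); last first.
  by apply/funext => s; rewrite /re; case: (h s); case: (g s).
rewrite (_ : im (fun s => h s - g s) = (fun s => im h s - im g s)); last first.
  by apply/funext => s; rewrite /im; case: (h s); case: (g s).
by rewrite !UpB//; [exact: im_kexp_fin|exact: im_kexp_fin|exact: re_kexp_fin|exact: re_kexp_fin].
Qed.

Lemma cDnB nu h g x : cmeasurable h -> cmeasurable g ->
  (forall x, (ckexp nu h x < +oo)%E) -> (forall x, (ckexp nu g x < +oo)%E) ->
  cDn nu h x - cDn nu g x = cDn nu (fun s => h s - g s) x.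
Proof.
move=> mh mg fh fg; have [mh1 mh2] := mh; have [mg1 mg2] := mg.
rewrite /cDn (_ : re (fun s => h s - g s) = (fun s => re h s - re g s)); last first.
  by apply/funext => s; rewrite /re; case: (h s); case: (g s).
rewrite (_ : im (fun s => h s - g s) = (fun s => im h s - im g s)); last first.
  by apply/funext => s; rewrite /im; case: (h s); case: (g s).
by rewrite !DnB//; [exact: im_kexp_fin|exact: im_kexp_fin|exact: re_kexp_fin|exact: re_kexp_fin].
Qed.

End ComplexHalfLine.

(** * The diagonalized first-order system *)

Section GeometricLimit.
Context {R : realType}.

Lemma geometric_cauchy (u : nat -> R) (c : R) :
  (forall k, `|u k.+1 - u k| <= c * (2^-1) ^+ k) ->
  forall k j, `|u (k + j)%N - u k| <= 2 * c * (2^-1) ^+ k.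
Proof.
move=> H k j.
have c0 : 0 <= c by have := le_trans (normr_ge0 _) (H 0); rewrite expr0 mulr1.
(* The exact partial geometric sum is kept, because the bound without the last factor does not
   reproduce itself in the induction on [j]. *)
suff : `|u (k + j)%N - u k| <= 2 * c * (2^-1) ^+ k * (1 - 2^-1 ^+ j).
  move=> /le_trans; apply; apply: ler_piMr; first by rewrite !mulr_ge0 ?exprn_ge0.
  by rewrite gerBl exprn_ge0.
elim: j => [|j IH]; first by rewrite addn0 subrr normr0 expr0 subrr mulr0.
rewrite addnS; have := H (k + j)%N; rewrite exprD => H1.
have : `|u (k + j).+1 - u k| <= `|u (k + j).+1 - u (k + j)%N| + `|u (k + j)%N - u k|.
  by rewrite -[u (k + j).+1 - u k](subrKA (u (k + j)%N)) ler_normD.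
have : 2^-1 ^+ j.+1 = 2^-1 * 2^-1 ^+ j :> R by rewrite exprS.
set X := 2^-1 ^+ k in H1 IH *; set Y := 2^-1 ^+ j in H1 IH * => -> h.
have -> : 2 * c * X * (1 - 2^-1 * Y) = c * (X * Y) + 2 * c * X * (1 - Y) by field.
lra.
Qed.

Lemma half_exp_lt (c e : R) : 0 < e -> exists k, c * (2^-1) ^+ k < e.
Proof.
move=> e0; have [c0|c0] := leP c 0.
  exists 0%N; rewrite expr0 mulr1; exact: le_lt_trans e0.
have h : (fun n => (2^-1 : R) ^+ n) @ \oo --> (0 : R).
  by apply: cvg_expr; rewrite ger0_norm ?invr_ge0// invf_lt1//; lra.
move/cvgrPdist_lt : h => /(_ _ (divr_gt0 e0 c0))[N _ HN].
exists N; have := HN N (leqnn N); rewrite sub0r normrN ger0_norm ?exprn_ge0//.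
by rewrite ltr_pdivlMr// mulrC.
Qed.

Lemma le_half_exp (x a c : R) : (forall k, x <= a + c * (2^-1) ^+ k) -> x <= a.
Proof.
move=> H; apply/ler_addgt0Pr => e e0; have [k hk] := half_exp_lt c e0.
by apply: (le_trans (H k)); rewrite lerD2l ltW.
Qed.

Lemma geometric_limit (u : nat -> R) (c : R) :
  (forall k, `|u k.+1 - u k| <= c * (2^-1) ^+ k) ->
  exists2 l, u @ \oo --> l & forall k, `|l - u k| <= 2 * c * (2^-1) ^+ k.
Proof.
move=> H; have G := geometric_cauchy H.
have cu : cvgn u.
  apply: cauchy_cvg; apply: cauchy_exP => e e0.
  have [k hk] := half_exp_lt (2 * c) e0.
  exists (u k); exists k => // n /= kn; rewrite /ball /= distrC.
  by apply: le_lt_trans hk; rewrite -(subnKC kn); exact: G.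
exists (limn u) => // k.
have cl : (fun j => `|u (k + j)%N - u k|) @ \oo --> `|limn u - u k|.
  apply: cvg_norm; apply: cvgB; last exact: cvg_cst.
  have -> : (fun j => u (k + j)%N) = (fun j => u (j + k)%N) by apply/funext => j; rewrite addnC.
  by rewrite cvg_shiftn.
rewrite -(cvg_lim _ cl)//; apply: limr_le; first by apply/cvg_ex; eexists; exact: cl.
by apply: nearW => j; exact: G.
Qed.

End GeometricLimit.

Section System.
Context {R : realType}.
Notation mu := (@lebesgue_measure R).
Implicit Types (Q b p m f : R -> R[i]) (F : R -> R).

(* Coupling terms of the system p' = nu p + Hp - f, m' = - nu m + Hm + f. *)
Definition Hp Q b p m x : R[i] := Q x * m x + b x * (p x + m x).
Definition Hm Q b p m x : R[i] := Q x * p x - b x * (p x + m x).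
(** A common bound for the coefficients of both coupling terms: [b] multiplies p + m, hence the
    factor 2. *)
Definition pot Q b x : R := n1 (Q x) + 2 * n1 (b x).

Lemma pot_ge0 Q b x : 0 <= pot Q b x.
Proof. by rewrite addr_ge0 ?n1_ge0// mulr_ge0 ?n1_ge0. Qed.

Lemma measurable_pot Q b : cmeasurable Q -> cmeasurable b -> measurable_fun [set: R] (pot Q b).
Proof.
move=> mQ mb; apply: measurable_funD; first exact: measurable_n1.
by apply: measurable_funM => //; exact: measurable_n1.
Qed.

Lemma cmeasurable_Hp Q b p m : cmeasurable Q -> cmeasurable b -> cmeasurable p -> cmeasurable m ->
  cmeasurable (Hp Q b p m).
Proof.
by move=> *; apply: cmeasurableD; apply: cmeasurableM => //; exact: cmeasurableD.
Qed.

Lemma cmeasurable_Hm Q b p m : cmeasurable Q -> cmeasurable b -> cmeasurable p -> cmeasurable m ->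
  cmeasurable (Hm Q b p m).
Proof.
by move=> *; apply: cmeasurableB; apply: cmeasurableM => //; exact: cmeasurableD.
Qed.

Lemma n1_Hp Q b p m x (t : R) : n1 (p x) <= t -> n1 (m x) <= t -> n1 (Hp Q b p m x) <= pot Q b x * t.
Proof.
move=> hp hm; apply: (le_trans (n1D _ _)).
have h1 : n1 (Q x * m x) <= n1 (Q x) * t.
  by apply: (le_trans (n1M _ _)); apply: ler_wpM2l => //; exact: n1_ge0.
have h2 : n1 (b x * (p x + m x)) <= n1 (b x) * (2 * t).
  apply: (le_trans (n1M _ _)); apply: ler_wpM2l; first exact: n1_ge0.
  by apply: (le_trans (n1D _ _)); lra.
rewrite /pot; lra.
Qed.

Lemma n1_Hm Q b p m x (t : R) : n1 (p x) <= t -> n1 (m x) <= t -> n1 (Hm Q b p m x) <= pot Q b x * t.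
Proof.
move=> hp hm; apply: (le_trans (n1B _ _)).
have h1 : n1 (Q x * p x) <= n1 (Q x) * t.
  by apply: (le_trans (n1M _ _)); apply: ler_wpM2l => //; exact: n1_ge0.
have h2 : n1 (b x * (p x + m x)) <= n1 (b x) * (2 * t).
  apply: (le_trans (n1M _ _)); apply: ler_wpM2l; first exact: n1_ge0.
  by apply: (le_trans (n1D _ _)); lra.
rewrite /pot; lra.
Qed.

Definition weight F := (forall x, 0 <= F x) /\ (forall x s, F s <= expR `|x - s| * F x).

(* The exponent [nu - 1] leaves room for the factor [exp |x - s|] of a weight. *)
Definition small (nu kappa : R) (V : R -> R) := forall x, (kexp (nu - 1) V x <= kappa%:E)%E.

(** Trading [F s] for [F x] lowers the exponent of the kernel from [nu] to [nu - 1]. The constant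
    [F x] then leaves the integral and the rest is bounded by [kappa]. *)
Lemma ckexp_weight (nu kappa : R) (V : R -> R) F (h : R -> R[i]) (t x : R) : measurable_fun [set: R] V ->
  (forall s, 0 <= V s) -> small nu kappa V -> weight F -> cmeasurable h -> 0 <= t ->
  (forall s, n1 (h s) <= V s * (t * F s)) -> (ckexp nu h x <= (t * kappa * F x)%:E)%E.
Proof.
move=> mV V0 sV [F0 FF] mh t0 hV.
apply: (@le_trans _ _ (\int[mu]_s ((t * F x) * (expR (- ((nu - 1) * `|x - s|)) * V s))%:E)%E).
  apply: ge0_le_integral => //.
  - by move=> s _; rewrite lee_fin mulr_ge0 ?expR_ge0 ?n1_ge0.
  - by apply/measurable_EFinP; apply: measurable_kexp_integrand; exact: measurable_n1.
  - by apply/measurable_EFinP; apply: measurable_funM => //; exact: measurable_kexp_integrand.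
  - move=> s _; rewrite lee_fin.
    apply: (@le_trans _ _ (expR (- (nu * `|x - s|)) * (V s * (t * (expR `|x - s| * F x))))).
      rewrite ler_wpM2l ?expR_ge0//; apply: (le_trans (hV s)).
      by rewrite ler_wpM2l// ler_wpM2l.
    have -> : - ((nu - 1) * `|x - s|) = - (nu * `|x - s|) + `|x - s| by ring.
    by rewrite expRD le_eqVlt; apply/orP; left; apply/eqP; ring.
rewrite ge0_integralM ?mulr_ge0//; last 2 first.
- exact: measurable_kexp_integrand.
- by move=> s; rewrite mulr_ge0 ?expR_ge0.
apply: (@le_trans _ _ ((t * F x)%:E * kappa%:E)%E).
  by apply: lee_wpmul2l; [rewrite lee_fin mulr_ge0|exact: sV].
by rewrite -EFinM lee_fin mulrAC.
Qed.

Lemma ckexpD_le nu (h g : R -> R[i]) (A B x : R) : cmeasurable h -> cmeasurable g ->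
  (ckexp nu h x <= A%:E)%E -> (ckexp nu g x <= B%:E)%E ->
  (ckexp nu (fun s => h s + g s)%R x <= (A + B)%:E)%E.
Proof.
move=> mh mg hA gB; rewrite EFinD; apply: le_trans (leeD hA gB).
rewrite /ckexp -kexpD; try exact: measurable_n1; try by move=> s; exact: n1_ge0.
apply: kexp_le.
- by apply: measurable_n1; exact: cmeasurableD.
- by apply: measurable_funD; exact: measurable_n1.
- by move=> s; rewrite n1_ge0 n1D.
Qed.

Lemma ckexpN nu (h : R -> R[i]) x : ckexp nu (fun s => - h s) x = ckexp nu h x.
Proof. by congr (kexp _ _ _); apply/funext => s; exact: n1N. Qed.

Lemma ckexpB_le nu (h g : R -> R[i]) (A B x : R) : cmeasurable h -> cmeasurable g ->
  (ckexp nu h x <= A%:E)%E -> (ckexp nu g x <= B%:E)%E ->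
  (ckexp nu (fun s => h s - g s)%R x <= (A + B)%:E)%E.
Proof.
move=> mh mg hA gB; apply: ckexpD_le => //; first exact: cmeasurableN.
by rewrite ckexpN.
Qed.

(** The ball of radius [t] for the supremum norm weighted by [F], the space in which the fixed point
    is sought. *)
Definition dom F (t : R) p m := [/\ cmeasurable p, cmeasurable m,
  forall x, n1 (p x) <= t * F x & forall x, n1 (m x) <= t * F x].

Lemma ckexp_Hp nu kappa Q b F (t : R) p m x : cmeasurable Q -> cmeasurable b ->
  small nu kappa (pot Q b) -> weight F -> 0 <= t -> dom F t p m ->
  (ckexp nu (Hp Q b p m) x <= (t * kappa * F x)%:E)%E.
Proof.
move=> mQ mb sV wF t0 [mp mm hp hm]; apply: (ckexp_weight (V := pot Q b)) => //.
- exact: measurable_pot.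
- exact: pot_ge0.
- exact: cmeasurable_Hp.
- by move=> s; exact: n1_Hp.
Qed.

Lemma ckexp_Hm nu kappa Q b F (t : R) p m x : cmeasurable Q -> cmeasurable b ->
  small nu kappa (pot Q b) -> weight F -> 0 <= t -> dom F t p m ->
  (ckexp nu (Hm Q b p m) x <= (t * kappa * F x)%:E)%E.
Proof.
move=> mQ mb sV wF t0 [mp mm hp hm]; apply: (ckexp_weight (V := pot Q b)) => //.
- exact: measurable_pot.
- exact: pot_ge0.
- exact: cmeasurable_Hm.
- by move=> s; exact: n1_Hm.
Qed.

Lemma fin_lty (a : \bar R) (b : R) : (a <= b%:E)%E -> (a < +oo)%E.
Proof. by move=> /le_lt_trans; apply; rewrite ltry. Qed.

(** * Fixed point of the coupled integral equations *)

Section Solve.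
Variables (nu kappa : R) (Q b f : R -> R[i]) (F : R -> R).
Hypotheses (mQ : cmeasurable Q) (mb : cmeasurable b) (mf : cmeasurable f)
  (sV : small nu kappa (pot Q b)) (wF : weight F)
  (fF : forall x, (ckexp nu f x <= (F x)%:E)%E).

Definition rhsp p m x := f x - Hp Q b p m x.
Definition rhsm p m x := f x + Hm Q b p m x.

Section Dom.
Variables (t : R) (p m : R -> R[i]).
Hypotheses (t0 : 0 <= t) (pm : dom F t p m).

Lemma rhsp_meas : cmeasurable (rhsp p m).
Proof. by case: pm => ? ? _ _; apply: cmeasurableB => //; exact: cmeasurable_Hp. Qed.

Lemma rhsm_meas : cmeasurable (rhsm p m).
Proof. by case: pm => ? ? _ _; apply: cmeasurableD => //; exact: cmeasurable_Hm. Qed.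

Lemma rhsp_le x : (ckexp nu (rhsp p m) x <= (F x + t * kappa * F x)%:E)%E.
Proof.
case: (pm) => ? ? _ _; apply: ckexpB_le => //; first exact: cmeasurable_Hp.
exact: ckexp_Hp.
Qed.

Lemma rhsm_le x : (ckexp nu (rhsm p m) x <= (F x + t * kappa * F x)%:E)%E.
Proof.
case: (pm) => ? ? _ _; apply: ckexpD_le => //; first exact: cmeasurable_Hm.
exact: ckexp_Hm.
Qed.

Lemma rhsp_fin x : (ckexp nu (rhsp p m) x < +oo)%E.
Proof. exact: fin_lty (rhsp_le x). Qed.

Lemma rhsm_fin x : (ckexp nu (rhsm p m) x < +oo)%E.
Proof. exact: fin_lty (rhsm_le x). Qed.

Lemma n1_Up x : n1 (cUp nu (rhsp p m) x) <= F x + t * kappa * F x.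
Proof. rewrite -lee_fin; apply: le_trans (rhsp_le x); exact: cUp_le rhsp_meas rhsp_fin x. Qed.

Lemma n1_Dn x : n1 (cDn nu (rhsm p m) x) <= F x + t * kappa * F x.
Proof. rewrite -lee_fin; apply: le_trans (rhsm_le x); exact: cDn_le rhsm_meas rhsm_fin x. Qed.

Lemma Up_meas : cmeasurable (cUp nu (rhsp p m)).
Proof. exact: cprim_measurable (cUp_cprim rhsp_meas rhsp_fin). Qed.

Lemma Dn_meas : cmeasurable (cDn nu (rhsm p m)).
Proof. exact: cprim_measurable (cDn_cprim rhsm_meas rhsm_fin). Qed.

End Dom.

Lemma dom_sub t t' r p m p' m' : dom F t p m -> dom F t' p' m' ->
  (forall x, n1 (p x - p' x) <= r * F x) -> (forall x, n1 (m x - m' x) <= r * F x) ->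
  dom F r (fun x => p x - p' x) (fun x => m x - m' x).
Proof. by move=> [? ? _ _] [? ? _ _] h1 h2; split => //; exact: cmeasurableB. Qed.

(** The map is affine, so [f] cancels in the difference and only the coupling term remains; [kappa]
    is the contraction factor. The radii [t] and [t'] provide the finiteness needed to subtract the
    two integrals, and only the distance [r] enters the bound. *)
Lemma Up_lip t t' r p m p' m' x : 0 <= t -> 0 <= t' -> 0 <= r ->
  dom F t p m -> dom F t' p' m' ->
  (forall x, n1 (p x - p' x) <= r * F x) -> (forall x, n1 (m x - m' x) <= r * F x) ->
  n1 (cUp nu (rhsp p m) x - cUp nu (rhsp p' m') x) <= r * kappa * F x.
Proof.
move=> t0 t'0 r0 pm pm' h1 h2; have d := dom_sub pm pm' h1 h2.
rewrite cUpB; try exact: rhsp_meas pm; try exact: rhsp_meas pm'; try exact: rhsp_fin pm; try exact: rhsp_fin pm'.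
rewrite (_ : (fun s => _ - _) = (fun s => - Hp Q b (fun x => p x - p' x) (fun x => m x - m' x) s)); last first.
  by apply/funext => s; rewrite /rhsp /Hp; ring.
case: (d) => ? ? _ _.
have mH := cmeasurable_Hp mQ mb; have hH y := ckexp_Hp y mQ mb sV wF r0 d.
rewrite -lee_fin; apply: le_trans (hH x); rewrite -ckexpN; apply: cUp_le.
  by apply: cmeasurableN; exact: mH.
by move=> y; rewrite ckexpN; exact: fin_lty (hH y).
Qed.

Lemma Dn_lip t t' r p m p' m' x : 0 <= t -> 0 <= t' -> 0 <= r ->
  dom F t p m -> dom F t' p' m' ->
  (forall x, n1 (p x - p' x) <= r * F x) -> (forall x, n1 (m x - m' x) <= r * F x) ->
  n1 (cDn nu (rhsm p m) x - cDn nu (rhsm p' m') x) <= r * kappa * F x.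
Proof.
move=> t0 t'0 r0 pm pm' h1 h2; have d := dom_sub pm pm' h1 h2.
rewrite cDnB; try exact: rhsm_meas pm; try exact: rhsm_meas pm'; try exact: rhsm_fin pm; try exact: rhsm_fin pm'.
rewrite (_ : (fun s => _ - _) = Hm Q b (fun x => p x - p' x) (fun x => m x - m' x)); last first.
  by apply/funext => s; rewrite /rhsm /Hm; ring.
case: (d) => ? ? _ _.
have hH y := ckexp_Hm y mQ mb sV wF r0 d.
rewrite -lee_fin; apply: le_trans (hH x); apply: cDn_le; first exact: cmeasurable_Hm.
by move=> y; exact: fin_lty (hH y).
Qed.

Section Existence.
Hypotheses (k0 : 0 <= kappa) (k1 : kappa <= 1 / 12).

Fixpoint picard k : (R -> R[i]) * (R -> R[i]) :=
  if k is j.+1 then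
    (cUp nu (rhsp (picard j).1 (picard j).2), cDn nu (rhsm (picard j).1 (picard j).2))
  else (fun=> 0, fun=> 0).

(** The ball of radius 2 is invariant, since F + 2 kappa F <= 2 F when kappa <= 1/12. *)
Lemma picard_dom k : dom F 2 (picard k).1 (picard k).2.
Proof.
have [F0 _] := wF; elim: k => [|k IH] /=.
  by split; try exact: cmeasurable_cst; move=> x; rewrite n10 mulr_ge0.
have le x : F x + 2 * kappa * F x <= 2 * F x.
  have : kappa * F x <= 1 / 12 * F x by rewrite ler_wpM2r.
  by have := F0 x; lra.
split.
- exact: (Up_meas (t := 2)).
- exact: (Dn_meas (t := 2)).
- by move=> x; apply: le_trans (le x); exact: n1_Up.
- by move=> x; apply: le_trans (le x); exact: n1_Dn.
Qed.

Lemma picard_step k :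
  (forall x, n1 ((picard k.+1).1 x - (picard k).1 x) <= (2^-1) ^+ k * F x) /\
  (forall x, n1 ((picard k.+1).2 x - (picard k).2 x) <= (2^-1) ^+ k * F x).
Proof.
have [F0 _] := wF; elim: k => [|k [IH1 IH2]].
  have d0 : dom F 0 (fun=> 0) (fun=> 0).
    by split; try exact: cmeasurable_cst; move=> x; rewrite n10 mul0r.
  split=> x /=; rewrite subr0 expr0 mul1r.
    by have := n1_Up (lexx 0) d0 x; rewrite !mul0r addr0.
  by have := n1_Dn (lexx 0) d0 x; rewrite !mul0r addr0.
have e0 : 0 <= (2^-1 : R) ^+ k by rewrite exprn_ge0// invr_ge0.
have le x : 2^-1 ^+ k * kappa * F x <= 2^-1 ^+ k.+1 * F x.
  have h : kappa <= 2^-1 by have := k1; lra.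
  by rewrite ler_wpM2r// exprS [2^-1 * _]mulrC ler_wpM2l.
have two : 0 <= 2 :> R by [].
split=> x; apply: le_trans (le x).
  exact: (Up_lip x two two e0 (picard_dom k.+1) (picard_dom k) IH1 IH2).
exact: (Dn_lip x two two e0 (picard_dom k.+1) (picard_dom k) IH1 IH2).
Qed.

(** Real and imaginary parts converge separately, each with error at most twice the geometric term,
    which gives the factor 4. Pointwise limits keep measurability. The completeness of L^2 rests on
    the same lemma, with another [F]. *)
Lemma climit (u : nat -> R -> R[i]) : (forall k, cmeasurable (u k)) ->
  (forall k x, n1 (u k.+1 x - u k x) <= (2^-1) ^+ k * F x) ->
  exists2 p, cmeasurable p & forall k x, n1 (p x - u k x) <= 4 * (2^-1) ^+ k * F x.
Proof.
move=> mu_ step.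
have Hre x k : `|re (u k.+1) x - re (u k) x| <= F x * 2^-1 ^+ k.
  rewrite mulrC; apply: le_trans (step k x); rewrite /n1 /re.
  by case: (u k.+1 x) => ? ?; case: (u k x) => ? ? /=; rewrite lerDl.
have Him x k : `|im (u k.+1) x - im (u k) x| <= F x * 2^-1 ^+ k.
  rewrite mulrC; apply: le_trans (step k x); rewrite /n1 /im.
  by case: (u k.+1 x) => ? ?; case: (u k x) => ? ? /=; rewrite lerDr.
have /choice[a Ha] : forall x, exists l, (fun k => re (u k) x) @ \oo --> l /\ forall k, `|l - re (u k) x| <= 2 * F x * 2^-1 ^+ k.
  by move=> x; have [l ? ?] := geometric_limit (Hre x); exists l.
have /choice[c Hc] : forall x, exists l, (fun k => im (u k) x) @ \oo --> l /\ forall k, `|l - im (u k) x| <= 2 * F x * 2^-1 ^+ k.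
  by move=> x; have [l ? ?] := geometric_limit (Him x); exists l.
exists (fun x => Complex (a x) (c x)).
  split.
    apply: (measurable_fun_cvg (h := fun k => re (u k))) => [k|x _].
      by case: (mu_ k).
    by case: (Ha x).
  apply: (measurable_fun_cvg (h := fun k => im (u k))) => [k|x _].
    by case: (mu_ k).
  by case: (Hc x).
move=> k x; have [_ /(_ k) h1] := Ha x; have [_ /(_ k) h2] := Hc x.
rewrite /n1; move: h1 h2; rewrite /re /im; case: (u k x) => ? ? /= h1 h2.
have -> : 4 * 2^-1 ^+ k * F x = 2 * F x * 2^-1 ^+ k + 2 * F x * 2^-1 ^+ k by ring.
exact: lerD.
Qed.

(** The radius 4 is the distance of the limit from the zero initial guess. The fixed-point equations
    hold because the defect is bounded by a multiple of 2^-k for every k. *)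
Lemma system_existence : exists p m, [/\ dom F 4 p m,
  (forall x, p x = cUp nu (rhsp p m) x) & (forall x, m x = cDn nu (rhsm p m) x)].
Proof.
have [F0 _] := wF.
have [p mp Hp_] := @climit (fun k => (picard k).1)
  ltac:(by move=> k; case: (picard_dom k)) ltac:(by move=> k x; have [H _] := picard_step k).
have [m mm Hm_] := @climit (fun k => (picard k).2)
  ltac:(by move=> k; case: (picard_dom k)) ltac:(by move=> k x; have [_ H] := picard_step k).
have d : dom F 4 p m.
  by split => // x; [have := Hp_ 0 x|have := Hm_ 0 x]; rewrite /= subr0 expr0 mulr1.
have e0 k : 0 <= 4 * (2^-1 : R) ^+ k by rewrite mulr_ge0// exprn_ge0// invr_ge0.
(* The first term is the distance from the image of the limit to iterate k + 1, the second the
   distance from that iterate to the limit; 4/12 + 2 <= 3. *)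
have close k x : 4 * 2^-1 ^+ k * kappa * F x + 4 * 2^-1 ^+ k.+1 * F x <= 0 + (3 * F x) * 2^-1 ^+ k.
  have : 4 * 2^-1 ^+ k * kappa * F x <= 4 * 2^-1 ^+ k * (1 / 12) * F x by rewrite ler_wpM2r// ler_wpM2l.
  have := mulr_ge0 (e0 k) (F0 x); rewrite exprS; lra.
exists p, m; split => // x; apply/esym/eqP; rewrite -subr_eq0; apply/eqP/n1_eq0/eqP;
  rewrite eq_le n1_ge0 andbT; apply: (@le_half_exp _ _ _ (3 * F x)) => k; apply: le_trans (close k x).
  rewrite -(subrKA ((picard k.+1).1 x)); apply: (le_trans (n1D _ _)); apply: lerD.
    by apply: (Up_lip (t := 4) (t' := 2)) => //; exact: picard_dom.
  by rewrite -n1N opprB.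
rewrite -(subrKA ((picard k.+1).2 x)); apply: (le_trans (n1D _ _)); apply: lerD.
  by apply: (Dn_lip (t := 4) (t' := 2)) => //; exact: picard_dom.
by rewrite -n1N opprB.
Qed.

End Existence.

End Solve.

(** * Dependence of the fixed point on the coefficients *)

Section Difference.
Variables (nu kappa dk : R) (Q b Q' b' f : R -> R[i]) (F : R -> R).
Hypotheses (mQ : cmeasurable Q) (mb : cmeasurable b) (mQ' : cmeasurable Q') (mb' : cmeasurable b')
  (mf : cmeasurable f)
  (sV : small nu kappa (pot Q b)) (sV' : small nu kappa (pot Q' b'))
  (sD : small nu dk (pot (fun x => Q x - Q' x) (fun x => b x - b' x))) (wF : weight F)
  (fF : forall x, (ckexp nu f x <= (F x)%:E)%E) (k0 : 0 <= kappa) (k1 : kappa <= 1 / 12) (dk0 : 0 <= dk).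

(** The difference solves a fixed-point problem with the same contraction and a source of size
    [4 * dk], coming from the change of coefficients applied to a solution of size 4. A bound [r]
    thus improves to [r * kappa + 4 * dk]; iterating from the a priori bound 4 + 4 leaves [8 * dk]
    in the limit. *)
Lemma system_difference p m p' m' : dom F 4 p m -> dom F 4 p' m' ->
  (forall x, p x = cUp nu (rhsp Q b f p m) x) -> (forall x, m x = cDn nu (rhsm Q b f p m) x) ->
  (forall x, p' x = cUp nu (rhsp Q' b' f p' m') x) -> (forall x, m' x = cDn nu (rhsm Q' b' f p' m') x) ->
  dom F (8 * dk) (fun x => p x - p' x) (fun x => m x - m' x).
Proof.
move=> d d' Ep Em Ep' Em'; have [F0 _] := wF.
have [mp mm hp hm] := d; have [mp' mm' hp' hm'] := d'.
have mdQ : cmeasurable (fun x => Q x - Q' x) by exact: cmeasurableB.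
have mdb : cmeasurable (fun x => b x - b' x) by exact: cmeasurableB.
have d4 : 0 <= 4 :> R by [].
have step r : 0 <= r -> (forall x, n1 (p x - p' x) <= r * F x) -> (forall x, n1 (m x - m' x) <= r * F x) ->
    (forall x, n1 (p x - p' x) <= (r * kappa + 4 * dk) * F x) /\
    (forall x, n1 (m x - m' x) <= (r * kappa + 4 * dk) * F x).
  move=> r0 h1 h2; split=> x.
    rewrite mulrDl -(subrKA (cUp nu (rhsp Q b f p' m') x)); apply: (le_trans (n1D _ _)); apply: lerD.
      rewrite {1}Ep.
      exact: (Up_lip mQ mb mf sV wF fF x d4 d4 r0 d d' h1 h2).
    rewrite {1}Ep' cUpB; try exact: (rhsp_meas mQ mb mf d'); try exact: (rhsp_meas mQ' mb' mf d');
      try exact: (rhsp_fin mQ mb mf sV wF fF d4 d'); try exact: (rhsp_fin mQ' mb' mf sV' wF fF d4 d').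
    rewrite (_ : (fun s => _ - _) = (fun s => - Hp (fun x => Q x - Q' x) (fun x => b x - b' x) p' m' s)); last first.
      by apply/funext => s; rewrite /rhsp /Hp; ring.
    have hH y := ckexp_Hp y mdQ mdb sD wF d4 d'.
    rewrite -lee_fin; apply: le_trans (hH x); rewrite -ckexpN; apply: cUp_le.
      by apply: cmeasurableN; exact: cmeasurable_Hp.
    by move=> y; rewrite ckexpN; exact: fin_lty (hH y).
  rewrite mulrDl -(subrKA (cDn nu (rhsm Q b f p' m') x)); apply: (le_trans (n1D _ _)); apply: lerD.
    rewrite {1}Em; exact: (Dn_lip mQ mb mf sV wF fF x d4 d4 r0 d d' h1 h2).
  rewrite {1}Em' cDnB; try exact: (rhsm_meas mQ mb mf d'); try exact: (rhsm_meas mQ' mb' mf d');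
    try exact: (rhsm_fin mQ mb mf sV wF fF d4 d'); try exact: (rhsm_fin mQ' mb' mf sV' wF fF d4 d').
  rewrite (_ : (fun s => _ - _) = Hm (fun x => Q x - Q' x) (fun x => b x - b' x) p' m'); last first.
    by apply/funext => s; rewrite /rhsm /Hm; ring.
  have hH y := ckexp_Hm y mdQ mdb sD wF d4 d'.
  rewrite -lee_fin; apply: le_trans (hH x); apply: cDn_le; first exact: cmeasurable_Hm.
  by move=> y; exact: fin_lty (hH y).
have all k : (forall x, n1 (p x - p' x) <= (8 * dk + 8 * 2^-1 ^+ k) * F x) /\
    (forall x, n1 (m x - m' x) <= (8 * dk + 8 * 2^-1 ^+ k) * F x).
  elim: k => [|k [IH1 IH2]].
    split=> x; rewrite expr0 mulr1 mulrDl; (apply: (le_trans (n1B _ _)));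
    [have h1 := hp x; have h2 := hp' x|have h1 := hm x; have h2 := hm' x];
    have := mulr_ge0 dk0 (F0 x); lra.
  have e0 : 0 <= (2^-1 : R) ^+ k by rewrite exprn_ge0// invr_ge0.
  have r0 : 0 <= 8 * dk + 8 * (2^-1 : R) ^+ k by have := dk0; lra.
  have le x : ((8 * dk + 8 * 2^-1 ^+ k) * kappa + 4 * dk) * F x <= (8 * dk + 8 * 2^-1 ^+ k.+1) * F x.
    rewrite ler_wpM2r// exprS.
    have : (8 * dk + 8 * 2^-1 ^+ k) * kappa <= (8 * dk + 8 * 2^-1 ^+ k) * (1 / 12) by rewrite ler_wpM2l.
    lra.
  have [h1 h2] := step _ r0 IH1 IH2.
  by split=> x; apply: le_trans (le x).
split; try exact: cmeasurableB.
  move=> x; apply: (@le_half_exp _ _ _ (8 * F x)) => k; have [h _] := all k.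
  by apply: (le_trans (h x)); rewrite mulrDl [X in _ + X]mulrAC.
move=> x; apply: (@le_half_exp _ _ _ (8 * F x)) => k; have [_ h] := all k.
by apply: (le_trans (h x)); rewrite mulrDl [X in _ + X]mulrAC.
Qed.

End Difference.

(** * Growth of solutions of the homogeneous system *)

Section Uniqueness.
Variables (nu kappa : R) (Q b p m : R -> R[i]).
Hypotheses (nu3 : 3 <= nu) (mQ : cmeasurable Q) (mb : cmeasurable b)
  (sV : small nu kappa (pot Q b)) (k1 : kappa <= 1 / 12)
  (Dp : cprim p (fun x => (nu%:C)%C * p x + Hp Q b p m x))
  (Dm : cprim m (fun x => - (nu%:C)%C * m x + Hm Q b p m x)).

Lemma cprim_expM (c : R) (F g : R -> R[i]) : cprim F g ->
  cprim (fun x => ((expR (c * x))%:C)%C * F x)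
    (fun x => ((expR (c * x))%:C)%C * ((c%:C)%C * F x + g x)).
Proof.
move=> H; have E : cprim (fun x => ((expR (c * x))%:C)%C) (fun x => ((c * expR (c * x))%:C)%C).
  split; first exact: rprim_exp.
  exact: rprim_cst.
have := cprimM E H; congr (cprim _ _); apply/funext => x.
by rewrite rmorphM /= mulrDr; ring.
Qed.

Lemma n1_continuous (F g : R -> R[i]) : cprim F g -> continuous (fun x => n1 (F x)).
Proof.
move=> [/rprim_AC/rAC_continuous H1 /rprim_AC/rAC_continuous H2] x.
by apply: cvgD; apply: cvg_norm; [exact: H1|exact: H2].
Qed.

(* Variation of constants on [a, T], from T for p and from a for m; Th is the larger of the two
   suprema. *)
Lemma interval_bound (a T : R) : a <= T -> exists2 Th : R,
   11 * Th <= 12 * (n1 (p T) + n1 (m a)) &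
   forall x, a <= x <= T ->
     n1 (p x) <= expR (- (nu * (T - x))) * n1 (p T) + Th / 12 /\
     n1 (m x) <= expR (- (nu * (x - a))) * n1 (m a) + Th / 12.
Proof.
move=> aT.
have bnd (F g : R -> R[i]) : cprim F g -> exists2 c, a <= c <= T & forall t, a <= t <= T -> n1 (F t) <= n1 (F c).
  move=> Fg; have [|c cab Hc] := @EVT_max R (fun x => n1 (F x)) a T aT.
    by apply: continuous_subspaceT; exact: n1_continuous Fg.
  by exists c => [|t tab]; [rewrite in_itv in cab|apply: Hc; rewrite in_itv].
have [xp xpT Hxp] := bnd _ _ Dp; have [xm xmT Hxm] := bnd _ _ Dm.
pose Th := Num.max (n1 (p xp)) (n1 (m xm)).
have pTh x : a <= x <= T -> n1 (p x) <= Th by move=> h; rewrite le_max Hxp.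
have mTh x : a <= x <= T -> n1 (m x) <= Th by move=> h; rewrite le_max Hxm ?orbT.
have Th0 : 0 <= Th by rewrite le_max n1_ge0.
have mV := measurable_pot mQ mb.
have V0 := pot_ge0 Q b.
have kV x : (kexp nu (pot Q b) x <= (1 / 12)%:E)%E.
  apply: (@le_trans _ _ (kexp (nu - 1) (pot Q b) x)); first by apply: kexp_nu => //; lra.
  by apply: le_trans (sV x) _; rewrite lee_fin.
(* Common estimate of the two Duhamel integrals: the one-sided factor [e] is dominated by the kernel
   centred at [z], and the kernel integral of the potential is at most 1/12. *)
have piece (x y z : R) (H : R -> R[i]) (e : R -> R) : a <= x -> x <= y -> y <= T ->
    cmeasurable H -> (forall s, a <= s <= T -> n1 (H s) <= pot Q b s * Th) ->
    (forall s, x <= s <= y -> 0 <= e s <= expR (- (nu * `|z - s|))) -> measurable_fun [set: R] e ->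
    (\int[mu]_(s in `[x, y]) (e s * n1 (H s))%:E <= (Th / 12)%:E)%E.
  move=> ax xy yT mH HV he me.
  apply: (@le_trans _ _ (\int[mu]_s (Th * (expR (- (nu * `|z - s|)) * pot Q b s))%:E)%E).
    rewrite integral_mkcond; apply: ge0_le_integral; first exact: measurableT.
    - move=> s _; rewrite patchE; case: ifPn => //; rewrite inE /= in_itv /= => /he/andP[? _].
      by rewrite lee_fin mulr_ge0// n1_ge0.
    - apply/(measurable_restrictT _ _).1 => //; apply: measurable_funTS; apply/measurable_EFinP.
      by apply: measurable_funM => //; exact: measurable_n1.
    - by apply/measurable_EFinP; apply: measurable_funM => //; exact: measurable_kexp_integrand.
    - move=> s _; rewrite patchE; case: ifPn => [|_]; last first.
        by rewrite lee_fin mulr_ge0// mulr_ge0 ?expR_ge0.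
      rewrite inE /= in_itv /= => xsy; have /andP[e0 e1] := he _ xsy.
      rewrite lee_fin [leRHS]mulrC -mulrA; apply: ler_pM => //; first exact: n1_ge0.
      by apply: HV; move/andP : xsy => [? ?]; apply/andP; split; lra.
  rewrite ge0_integralM//; last 2 first.
  - exact: measurable_kexp_integrand.
  - by move=> s; rewrite mulr_ge0 ?expR_ge0.
  apply: (@le_trans _ _ (Th%:E * (1 / 12)%:E)%E); first by apply: lee_wpmul2l => //; exact: kV.
  by rewrite -EFinM lee_fin; lra.
have me (c d : R) : measurable_fun [set: R] (fun s => expR (- (nu * (c * s - d)))).
  apply: measurableT_comp => //; apply: measurable_funN; apply: measurable_funM => //.
  by apply: measurable_funB => //; exact: measurable_funM.
have mp := cprim_measurable Dp; have mm := cprim_measurable Dm.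
have HpV s : a <= s <= T -> n1 (Hp Q b p m s) <= pot Q b s * Th.
  by move=> h; apply: n1_Hp; [exact: pTh|exact: mTh].
have HmV s : a <= s <= T -> n1 (Hm Q b p m s) <= pot Q b s * Th.
  by move=> h; apply: n1_Hm; [exact: pTh|exact: mTh].
have main x : a <= x <= T ->
     n1 (p x) <= expR (- (nu * (T - x))) * n1 (p T) + Th / 12 /\
     n1 (m x) <= expR (- (nu * (x - a))) * n1 (m a) + Th / 12.
  move=> /andP[ax xT]; split.
    (* The integrating factor exp(-nu s) removes the term [nu p]; the constant exp(nu x) normalizes
       it to 1 at s = x. *)
    have := cprim_n1 (cprimZ ((expR (nu * x))%:C)%C (cprim_expM (- nu) Dp)) xT.
    have -> : ((expR (nu * x))%:C)%C * (((expR (- nu * x))%:C)%C * p x) = p x.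
      by rewrite mulrA -rmorphM /= -expRD mulNr addrN expR0 rmorph1 mul1r.
    have -> : ((expR (nu * x))%:C)%C * (((expR (- nu * T))%:C)%C * p T) = ((expR (- (nu * (T - x))))%:C)%C * p T.
      by rewrite mulrA -rmorphM /= -expRD; congr (((expR _)%:C)%C * _); ring.
    have -> : (\int[mu]_(x0 in `[x, T]) (n1 (((expR (nu * x))%:C)%C * (((expR (- nu * x0))%:C)%C * (((- nu)%:C)%C * p x0 + ((nu%:C)%C * p x0 + Hp Q b p m x0)))))%:E = \int[mu]_(s in `[x, T]) (expR (- (nu * (1 * s - x))) * n1 (Hp Q b p m s))%:E)%E.
      apply: eq_integral => s _; congr EFin.
      rewrite addrA -mulrDl rmorphN addNr mul0r add0r mulrA -rmorphM /= -expRD n1_real.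
      by rewrite ger0_norm ?expR_ge0//; congr (expR _ * _); ring.
    move=> h1; have h2 : n1 (((expR (- (nu * (T - x))))%:C)%C * p T - p x) <= Th / 12.
      rewrite -lee_fin; apply: (le_trans h1); apply: (piece _ _ x) => //.
        exact: cmeasurable_Hp.
      move=> s /andP[xs _]; rewrite expR_ge0 ler_expR /= distrC mul1r.
      by rewrite (ger0_norm (_ : 0 <= s - x)) ?subr_ge0.
    have -> : p x = ((expR (- (nu * (T - x))))%:C)%C * p T - (((expR (- (nu * (T - x))))%:C)%C * p T - p x) by ring.
    apply: (le_trans (n1B _ _)); apply: lerD => //.
    by rewrite n1_real ger0_norm ?expR_ge0.
  have := cprim_n1 (cprimZ ((expR (- nu * x))%:C)%C (cprim_expM nu Dm)) ax.
  have -> : ((expR (- nu * x))%:C)%C * (((expR (nu * x))%:C)%C * m x) = m x.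
    by rewrite mulrA -rmorphM /= -expRD mulNr addNr expR0 rmorph1 mul1r.
  have -> : ((expR (- nu * x))%:C)%C * (((expR (nu * a))%:C)%C * m a) = ((expR (- (nu * (x - a))))%:C)%C * m a.
    by rewrite mulrA -rmorphM /= -expRD; congr (((expR _)%:C)%C * _); ring.
  have -> : (\int[mu]_(x0 in `[a, x]) (n1 (((expR (- nu * x))%:C)%C * (((expR (nu * x0))%:C)%C * ((nu%:C)%C * m x0 + (- (nu%:C)%C * m x0 + Hm Q b p m x0)))))%:E = \int[mu]_(s in `[a, x]) (expR (- (nu * (-1 * s - - x))) * n1 (Hm Q b p m s))%:E)%E.
    apply: eq_integral => s _; congr EFin.
    rewrite addrA -mulrDl addrN mul0r add0r mulrA -rmorphM /= -expRD n1_real.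
    by rewrite ger0_norm ?expR_ge0//; congr (expR _ * _); ring.
  move=> h1; have h2 : n1 (m x - ((expR (- (nu * (x - a))))%:C)%C * m a) <= Th / 12.
    rewrite -lee_fin; apply: (le_trans h1); apply: (piece _ _ x) => //.
      exact: cmeasurable_Hm.
    move=> s /andP[_ sx]; rewrite expR_ge0 ler_expR /=.
    by rewrite (ger0_norm (_ : 0 <= x - s)) ?subr_ge0// lerN2 le_eqVlt; apply/orP; left; apply/eqP; ring.
  rewrite -(subrK (((expR (- (nu * (x - a))))%:C)%C * m a) (m x)) addrC.
  apply: (le_trans (n1D _ _)); apply: lerD => //.
  by rewrite n1_real ger0_norm ?expR_ge0.
exists Th => //.
have e1 c d : 0 <= d -> 0 <= c -> expR (- (nu * d)) * c <= c.
  by move=> d0 c0; rewrite ler_piMl// expR_le1 oppr_le0 mulr_ge0//; have := nu3; lra.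
(* Evaluating the bounds at the maximum points, where both exponentials are at most 1; the term
   [Th / 12] is then absorbed on the left. *)
have : Th <= n1 (p T) + n1 (m a) + Th / 12.
  rewrite {1}/Th ge_max; apply/andP; split.
    have [h _] := main _ xpT; apply: (le_trans h).
    have := e1 (n1 (p T)) (T - xp) ltac:(by rewrite subr_ge0; case/andP: xpT) (n1_ge0 _).
    have := n1_ge0 (m a); lra.
  have [_ h] := main _ xmT; apply: (le_trans h).
  have := e1 (n1 (m a)) (xm - a) ltac:(by rewrite subr_ge0; case/andP: xmT) (n1_ge0 _).
  have := n1_ge0 (p T); lra.
lra.
Qed.

Lemma exp_nu_le (d : R) : 1 <= d -> expR (- (nu * d)) <= 1 / 4.
Proof.
move=> d1; have h3 : 3 <= nu * d by have : nu * 1 <= nu * d; [rewrite ler_wpM2l//; have := nu3; lra|have := nu3; lra].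
rewrite expRN -[leRHS]invrK lef_pV2 ?posrE ?expR_gt0 ?invr_gt0 ?divr_gt0//.
by apply: le_trans (expR_ge1Dx _); lra.
Qed.

(* If |m(a)| <= |p(a)| then p dominates to the right of a, otherwise m dominates to its left. *)
Lemma growth (a : R) : p a <> 0 \/ m a <> 0 ->
  exists2 c : R, 0 < c & (forall x, a + 1 <= x -> c <= n1 (p x + m x)) \/
                        (forall x, x <= a - 1 -> c <= n1 (p x + m x)).
Proof.
move=> Z; have low (u v : R[i]) : n1 u - n1 v <= n1 (u + v).
  by have := n1B (u + v) v; rewrite addrK; lra.
have [le|/ltW le] := leP (n1 (m a)) (n1 (p a)).
  have pa : 0 < n1 (p a).
    rewrite lt_neqAle n1_ge0 andbT eq_sym; apply/eqP => p0.
    case: Z; first by move: p0 => /n1_eq0.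
    by apply; apply: n1_eq0; apply/eqP; rewrite eq_le n1_ge0 andbT -p0.
  (* With the exponentials at most 1/4 and [n1 (m a) <= n1 (p a)], the bounds of [interval_bound]
     give [n1 (p x) >= 8/3 * n1 (p a)] and then [n1 (p x) - n1 (m x) >= 25/12 * n1 (p a)]; the
     constant 5/12 is on the safe side. *)
  exists (5 / 12 * n1 (p a)); first by rewrite mulr_gt0.
  left=> x ax; have [Th hTh H] := @interval_bound a x ltac:(lra).
  have [h1 _] := H a ltac:(by rewrite lexx /=; lra).
  have [_ h2] := H x ltac:(by rewrite lexx andbT; lra).
  have e1 := @exp_nu_le (x - a) ltac:(lra).
  have p0 := n1_ge0 (p x); have m0 := n1_ge0 (m a).
  have e2 : expR (- (nu * (x - a))) * n1 (p x) <= 1 / 4 * n1 (p x) by rewrite ler_wpM2r.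
  have e3 : expR (- (nu * (x - a))) * n1 (m a) <= 1 / 4 * n1 (m a) by rewrite ler_wpM2r.
  apply: le_trans (low _ _); lra.
have ma : 0 < n1 (m a).
  rewrite lt_neqAle n1_ge0 andbT eq_sym; apply/eqP => p0.
  case: Z; last by move: p0 => /n1_eq0.
  by apply; apply: n1_eq0; apply/eqP; rewrite eq_le n1_ge0 andbT -p0.
exists (5 / 12 * n1 (m a)); first by rewrite mulr_gt0.
right=> x ax; have [Th hTh H] := @interval_bound x a ltac:(lra).
have [h1 _] := H x ltac:(by rewrite lexx /=; lra).
have [_ h2] := H a ltac:(by rewrite lexx andbT; lra).
have e1 := @exp_nu_le (a - x) ltac:(lra).
have p0 := n1_ge0 (m x); have m0 := n1_ge0 (p a).
have e2 : expR (- (nu * (a - x))) * n1 (m x) <= 1 / 4 * n1 (m x) by rewrite ler_wpM2r.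
have e3 : expR (- (nu * (a - x))) * n1 (p a) <= 1 / 4 * n1 (p a) by rewrite ler_wpM2r.
rewrite addrC; apply: le_trans (low _ _); lra.
Qed.

Lemma system_uniqueness : (\int[mu]_x (n1 (p x + m x) ^+ 2)%:E < +oo)%E ->
  forall x, p x = 0 /\ m x = 0.
Proof.
move=> fin x; apply: contrapT => nz.
have [c c0 H] : exists2 c : R, 0 < c & (forall y, x + 1 <= y -> c <= n1 (p y + m y)) \/
                        (forall y, y <= x - 1 -> c <= n1 (p y + m y)).
  apply: growth; apply: contrapT => h; apply: nz; split; apply: contrapT => h1; apply: h;
  by [left|right].
have mg : measurable_fun [set: R] (fun x => n1 (p x + m x) ^+ 2).
  apply: measurable_funX; apply: measurable_n1.
  by apply: cmeasurableD; [exact: cprim_measurable Dp|exact: cprim_measurable Dm].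
have key (A : set R) : measurable A -> (forall y, A y -> c <= n1 (p y + m y)) ->
    ((c ^+ 2)%:E * mu A <= \int[mu]_x (n1 (p x + m x) ^+ 2)%:E)%E.
  move=> mA HA; rewrite -integral_cst//.
  apply: (@le_trans _ _ (\int[mu]_(y in A) (n1 (p y + m y) ^+ 2)%:E)%E).
    apply: ge0_le_integral => //.
    - by move=> y _; rewrite lee_fin sqr_ge0.
    - by apply/measurable_EFinP; exact: measurable_funTS.
    - by move=> y Ay; rewrite lee_fin lerXn2r ?nnegrE ?n1_ge0 ?(ltW c0)// HA.
  apply: ge0_subset_integral => //; last by move=> y _; rewrite lee_fin sqr_ge0.
  by apply/measurable_EFinP.
move: fin; apply/negP; rewrite -leNgt leye_eq; apply/eqP.
have c20 : 0 < c ^+ 2 by rewrite exprn_gt0.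
case: H => H.
  have := key _ (measurable_itv `[x + 1, +oo[) (fun y => ltac:(rewrite /mkset in_itv /= andbT; exact: H)).
  by rewrite lebesgue_measure_itv /= ltry addye// gt0_muley ?lte_fin// leye_eq => /eqP.
have := key _ (measurable_itv `]-oo, x - 1]) (fun y => ltac:(rewrite /mkset in_itv /=; exact: H)).
by rewrite lebesgue_measure_itv /= ltNyr gt0_muley ?lte_fin// leye_eq => /eqP.
Qed.

End Uniqueness.

End System.

(** * Uniform local bounds *)

Section UnifBounds.
Context {R : realType}.
Notation mu := (@lebesgue_measure R).
Implicit Types (f g Q tau : R -> R[i]) (N nu : R).

(** Real-valued uniform local bounds, in terms of [n1]. In [ub2] no root is taken, so its bound
    corresponds to the square of an L^2_unif norm. *)
Definition ub1 f N := forall t : R, (\int[mu]_(s in `[t, (t + 1)%R]) (n1 (f s))%:E <= N%:E)%E.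
Definition ub2 f N := forall t : R, (\int[mu]_(s in `[t, (t + 1)%R]) (n1 (f s) ^+ 2)%:E <= N%:E)%E.

Lemma sqrD_le2 (a b : R) : (a + b) ^+ 2 <= 2 * a ^+ 2 + 2 * b ^+ 2.
Proof.
rewrite -subr_ge0 (_ : _ - _ = (a - b) ^+ 2) ?sqr_ge0//; ring.
Qed.

Lemma measurable_cmod f : cmeasurable f -> measurable_fun [set: R] (cmod f).
Proof.
move=> [m1 m2]; rewrite (_ : cmod f = (fun x => Num.sqrt (re f x ^+ 2 + im f x ^+ 2))).
  apply: measurableT_comp; last by apply: measurable_funD; exact: measurable_funX.
  by apply: continuous_measurable_fun; exact: sqrt_continuous.
by apply/funext => x; rewrite /cmod /re /im; case: (f x).
Qed.

Lemma cmod_ge0 f x : 0 <= cmod f x.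
Proof. by rewrite /cmod; case: (f x) => a b; exact: sqrtr_ge0. Qed.

Lemma poweR_half_le (S : \bar R) N : (0 <= S)%E -> 0 <= N -> (S `^ 2^-1 <= N%:E)%E -> (S <= (N ^+ 2)%:E)%E.
Proof.
case: S => [r||] //; last by rewrite poweRyr// leye_eq.
rewrite lee_fin poweR_EFin !lee_fin => r0 N0; rewrite powR12_sqrt// => h.
by rewrite -(sqr_sqrtr r0) lerXn2r// nnegrE.
Qed.

Lemma poweR_lty_inv (S : \bar R) (p : R) : p != 0 -> (0 <= S)%E -> (S `^ p < +oo)%E -> (S < +oo)%E.
Proof. by move=> p0; case: S => [r||] //; rewrite ?ltry// poweRyr. Qed.

Lemma poweR_lt_y (S : \bar R) (p : R) : (S < +oo)%E -> (0 <= S)%E -> (S `^ p < +oo)%E.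
Proof.
by move=> h h0; move: S h h0 => [r||] // _ _; rewrite poweR_EFin ltry.
Qed.

Definition Lsup (p : R) f : \bar R :=
  ereal_sup [set (\int[mu]_(x in `[t, (t + 1)%R]) (cmod f x `^ p)%:E)%E | t in [set: R]].

Lemma Lsup_ge0 p f : (0 <= Lsup p f)%E.
Proof.
apply: (@le_trans _ _ (\int[mu]_(x in `[0%R, (0 + 1)%R]) (cmod f x `^ p)%:E)%E).
  by apply: integral_ge0 => s _; rewrite lee_fin powR_ge0.
by apply: ereal_sup_ubound; exists 0.
Qed.

Lemma Lsup_ub p f t : (\int[mu]_(x in `[t, (t + 1)%R]) (cmod f x `^ p)%:E <= Lsup p f)%E.
Proof. by apply: ereal_sup_ubound; exists t. Qed.

Lemma Lunif_norm1E f : Lunif_norm 1 f = Lsup 1 f.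
Proof. by rewrite /Lunif_norm invr1 poweRe1// Lsup_ge0. Qed.

Lemma ub1_of_Lsup f N : cmeasurable f -> (Lsup 1 f <= N%:E)%E -> ub1 f (2 * N).
Proof.
move=> mf H t; have mc := measurable_cmod mf.
apply: (@le_trans _ _ (\int[mu]_(s in `[t, (t + 1)%R]) (2 * cmod f s)%:E)%E).
  apply: ge0_le_integral => //.
  - by move=> s _; rewrite lee_fin n1_ge0.
  - by apply/measurable_EFinP; apply: measurable_funTS; exact: measurable_n1.
  - by apply/measurable_EFinP; apply: measurable_funTS; exact: measurable_funM.
  - by move=> s _; rewrite lee_fin n1_normc.
rewrite ge0_integralM//; last 2 first.
- exact: measurable_funTS.
- by move=> s; exact: cmod_ge0.
rewrite EFinM; apply: lee_wpmul2l => //; apply: le_trans H; apply: le_trans (Lsup_ub 1 f t).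
by under [leRHS]eq_integral do rewrite powRr1 ?cmod_ge0//.
Qed.

Lemma ub2_of_Lsup f N : cmeasurable f -> (Lsup 2 f <= N%:E)%E -> ub2 f (2 * N).
Proof.
move=> mf H t; have mc := measurable_cmod mf.
have mc2 : measurable_fun [set: R] (fun s => cmod f s ^+ 2) by exact: measurable_funX.
apply: (@le_trans _ _ (\int[mu]_(s in `[t, (t + 1)%R]) (2 * cmod f s ^+ 2)%:E)%E).
  apply: ge0_le_integral => //.
  - by move=> s _; rewrite lee_fin sqr_ge0.
  - by apply/measurable_EFinP; apply: measurable_funTS; apply: measurable_funX; exact: measurable_n1.
  - by apply/measurable_EFinP; apply: measurable_funTS; exact: measurable_funM.
  - by move=> s _; rewrite lee_fin n1_sq_normc.
rewrite ge0_integralM//; last 2 first.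
- exact: measurable_funTS.
- by move=> s; exact: sqr_ge0.
rewrite EFinM; apply: lee_wpmul2l => //; apply: le_trans H; apply: le_trans (Lsup_ub 2 f t).
by under [leRHS]eq_integral => s _ do rewrite (powR_mulrn 2 (cmod_ge0 f s)).
Qed.

Lemma Lunif1_ub1 f N : cmeasurable f -> (Lunif_norm 1 f <= N%:E)%E -> ub1 f (2 * N).
Proof. by move=> mf; rewrite Lunif_norm1E; exact: ub1_of_Lsup. Qed.

Lemma Lunif2_ub2 f N : 0 <= N -> cmeasurable f -> (Lunif_norm 2 f <= N%:E)%E -> ub2 f (2 * N ^+ 2).
Proof.
move=> N0 mf H; apply: ub2_of_Lsup => //.
by apply: poweR_half_le => //; exact: Lsup_ge0.
Qed.

(** On [a, b] the kernel centred at [a] is at least exp(-(b - a)), so [kexp_unif] bounds the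
    integral without any count of unit intervals. *)
Lemma local_of_ub (w : R -> R) N a b : measurable_fun [set: R] w -> (forall s, 0 <= w s) ->
  (forall t, (\int[mu]_(s in `[t, (t + 1)%R]) (w s)%:E <= N%:E)%E) ->
  (\int[mu]_(s in `[a, b]) (w s)%:E < +oo)%E.
Proof.
move=> mw w0 wN.
apply: (@le_lt_trans _ _ ((expR (b - a))%:E * kexp 1 w a)%E); last first.
  by apply: lte_mul_pinfty; rewrite ?lee_fin ?expR_ge0// (le_lt_trans (kexp_unif a mw w0 wN)) ?ltry.
rewrite -ge0_integralM ?expR_ge0//; last 2 first.
- exact: measurable_kexp_integrand.
- by move=> s; rewrite mulr_ge0 ?expR_ge0.
apply: (@le_trans _ _ (\int[mu]_(s in `[a, b]) (expR (b - a) * (expR (- (1 * `|a - s|)) * w s))%:E)%E).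
  apply: ge0_le_integral => //.
  - by move=> s _; rewrite lee_fin.
  - by apply/measurable_EFinP; exact: measurable_funTS.
  - by apply/measurable_EFinP; apply: measurable_funTS; apply: measurable_funM => //; exact: measurable_kexp_integrand.
  - move=> s; rewrite /mkset in_itv /= => /andP[as_ sb]; rewrite lee_fin mulrA -expRD ler_peMl//.
    rewrite -[leLHS]expR0 ler_expR distrC ger0_norm ?subr_ge0//; lra.
apply: ge0_subset_integral => //.
- by apply/measurable_EFinP; apply: measurable_funM => //; exact: measurable_kexp_integrand.
- by move=> s _; rewrite lee_fin mulr_ge0 ?expR_ge0// mulr_ge0 ?expR_ge0.
Qed.

Lemma ub1_Lunif f N : cmeasurable f -> ub1 f N -> Lunif 1 f.
Proof.
move=> mf H; have mc := measurable_cmod mf.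
have le t : (\int[mu]_(x in `[t, (t + 1)%R]) (cmod f x `^ 1)%:E <= N%:E)%E.
  apply: le_trans (H t); apply: ge0_le_integral => //.
  - by move=> s _; rewrite lee_fin powR_ge0.
  - apply/measurable_EFinP; apply: measurable_funTS.
    by under eq_fun do rewrite powRr1 ?cmod_ge0//.
  - by apply/measurable_EFinP; apply: measurable_funTS; exact: measurable_n1.
  - by move=> s _; rewrite lee_fin powRr1 ?cmod_ge0// normc_n1.
split; last first.
  by rewrite Lunif_norm1E; apply: (@le_lt_trans _ _ N%:E); [apply: ge_ereal_sup => _ [t _ <-]; exact: le|rewrite ltry].
split => // a b; apply: (@local_of_ub (fun s => cmod f s `^ 1) N) => //.
  by under eq_fun do rewrite powRr1 ?cmod_ge0//.
by move=> s; rewrite powR_ge0.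
Qed.

Lemma ub2_Lunif f N : cmeasurable f -> ub2 f N -> Lunif 2 f.
Proof.
move=> mf H; have mc := measurable_cmod mf.
have E s : cmod f s `^ 2 = cmod f s ^+ 2 := powR_mulrn 2 (cmod_ge0 f s).
have me : measurable_fun [set: R] (fun s => cmod f s `^ 2).
  by under eq_fun do rewrite E; exact: measurable_funX.
have le t : (\int[mu]_(x in `[t, (t + 1)%R]) (cmod f x `^ 2)%:E <= N%:E)%E.
  apply: le_trans (H t); apply: ge0_le_integral => //.
  - by move=> s _; rewrite lee_fin powR_ge0.
  - by apply/measurable_EFinP; exact: measurable_funTS.
  - by apply/measurable_EFinP; apply: measurable_funTS; apply: measurable_funX; exact: measurable_n1.
  - by move=> s _; rewrite lee_fin E lerXn2r ?nnegrE ?cmod_ge0 ?n1_ge0// normc_n1.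
split; last first.
  rewrite /Lunif_norm; apply: poweR_lt_y; last exact: Lsup_ge0.
  by apply: (@le_lt_trans _ _ N%:E); [apply: ge_ereal_sup => _ [t _ <-]; exact: le|rewrite ltry].
split => // a b; apply: (@local_of_ub (fun s => cmod f s `^ 2) N) => //.
by move=> s; rewrite powR_ge0.
Qed.

Lemma Lsup_fin p f : (Lsup p f < +oo)%E -> exists2 N, 0 <= N & (Lsup p f <= N%:E)%E.
Proof.
by have := Lsup_ge0 p f; case: (Lsup p f) => [N||] //; rewrite lee_fin => N0 _; exists N.
Qed.

Lemma Lunif1P f : Lunif 1 f -> exists2 N, 0 <= N & ub1 f N.
Proof.
move=> [[mf _]]; rewrite Lunif_norm1E => /Lsup_fin[N N0 H].
by exists (2 * N); [rewrite mulr_ge0|exact: ub1_of_Lsup].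
Qed.

Lemma Lunif2P f : Lunif 2 f -> exists2 N, 0 <= N & ub2 f N.
Proof.
move=> [[mf _]] /poweR_lty_inv H.
have /Lsup_fin[N N0 H'] : (Lsup 2 f < +oo)%E by apply: H; [rewrite invr_eq0|exact: Lsup_ge0].
by exists (2 * N); [rewrite mulr_ge0|exact: ub2_of_Lsup].
Qed.

(** Young's inequality u v <= u^2 / (2 d) + d v^2 / 2 under the kernel. A large [d] with v = 1 makes
    the contribution of |Q| small; [d] equal to the distance of the coefficients makes a product
    with Q - Q' of order [d]. *)
Lemma kexp_prod nu (u v : R -> R) (d A B x : R) : measurable_fun [set: R] u -> measurable_fun [set: R] v ->
  (forall s, 0 <= u s) -> (forall s, 0 <= v s) -> 0 < d ->
  (kexp nu (fun s => u s ^+ 2)%R x <= A%:E)%E -> (kexp nu (fun s => v s ^+ 2)%R x <= B%:E)%E ->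
  (kexp nu (fun s => u s * v s)%R x <= ((2 * d)^-1 * A + d / 2 * B)%:E)%E.
Proof.
move=> mu_ mv u0 v0 d0 hA hB.
have c1 : 0 <= (2 * d)^-1 by rewrite invr_ge0 mulr_ge0// ltW.
have c2 : 0 <= d / 2 by rewrite divr_ge0// ltW.
have m2u : measurable_fun [set: R] (fun s => u s ^+ 2) by exact: measurable_funX.
have m2v : measurable_fun [set: R] (fun s => v s ^+ 2) by exact: measurable_funX.
apply: (@le_trans _ _ (kexp nu (fun s => (2 * d)^-1 * u s ^+ 2 + d / 2 * v s ^+ 2)%R x)).
  apply: kexp_le; first exact: measurable_funM.
    by apply: measurable_funD; exact: measurable_funM.
  move=> s; rewrite mulr_ge0//=.
  have h : 0 <= (2 * d)^-1 * (u s - d * v s) ^+ 2 by rewrite mulr_ge0// sqr_ge0.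
  have h2 : (2 * d)^-1 * (u s - d * v s) ^+ 2 = (2 * d)^-1 * u s ^+ 2 + d / 2 * v s ^+ 2 - u s * v s by field; rewrite gt_eqF.
  by rewrite -subr_ge0 -h2.
rewrite kexpD; last 4 first.
- exact: measurable_funM.
- exact: measurable_funM.
- by move=> s; rewrite mulr_ge0 ?sqr_ge0.
- by move=> s; rewrite mulr_ge0 ?sqr_ge0.
rewrite !kexpZ//; try by move=> s; exact: sqr_ge0.
by rewrite EFinD !EFinM leeD// lee_wpmul2l.
Qed.

Definition cK : R := 2 * expR 1.

Lemma cK_gt0 : 0 < cK.
Proof. by rewrite mulr_gt0 ?expR_gt0. Qed.

Lemma kexp_ub nu (w : R -> R) N x : 2 <= nu -> measurable_fun [set: R] w -> (forall s, 0 <= w s) ->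
  (forall t, (\int[mu]_(s in `[t, (t + 1)%R]) (w s)%:E <= N%:E)%E) ->
  (kexp (nu - 1) w x <= (cK * N)%:E)%E.
Proof.
move=> nu2 mw w0 wN; apply: le_trans (kexp_unif x mw w0 wN).
by apply: kexp_nu => //; lra.
Qed.

(* The coefficient b of the system, produced by 2 nu y = p + m. *)
Definition bcoef nu Q tau : R -> R[i] := fun x => (((2 * nu)^-1)%:C)%C * (tau x - Q x * Q x).

Lemma cmeasurable_bcoef nu Q tau : cmeasurable Q -> cmeasurable tau -> cmeasurable (bcoef nu Q tau).
Proof.
move=> mQ mt; apply: cmeasurableM; first exact: cmeasurable_cst.
by apply: cmeasurableB => //; exact: cmeasurableM.
Qed.

Lemma n1_bcoef nu Q tau x : 0 < nu -> 2 * n1 (bcoef nu Q tau x) <= nu^-1 * (n1 (tau x) + n1 (Q x) ^+ 2).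
Proof.
move=> nu0; rewrite /bcoef n1_real ger0_norm ?invr_ge0 ?mulr_ge0 ?(ltW nu0)//.
have : n1 (tau x - Q x * Q x) <= n1 (tau x) + n1 (Q x) ^+ 2.
  by apply: (le_trans (n1B _ _)); rewrite lerD2l expr2 n1M.
have -> : 2 * ((2 * nu)^-1 * n1 (tau x - Q x * Q x)) = nu^-1 * n1 (tau x - Q x * Q x) by field; rewrite gt_eqF.
by move=> h; rewrite ler_wpM2l// invr_ge0 ltW.
Qed.

Lemma kexp1_le nu x : 2 <= nu -> (kexp (nu - 1) (fun s => (1 : R) ^+ 2)%R x <= (2 / (nu - 1))%:E)%E.
Proof.
move=> nu2; have nu1 : 0 < nu - 1 by lra.
rewrite -(kexp1 x nu1); rewrite (_ : (fun=> _) = (fun=> 1))//.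
by apply/funext => s; rewrite expr1n.
Qed.

(** The budget 1/12 is shared by three terms of at most 1/36. With D = cK N + 1 and Young parameter
    18 D, the integral of |Q| contributes cK N / (36 D) and 18 D / (nu - 1), and the integral of 2
    |b| contributes 2 cK N / nu. The middle term forces 648 = 36 * 18. *)
Lemma pot_small nu Q tau N : cmeasurable Q -> cmeasurable tau -> 0 <= N -> ub2 Q N -> ub1 tau N ->
  1 + 648 * (cK * N + 1) <= nu -> small nu (1 / 12) (pot Q (bcoef nu Q tau)).
Proof.
move=> mQ mt N0 HQ Ht hnu x.
have c0 := cK_gt0.
have cN : 0 <= cK * N by rewrite mulr_ge0// ltW.
pose D := cK * N + 1; rewrite -/D in hnu.
have D1 : 1 <= D by rewrite /D; lra.
have nu2 : 2 <= nu by lra.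
have nu0 : 0 < nu by lra.
have mn := measurable_n1 mQ; have mnt := measurable_n1 mt.
have mn2 : measurable_fun [set: R] (fun s => n1 (Q s) ^+ 2) by exact: measurable_funX.
have k1 : (kexp (nu - 1) (fun s => n1 (Q s) ^+ 2)%R x <= (cK * N)%:E)%E.
  by apply: kexp_ub => // s; exact: sqr_ge0.
have k2 : (kexp (nu - 1) (fun s => n1 (tau s)) x <= (cK * N)%:E)%E.
  by apply: kexp_ub => // s; exact: n1_ge0.
have D0 : 0 < 18 * D by lra.
have := @kexp_prod (nu - 1) (fun s => n1 (Q s)) (fun=> 1) (18 * D) _ _ x mn (measurable_cst _)
   (fun s => n1_ge0 _) (fun=> ler01) D0 k1 (kexp1_le x nu2).
under [X in (kexp _ X _ <= _)%E -> _]eq_fun do rewrite mulr1.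
move=> k3.
apply: (@le_trans _ _ (kexp (nu - 1) (fun s => n1 (Q s) + nu^-1 * (n1 (tau s) + n1 (Q s) ^+ 2))%R x)).
  apply: kexp_le.
  - by apply: measurable_pot => //; exact: cmeasurable_bcoef.
  - by apply: measurable_funD => //; apply: measurable_funM => //; apply: measurable_funD.
  - by move=> s; rewrite pot_ge0 lerD2l n1_bcoef.
have i0 : 0 <= nu^-1 by rewrite invr_ge0 ltW.
rewrite kexpD//; last 3 first.
- by apply: measurable_funM => //; apply: measurable_funD.
- by move=> s; exact: n1_ge0.
- by move=> s; rewrite mulr_ge0// addr_ge0 ?n1_ge0 ?sqr_ge0.
rewrite kexpZ//; last 2 first.
- exact: measurable_funD.
- by move=> s; rewrite addr_ge0 ?n1_ge0 ?sqr_ge0.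
rewrite kexpD//; last 2 first.
- by move=> s; exact: n1_ge0.
- by move=> s; exact: sqr_ge0.
apply: (@le_trans _ _ (((2 * (18 * D))^-1 * (cK * N) + 18 * D / 2 * (2 / (nu - 1)))%:E + (nu^-1)%:E * ((cK * N)%:E + (cK * N)%:E))%E).
  by apply: leeD => //; apply: lee_wpmul2l => //; exact: leeD.
rewrite -EFinD [X in (X <= _)%E](_ : _ = ((2 * (18 * D))^-1 * (cK * N) + 18 * D / 2 * (2 / (nu - 1)) + nu^-1 * (cK * N + cK * N))%:E)// lee_fin.
have e1 : (2 * (18 * D))^-1 * (cK * N) <= 1 / 36.
  by rewrite mulrC ler_pdivrMr; rewrite /D; lra.
have e2 : 18 * D / 2 * (2 / (nu - 1)) <= 1 / 36.
  have -> : 18 * D / 2 * (2 / (nu - 1)) = (18 * D) / (nu - 1) by field; lra.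
  by rewrite ler_pdivrMr; lra.
have e3 : nu^-1 * (cK * N + cK * N) <= 1 / 36.
  by rewrite mulrC ler_pdivrMr//; move: hnu; rewrite /D; lra.
lra.
Qed.

(** The squares in [bcoef] are compared through Q^2 - Q'^2 = (Q - Q') (Q + Q'). The constant adds up
    the contributions cK / 2 + 1 of Q - Q', cK of tau - tau', and cK / 2 + 2 cK N of the product,
    the prefactor 1 / nu being bounded by 1. *)
Lemma pot_diff_small nu Q tau Q' tau' N d : cmeasurable Q -> cmeasurable tau -> cmeasurable Q' -> cmeasurable tau' ->
  0 <= N -> ub2 Q N -> ub2 Q' N -> 2 <= nu -> 0 < d ->
  ub2 (fun x => Q x - Q' x) (d ^+ 2) -> ub1 (fun x => tau x - tau' x) d ->
  small nu ((2 * cK + 1 + 2 * cK * N) * d)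
   (pot (fun x => Q x - Q' x) (fun x => bcoef nu Q tau x - bcoef nu Q' tau' x)).
Proof.
move=> mQ mt mQ' mt' N0 HQ HQ' nu2 d0 HdQ Hdt x.
have c0 := cK_gt0.
have mdQ : cmeasurable (fun x => Q x - Q' x) by exact: cmeasurableB.
have mdt : cmeasurable (fun x => tau x - tau' x) by exact: cmeasurableB.
have msQ : cmeasurable (fun x => Q x + Q' x) by exact: cmeasurableD.
have mn := measurable_n1 mdQ; have mnt := measurable_n1 mdt; have mns := measurable_n1 msQ.
have mn2 : measurable_fun [set: R] (fun s => n1 (Q s - Q' s) ^+ 2) by exact: measurable_funX.
have mns2 : measurable_fun [set: R] (fun s => n1 (Q s + Q' s) ^+ 2) by exact: measurable_funX.
have k1 : (kexp (nu - 1) (fun s => n1 (Q s - Q' s) ^+ 2)%R x <= (cK * d ^+ 2)%:E)%E.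
  by apply: kexp_ub => // s; exact: sqr_ge0.
have k2 : (kexp (nu - 1) (fun s => n1 (tau s - tau' s)%R) x <= (cK * d)%:E)%E.
  by apply: kexp_ub => // s; exact: n1_ge0.
have k4 : (kexp (nu - 1) (fun s => n1 (Q s + Q' s) ^+ 2)%R x <= (cK * (4 * N))%:E)%E.
  apply: kexp_ub => //; first by move=> s; exact: sqr_ge0.
  move=> t.
  have mQ2 : measurable_fun [set: R] (fun s => n1 (Q s) ^+ 2) by apply: measurable_funX; exact: measurable_n1.
  have mQ2' : measurable_fun [set: R] (fun s => n1 (Q' s) ^+ 2) by apply: measurable_funX; exact: measurable_n1.
  apply: (@le_trans _ _ (\int[mu]_(s in `[t, (t + 1)%R]) ((2 * n1 (Q s) ^+ 2)%:E + (2 * n1 (Q' s) ^+ 2)%:E))%E).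
    apply: ge0_le_integral => //.
    - by move=> s _; rewrite lee_fin sqr_ge0.
    - by apply/measurable_EFinP; exact: measurable_funTS.
    - by apply: emeasurable_funD; apply/measurable_EFinP; apply: measurable_funTS; exact: measurable_funM.
    - move=> s _; rewrite -EFinD lee_fin.
      have h := n1D (Q s) (Q' s); have h0 := n1_ge0 (Q s + Q' s).
      have : n1 (Q s + Q' s) ^+ 2 <= (n1 (Q s) + n1 (Q' s)) ^+ 2 by rewrite lerXn2r ?nnegrE// addr_ge0 ?n1_ge0.
      by move/le_trans; apply; exact: sqrD_le2.
  rewrite ge0_integralD//; last 4 first.
  - by move=> s _; rewrite lee_fin mulr_ge0 ?sqr_ge0.
  - by apply/measurable_EFinP; apply: measurable_funTS; exact: measurable_funM.
  - by move=> s _; rewrite lee_fin mulr_ge0 ?sqr_ge0.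
  - by apply/measurable_EFinP; apply: measurable_funTS; exact: measurable_funM.
  rewrite !ge0_integralM//; try by move=> s; exact: sqr_ge0.
  - apply: (@le_trans _ _ (2%:E * N%:E + 2%:E * N%:E)%E).
      by apply: leeD; apply: lee_wpmul2l => //.
    by rewrite -EFinM -EFinD lee_fin; lra.
  - exact: measurable_funTS.
  - exact: measurable_funTS.
have := @kexp_prod (nu - 1) (fun s => n1 (Q s - Q' s)) (fun=> 1) d _ _ x mn (measurable_cst _)
   (fun s => n1_ge0 _) (fun=> ler01) d0 k1 (kexp1_le x nu2).
under [X in (kexp _ X _ <= _)%E -> _]eq_fun do rewrite mulr1.
move=> k3.
have k5 := @kexp_prod (nu - 1) (fun s => n1 (Q s - Q' s)) (fun s => n1 (Q s + Q' s)) d _ _ x mn mns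
   (fun s => n1_ge0 _) (fun s => n1_ge0 _) d0 k1 k4.
apply: (@le_trans _ _ (kexp (nu - 1) (fun s => n1 (Q s - Q' s) + (n1 (tau s - tau' s) + n1 (Q s - Q' s) * n1 (Q s + Q' s)))%R x)).
  apply: kexp_le.
  - by apply: measurable_pot => //; apply: cmeasurableB; exact: cmeasurable_bcoef.
  - by apply: measurable_funD => //; apply: measurable_funD => //; apply: measurable_funM.
  - move=> s; rewrite pot_ge0 lerD2l.
    have -> : bcoef nu Q tau s - bcoef nu Q' tau' s = (((2 * nu)^-1)%:C)%C * ((tau s - tau' s) - (Q s - Q' s) * (Q s + Q' s)).
      by rewrite /bcoef; ring.
    have nu0 : 0 < nu by lra.
    rewrite n1_real ger0_norm ?invr_ge0 ?mulr_ge0 ?(ltW nu0)//.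
    set X := n1 _; have hX : X <= n1 (tau s - tau' s) + n1 (Q s - Q' s) * n1 (Q s + Q' s).
      by apply: (le_trans (n1B _ _)); rewrite lerD2l n1M.
    apply: le_trans hX; have -> : 2 * ((2 * nu)^-1 * X) = nu^-1 * X by field; rewrite gt_eqF.
    by rewrite ler_piMl ?n1_ge0// invf_le1//; lra.
have pn s : 0 <= n1 (Q s - Q' s) * n1 (Q s + Q' s) by rewrite mulr_ge0 ?n1_ge0.
have mprod : measurable_fun [set: R] (fun s => n1 (Q s - Q' s) * n1 (Q s + Q' s)) by exact: measurable_funM.
rewrite kexpD//; last 3 first.
- exact: measurable_funD.
- by move=> s; exact: n1_ge0.
- by move=> s; rewrite addr_ge0 ?n1_ge0.
rewrite kexpD//; last by move=> s; exact: n1_ge0.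
apply: le_trans (leeD k3 (leeD k2 k5)) _.
rewrite -!EFinD lee_fin.
have e1 : (2 * d)^-1 * (cK * d ^+ 2) = cK / 2 * d by field; rewrite gt_eqF.
have e2 : d / 2 * (2 / (nu - 1)) <= d.
  have -> : d / 2 * (2 / (nu - 1)) = d * (nu - 1)^-1 by field; lra.
  by rewrite ler_piMr ?(ltW d0)// invf_le1; lra.
rewrite e1.
have : d / 2 * (cK * (4 * N)) = 2 * cK * N * d by field.
have : 0 <= cK * d by rewrite mulr_ge0// ltW.
lra.
Qed.

End UnifBounds.

(** * The space L^2 *)

Section L2facts.
Context {R : realType}.
Notation mu := (@lebesgue_measure R).
Implicit Types (f g : R -> R[i]) (c : R).

Definition sqint f : \bar R := (\int[mu]_x (cmod f x ^+ 2)%:E)%E.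
Definition sqint1 f : \bar R := (\int[mu]_x (n1 (f x) ^+ 2)%:E)%E.

Lemma sqint_ge0 f : (0 <= sqint f)%E.
Proof. by apply: integral_ge0 => x _; rewrite lee_fin sqr_ge0. Qed.

Lemma L2normE f : L2norm f = (sqint f `^ 2^-1)%E.
Proof.
rewrite /L2norm unlock /=; congr (_ `^ _)%E; apply: eq_integral => x _ /=.
by rewrite ger0_norm ?cmod_ge0// (powR_mulrn 2 (cmod_ge0 f x)).
Qed.

Lemma L2norm_ge0 f : (0 <= L2norm f)%E.
Proof. by rewrite L2normE poweR_ge0. Qed.

Lemma L2norm_le f g c : 0 <= c -> (sqint f <= (c ^+ 2)%:E * sqint g)%E ->
  (L2norm f <= c%:E * L2norm g)%E.
Proof.
move=> c0 h; rewrite !L2normE.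
have -> : c%:E = (((c ^+ 2)%:E : \bar R) `^ 2^-1)%E.
  by rewrite poweR_EFin powR12_sqrt ?sqr_ge0// sqrtr_sqr ger0_norm.
rewrite -poweRM ?sqint_ge0 ?lee_fin ?sqr_ge0//.
apply: gt0_ler_poweR => //.
- by rewrite in_itv /= leey sqint_ge0.
- by rewrite in_itv /= leey mule_ge0 ?sqint_ge0 ?lee_fin ?sqr_ge0.
Qed.

Lemma measurable_cmod_sq f : cmeasurable f -> measurable_fun [set: R] (fun x => (cmod f x ^+ 2)%:E).
Proof. by move=> mf; apply/measurable_EFinP; apply: measurable_funX; exact: measurable_cmod. Qed.

Lemma measurable_n1_sq f : cmeasurable f -> measurable_fun [set: R] (fun x => (n1 (f x) ^+ 2)%:E).
Proof. by move=> mf; apply/measurable_EFinP; apply: measurable_funX; exact: measurable_n1. Qed.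

Lemma sqint_le1 f : cmeasurable f -> (sqint f <= sqint1 f)%E.
Proof.
move=> mf; apply: ge0_le_integral; first exact: measurableT.
- by move=> s _; rewrite lee_fin sqr_ge0.
- exact: measurable_cmod_sq.
- exact: measurable_n1_sq.
- by move=> s _; rewrite lee_fin lerXn2r ?nnegrE ?cmod_ge0 ?n1_ge0// normc_n1.
Qed.

Lemma sqint1_le f : cmeasurable f -> (sqint1 f <= 2%:E * sqint f)%E.
Proof.
move=> mf; rewrite /sqint -ge0_integralM//; last 2 first.
- by apply: measurable_funX; exact: measurable_cmod.
- by move=> s; exact: sqr_ge0.
apply: ge0_le_integral; first exact: measurableT.
- by move=> s _; rewrite lee_fin sqr_ge0.
- exact: measurable_n1_sq.
- by apply/measurable_EFinP; apply: measurable_funM => //; apply: measurable_funX; exact: measurable_cmod.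
- by move=> s _; rewrite lee_fin n1_sq_normc.
Qed.

Lemma L2norm_le1 f g c : 0 <= c -> cmeasurable f -> cmeasurable g ->
  (sqint1 f <= (c ^+ 2)%:E * sqint1 g)%E -> (L2norm f <= (2 * c)%:E * L2norm g)%E.
Proof.
move=> c0 mf mg h; apply: L2norm_le; first exact: mulr_ge0.
apply: (le_trans (sqint_le1 mf)); apply: (le_trans h).
have c2 : (0 <= (c ^+ 2)%:E :> \bar R)%E by rewrite lee_fin sqr_ge0.
apply: (le_trans (lee_wpmul2l c2 (sqint1_le mg))).
rewrite muleA -EFinM; apply: lee_wpmul2r; first exact: sqint_ge0.
rewrite lee_fin exprMn mulrC ler_wpM2r ?sqr_ge0//; lra.
Qed.

Lemma L2P f : L2 f <-> cmeasurable f /\ (sqint f < +oo)%E.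
Proof.
split=> -[mf h]; split => //.
  by move: h; rewrite L2normE; apply: poweR_lty_inv; [rewrite invr_eq0|exact: sqint_ge0].
by rewrite L2normE; apply: poweR_lt_y => //; exact: sqint_ge0.
Qed.

Lemma L2P1 f : L2 f <-> cmeasurable f /\ (sqint1 f < +oo)%E.
Proof.
rewrite L2P; split=> -[mf h]; split => //.
  by apply: (le_lt_trans (sqint1_le mf)); rewrite lte_mul_pinfty ?sqint_ge0.
exact: le_lt_trans (sqint_le1 mf) h.
Qed.

Lemma L2norm_fin f : L2 f -> exists2 r, 0 <= r & L2norm f = r%:E.
Proof.
move=> [_]; have := L2norm_ge0 f; case: (L2norm f) => [r||]//.
by rewrite lee_fin => r0 _; exists r.
Qed.

Lemma L2norm_add f g : cmeasurable f -> cmeasurable g ->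
  (L2norm (fun x => f x + g x)%R <= L2norm f + L2norm g)%E.
Proof.
move=> mf mg; have := @minkowski_EFin _ _ R mu _ _ 2 (measurable_cmod mf) (measurable_cmod mg) (ler1n _ 2).
apply: le_trans.
rewrite -[leRHS]mul1e.
(* The sum of the moduli is viewed as a complex function, so that the pointwise inequality |f + g|
   <= |f| + |g| can be integrated with [L2norm_le]. *)
rewrite (_ : 'N[mu]_2%:E[EFin \o (cmod f \+ cmod g)%R]%E =
   L2norm (fun x => Complex (cmod f x + cmod g x) 0)); last first.
  rewrite /L2norm; apply: eq_Lnorm => x /=; congr EFin.
  by rewrite /cmod /= expr0n /= addr0 sqrtr_sqr ger0_norm// addr_ge0 ?cmod_ge0.
apply: L2norm_le => //; rewrite expr1n mul1e.
apply: ge0_le_integral; first exact: measurableT.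
- by move=> s _; rewrite lee_fin sqr_ge0.
- by apply: measurable_cmod_sq; exact: cmeasurableD.
- apply: measurable_cmod_sq; split => //.
    by apply: measurable_funD; exact: measurable_cmod.
  exact: measurable_cst.
- move=> s _; rewrite lee_fin lerXn2r ?nnegrE ?cmod_ge0//.
  rewrite {2}/cmod /= expr0n /= addr0 sqrtr_sqr ger0_norm ?addr_ge0 ?cmod_ge0//.
  exact: le_normcD.
Qed.

Lemma cmodM f g x : cmod (fun x => f x * g x) x = cmod f x * cmod g x.
Proof. exact: ComplexField.Normc.normcM. Qed.

Lemma L2norm_scale z f : cmeasurable f ->
  L2norm (fun x => z * f x) = ((ComplexField.Normc.normc z)%:E * L2norm f)%E.
Proof.
move=> mf; have z0 : 0 <= ComplexField.Normc.normc z by exact: (cmod_ge0 (fun=> z) 0).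
rewrite !L2normE.
rewrite -[X in (X%:E * _)%E](ger0_norm z0) -sqrtr_sqr -powR12_sqrt ?sqr_ge0// -poweR_EFin.
rewrite -poweRM ?sqint_ge0 ?lee_fin ?sqr_ge0//; congr (_ `^ _)%E.
rewrite /sqint -ge0_integralM ?sqr_ge0//; last 2 first.
- by apply: measurable_funX; exact: measurable_cmod.
- by move=> s; exact: sqr_ge0.
by apply: eq_integral => x _; rewrite (cmodM (fun=> z)) exprMn.
Qed.

Lemma L2norm_opp f : L2norm (fun x => - f x) = L2norm f.
Proof.
by rewrite /L2norm; apply: eq_Lnorm => x /=; congr EFin; exact: normcN.
Qed.

Lemma L2_add f g : L2 f -> L2 g -> L2 (fun x => f x + g x).
Proof.
move=> [mf hf] [mg hg]; split; first exact: cmeasurableD.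
by apply: (le_lt_trans (L2norm_add mf mg)); rewrite lte_add_pinfty.
Qed.

Lemma L2_scale z f : L2 f -> L2 (fun x => z * f x).
Proof.
move=> [mf hf]; split; first by apply: cmeasurableM => //; exact: cmeasurable_cst.
rewrite L2norm_scale// lte_mul_pinfty//; rewrite lee_fin; exact: (cmod_ge0 (fun=> z) 0).
Qed.

Lemma L2_opp f : L2 f -> L2 (fun x => - f x).
Proof. by move=> [mf hf]; split; [exact: cmeasurableN|rewrite L2norm_opp]. Qed.

Lemma L2_sub f g : L2 f -> L2 g -> L2 (fun x => f x - g x).
Proof. by move=> hf /L2_opp; exact: L2_add. Qed.

Lemma L2_0 : L2 (fun _ : R => 0).
Proof.
apply/L2P1; split; first exact: cmeasurable_cst.
rewrite /sqint1; under eq_integral do rewrite n10 expr0n.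
by rewrite integral0 ltry.
Qed.

Lemma cae_eq_sqint f g : cmeasurable f -> cmeasurable g -> cae_eq f g -> sqint f = sqint g.
Proof.
move=> mf mg h; apply: ge0_ae_eq_integral; first exact: measurableT.
- exact: measurable_cmod_sq.
- exact: measurable_cmod_sq.
- by move=> x _; rewrite lee_fin sqr_ge0.
- by move=> x _; rewrite lee_fin sqr_ge0.
by apply: ae_imply h => x /= e _; rewrite /cmod e.
Qed.

Lemma cae_eq_L2norm f g : cmeasurable f -> cmeasurable g -> cae_eq f g -> L2norm f = L2norm g.
Proof. by move=> mf mg h; rewrite !L2normE (cae_eq_sqint mf mg h). Qed.

Lemma L2norm_eq0 f : cmeasurable f -> L2norm f = 0%E -> cae_eq f (fun=> 0).
Proof.
move=> mf h; have m : measurable_fun [set: R] (EFin \o cmod f).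
  by apply/measurable_EFinP; exact: measurable_cmod.
have := @Lnorm_eq0_eq0 _ _ R mu _ _ m _ h; rewrite lte_fin ltr0n => /(_ isT).
by apply: ae_imply => x e _; have [/ComplexField.Normc.eq0_normc] := e I.
Qed.

Lemma L2norm_sub_eq0 f g : cmeasurable f -> cmeasurable g -> L2norm (fun x => f x - g x) = 0%E -> cae_eq f g.
Proof.
move=> mf mg /(L2norm_eq0 (cmeasurableB mf mg)).
by apply: ae_imply => x /= e _; apply/eqP; rewrite -subr_eq0 e.
Qed.

Lemma geometric_nneseries c : 0 <= c ->
  (\sum_(0 <= k <oo) (c * (2^-1) ^+ k)%:E < +oo)%E.
Proof.
move=> c0; have p k : (0 <= (c * (2^-1) ^+ k)%:E :> \bar R)%E by rewrite lee_fin mulr_ge0// exprn_ge0.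
apply: (@le_lt_trans _ _ (2 * c)%:E); last by rewrite ltry.
apply: lime_le; first by apply: is_cvg_nneseries => k _ _; exact: p.
apply: nearW => n; rewrite sumEFin lee_fin -mulr_sumr mulrC.
apply: ler_wpM2r => //.
suff -> : \sum_(0 <= i < n) (2^-1 : R) ^+ i = 2 * (1 - 2^-1 ^+ n).
  by rewrite ger_pMr// gerBl exprn_ge0.
elim: n => [|n IH]; first by rewrite big_geq// expr0 subrr mulr0.
by rewrite big_nat_recr//= IH exprS; field.
Qed.

(* The sum of [4 ^ k |u (k + 1) - u k| ^ 2] is integrable, so u k converges geometrically wherever
   it is finite, and its square root is an L^2 majorant. *)
Lemma L2_complete (u : nat -> R -> R[i]) c : 0 <= c -> (forall k, L2 (u k)) ->
  (forall k, (L2norm (fun x => u k.+1 x - u k x)%R <= (c * (4^-1) ^+ k)%:E)%E) ->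
  exists2 y, L2 y & exists C : R, forall k,
    (L2norm (fun x => y x - u k x)%R <= (C * (2^-1) ^+ k)%:E)%E.
Proof.
move=> c0 Lu du.
have mu_ k : cmeasurable (u k) by have [] := Lu k.
have md k : cmeasurable (fun x => u k.+1 x - u k x) by exact: cmeasurableB.
(* The squared steps decay like 16^-k in the mean; the weight 4^k still leaves a summable series,
   and its sum S controls each step pointwise by 2^-k times the square root of S. *)
pose G k x := ((4 : R) ^+ k * n1 (u k.+1 x - u k x) ^+ 2)%:E.
have mG k : measurable_fun [set: R] (G k).
  apply/measurable_EFinP; apply: measurable_funM => //; apply: measurable_funX.
  exact: (measurable_n1 (md k)).
have G0 k x : (0 <= G k x)%E by rewrite lee_fin mulr_ge0 ?sqr_ge0 ?exprn_ge0.
pose S x := (\sum_(k <oo) G k x)%E.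
have S0 x : (0 <= S x)%E by apply: nneseries_ge0 => k _ _; exact: G0.
have mS : measurable_fun [set: R] S by apply: ge0_emeasurable_sum.
have GS k x : (G k x <= S x)%E.
  apply: le_trans (nneseries_lim_ge k.+1 (fun n _ _ => G0 n x)).
  by rewrite big_nat_recr//= leeDr// sume_ge0.
have iS : (\int[mu]_x S x < +oo)%E.
  rewrite integral_nneseries//.
  apply: le_lt_trans (geometric_nneseries (c := 2 * c ^+ 2) _); last by rewrite mulr_ge0 ?sqr_ge0.
  apply: lee_nneseries => [k _ _|k _]; first by apply: integral_ge0.
  rewrite /G ge0_integralM ?exprn_ge0//; last 2 first.
  - by apply: measurable_funX; exact: (measurable_n1 (md k)).
  - by move=> s; exact: sqr_ge0.
  have h := sqint1_le (md k); have hc := du k.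
  have c4 : 0 <= c * 4^-1 ^+ k by rewrite mulr_ge0 ?exprn_ge0.
  have h3 : (sqint (fun x => u k.+1 x - u k x)%R <= ((c * 4^-1 ^+ k) ^+ 2)%:E)%E.
    by apply: poweR_half_le => //; [exact: sqint_ge0|rewrite -L2normE].
  have p4 : (0 <= (4 ^+ k)%:E :> \bar R)%E by rewrite lee_fin exprn_ge0.
  apply: (le_trans (lee_wpmul2l p4 h)).
  have p2 : (0 <= (4 ^+ k * 2)%:E :> \bar R)%E by rewrite lee_fin mulr_ge0 ?exprn_ge0.
  rewrite muleA -EFinM; apply: (le_trans (lee_wpmul2l p2 h3)).
  rewrite -EFinM lee_fin exprMn.
  have e1 : (4 : R) ^+ k * (4^-1 ^+ k) = 1 by rewrite -exprMn mulfV ?expr1n// pnatr_eq0.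
  have -> : (4 : R) ^+ k * 2 * (c ^+ 2 * (4^-1 ^+ k) ^+ 2) = 2 * c ^+ 2 * (4^-1 ^+ k) * (4 ^+ k * 4^-1 ^+ k) by ring.
  rewrite e1 mulr1 ler_wpM2l ?mulr_ge0 ?sqr_ge0//.
  by rewrite lerXn2r ?nnegrE// lef_pV2 ?posrE// ler_nat.
have intS : mu.-integrable [set: R] S.
  apply/integrableP; split => //.
  by under eq_integral do rewrite gee0_abs//.
pose E := [set x | S x \is a fin_num].
have mE : measurable E.
  by rewrite -[E]setTI; apply: emeasurable_fin_num.
have aeE : {ae mu, forall x, E x}.
  have := @integrable_ae _ _ R mu _ measurableT S intS.
  by apply: ae_imply => x /(_ I).
(* [climit] requires the geometric bound at every point, so the sequence is replaced by 0 on the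
   null set where the sum is infinite. *)
pose ind x : R[i] := ((\1_E x)%:C)%C.
have mind : cmeasurable ind by split; [exact: (measurable_indic mE)|exact: measurable_cst].
pose F x := Num.sqrt (fine (S x)).
have mF : measurable_fun [set: R] F.
  apply: measurableT_comp; first by apply: continuous_measurable_fun; exact: sqrt_continuous.
  exact: measurableT_comp mS.
have F0 x : 0 <= F x by exact: sqrtr_ge0.
have FS x : E x -> (F x ^+ 2)%:E = S x.
  move=> Ex; rewrite /F sqr_sqrtr ?fineK//; apply: fine_ge0; exact: S0.
have [y my hy] : exists2 p, cmeasurable p & forall k x, n1 (p x - ind x * u k x) <= 4 * (2^-1) ^+ k * F x.
  apply: climit => [k|k x]; first exact: cmeasurableM.
  rewrite -mulrBr /ind n1_real ger0_norm// indicE.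
  have [Ex|nEx] := pselect (E x); last by rewrite memNset// mul0r mulr_ge0 ?exprn_ge0.
  rewrite mem_set// mul1r.
  have e2 : 0 <= 2^-1 ^+ k * F x by rewrite mulr_ge0 ?exprn_ge0.
  rewrite -(@ler_pXn2r _ 2)// ?nnegrE ?n1_ge0// exprMn.
  have := GS k x; rewrite -FS// lee_fin => hG.
  have -> : ((2^-1 : R) ^+ k) ^+ 2 = (4 ^+ k)^-1.
    by rewrite -exprM mulnC exprM exprVn -natrX -exprVn.
  by rewrite mulrC ler_pdivlMr ?exprn_gt0// mulrC.
have iF : (\int[mu]_x (F x ^+ 2)%:E < +oo)%E.
  rewrite (_ : (\int[mu]_x (F x ^+ 2)%:E = \int[mu]_x S x)%E)//.
  apply: ge0_ae_eq_integral; first exact: measurableT.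
  - by apply/measurable_EFinP; exact: measurable_funX.
  - exact: mS.
  - by move=> x _; rewrite lee_fin sqr_ge0.
  - by move=> x _; exact: S0.
  - by apply: ae_imply aeE => x Ex _; exact: FS.
have [A A0 hA] : exists2 A, 0 <= A & (\int[mu]_x (F x ^+ 2)%:E <= (A ^+ 2)%:E)%E.
  have : (0 <= \int[mu]_x (F x ^+ 2)%:E)%E by apply: integral_ge0 => x _; rewrite lee_fin sqr_ge0.
  move: iF; case: (\int[mu]_x (F x ^+ 2)%:E)%E => [r||]// _; rewrite lee_fin => r0.
  by exists (Num.sqrt r); rewrite ?sqrtr_ge0// sqr_sqrtr.
have bound k : (L2norm (fun x => y x - ind x * u k x)%R <= (4 * A * (2^-1) ^+ k)%:E)%E.
  have C0 : 0 <= 4 * A * 2^-1 ^+ k by rewrite !mulr_ge0 ?exprn_ge0.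
  have m1 : cmeasurable (fun x => y x - ind x * u k x) by apply: cmeasurableB => //; exact: cmeasurableM.
  rewrite L2normE -[X in (_ <= X%:E)%E](ger0_norm C0) -sqrtr_sqr -powR12_sqrt ?sqr_ge0// -poweR_EFin.
  apply: gt0_ler_poweR => //; rewrite ?in_itv /= ?leey ?sqint_ge0 ?lee_fin ?sqr_ge0//.
  apply: (le_trans (sqint_le1 m1)).
  apply: (@le_trans _ _ (\int[mu]_x ((4 * 2^-1 ^+ k) ^+ 2 * F x ^+ 2)%:E)%E).
    apply: ge0_le_integral; first exact: measurableT.
    - by move=> s _; rewrite lee_fin sqr_ge0.
    - exact: measurable_n1_sq.
    - by apply/measurable_EFinP; apply: measurable_funM => //; exact: measurable_funX.
    - by move=> s _; rewrite lee_fin -exprMn lerXn2r ?nnegrE ?n1_ge0// !mulr_ge0 ?exprn_ge0.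
  rewrite ge0_integralM ?sqr_ge0//; last 2 first.
  - exact: measurable_funX.
  - by move=> s; exact: sqr_ge0.
  have q0 : (0 <= ((4 * 2^-1 ^+ k) ^+ 2)%:E :> \bar R)%E by rewrite lee_fin sqr_ge0.
  apply: (le_trans (lee_wpmul2l q0 hA)).
  have -> : 4 * A * 2^-1 ^+ k = 4 * 2^-1 ^+ k * A by ring.
  by rewrite -EFinM -exprMn.
have bound' k : (L2norm (fun x => y x - u k x)%R <= (4 * A * (2^-1) ^+ k)%:E)%E.
  apply: le_trans (bound k); rewrite le_eqVlt; apply/orP; left; apply/eqP.
  apply: cae_eq_L2norm; first exact: cmeasurableB.
    by apply: cmeasurableB => //; exact: cmeasurableM.
  apply: ae_imply aeE => x Ex /= _; rewrite /ind indicE mem_set//.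
  by congr (_ - _); rewrite mul1r.
exists y; last by exists (4 * A).
have : L2 (fun x => (y x - u 0%N x) + u 0%N x).
  apply: L2_add => //; split; first exact: cmeasurableB.
  by apply: (le_lt_trans (bound' 0%N)); rewrite ltry.
by under [X in L2 X -> _]eq_fun do rewrite subrK.
Qed.

End L2facts.

(** * The resolvent for a fixed representation *)

Section GraphSystem.
Context {R : realType}.
Notation mu := (@lebesgue_measure R).
Implicit Types (Q tau y f g p m : R -> R[i]).

(** Pointwise derivatives are traded for primitives: substituting y0' = u + Q y0 into the equation
    leaves a first-order system that is linear in (y0, u) and has explicit densities. *)
Lemma S_graphP Q tau y f : cmeasurable Q -> cmeasurable tau ->
  S_graph Q tau y f <-> [/\ L2 y, L2 f & exists y0 u : R -> R[i], [/\ cae_eq y y0,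
    cprim y0 (fun x => u x + Q x * y0 x) &
    cprim u (fun x => tau x * y0 x - Q x * (u x + Q x * y0 x) - f x)]].
Proof.
move=> mQ mt; split=> -[Ly Lf [y0 [u]]].
  move=> [ACy ACu yy0 eu ef]; split => //; exists y0, u.
  have [mf _] := Lf.
  have [g0 P0] := AC_cprim ACy; have [g1 P1] := AC_cprim ACu.
  have my := cprim_measurable P0; have mu0 := cprim_measurable P1.
  have e0 : {ae mu, forall x, cderive y0 x = u x + Q x * y0 x}.
    by apply: ae_imply eu => x /= /(_ I) ->; rewrite subrK.
  have m0 : cmeasurable (fun x => u x + Q x * y0 x) by apply: cmeasurableD => //; exact: cmeasurableM.
  split => //; first by apply: (cprim_ae P0) => //; apply: ae_imply2 (cprim_derive P0) e0 => x -> ->.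
  apply: (cprim_ae P1).
    by apply: cmeasurableB => //; apply: cmeasurableB; exact: cmeasurableM.
  have H := ae_imply2 (fun x a b => conj a b) (cprim_derive P1) e0.
  by apply: ae_imply2 H ef => x [e1 e2] /= /(_ I) ->; rewrite -e1 -e2; ring.
move=> [yy0 P0 P1]; split => //; exists y0, u; split => //; [exact: cprim_AC P0|exact: cprim_AC P1| |].
  by apply: ae_imply (cprim_derive P0) => x /= -> _; rewrite addrK.
by apply: ae_imply2 (cprim_derive P0) (cprim_derive P1) => x /= -> -> _; ring.
Qed.

Variables (nu : R) (Q tau : R -> R[i]).
Hypotheses (nu0 : 0 < nu) (mQ : cmeasurable Q) (mt : cmeasurable tau).
Let b := bcoef nu Q tau.
Let lam : R[i] := - ((nu ^+ 2)%:C)%C.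

Let c2 : ((2 * nu)%:C)%C != 0 :> R[i].
Proof. by rewrite eq_complex /= eqxx andbT mulf_neq0// gt_eqF. Qed.

Let bE x z : b x * (((2 * nu)%:C)%C * z) = (tau x - Q x * Q x) * z.
Proof.
rewrite /b /bcoef mulrCA !mulrA -(rmorphM (real_complex R)) /= mulfV ?mul1r//.
by rewrite mulf_neq0// gt_eqF.
Qed.

(* p = nu y + u and m = nu y - u. *)
Lemma op_shift_system y f : op_shift (S_graph Q tau) lam y f -> exists p m,
  [/\ cprim p (fun x => (nu%:C)%C * p x + Hp Q b p m x - f x),
      cprim m (fun x => - (nu%:C)%C * m x + Hm Q b p m x + f x) &
      cae_eq (fun x => ((2 * nu)%:C)%C * y x) (fun x => p x + m x)].
Proof.
move=> [g /S_graphP[]// [my _] [mg _] [y0 [u [yy0 P0 P1]]] [[mf _] ef]].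
have P0' := cprimZ ((nu%:C)%C) P0.
have E2 : ((2 * nu)%:C)%C = (nu%:C)%C + (nu%:C)%C :> R[i].
  by rewrite -(rmorphD (real_complex R)) /=; congr (_%:C)%C; ring.
have m0 := cprim_measurable P0; have m1 := cprim_measurable P1.
exists (fun x => (nu%:C)%C * y0 x + u x), (fun x => (nu%:C)%C * y0 x + (-1) * u x).
have sumE x : (nu%:C)%C * y0 x + u x + ((nu%:C)%C * y0 x + (-1) * u x) = ((2 * nu)%:C)%C * y0 x.
  by rewrite E2; ring.
have ndE : ((nu ^+ 2)%:C)%C = (nu%:C)%C * (nu%:C)%C :> R[i] by rewrite -(rmorphM (real_complex R)) expr2.
have eg : {ae mu, forall x, g x = f x - (nu%:C)%C * (nu%:C)%C * y0 x}.
  by apply: ae_imply2 yy0 ef => x /= /(_ I) <- /(_ I) ->; rewrite /lam ndE; ring.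
have mp : cmeasurable (fun x => (nu%:C)%C * y0 x + u x).
  by apply: cmeasurableD => //; apply: cmeasurableM => //; exact: cmeasurable_cst.
have mm : cmeasurable (fun x => (nu%:C)%C * y0 x + (-1) * u x).
  by apply: cmeasurableD; apply: cmeasurableM => //; exact: cmeasurable_cst.
have mb : cmeasurable b by exact: cmeasurable_bcoef.
split.
- apply: (cprim_ae (cprimD P0' P1)).
    apply: cmeasurableB => //; apply: cmeasurableD; last exact: cmeasurable_Hp.
    by apply: cmeasurableM => //; exact: cmeasurable_cst.
  apply: ae_imply eg => x ->; rewrite /Hp sumE bE; ring.
- apply: (cprim_ae (cprimD P0' (cprimZ (-1) P1))).
    apply: cmeasurableD => //; apply: cmeasurableD; last exact: cmeasurable_Hm.
    by apply: cmeasurableM => //; exact: cmeasurable_cst.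
  apply: ae_imply eg => x ->; rewrite /Hm sumE bE; ring.
- by apply: ae_imply yy0 => x /= /(_ I) -> _; rewrite sumE.
Qed.

Lemma system_op_shift p m f y : L2 y -> L2 f ->
  cprim p (fun x => (nu%:C)%C * p x + Hp Q b p m x - f x) ->
  cprim m (fun x => - (nu%:C)%C * m x + Hm Q b p m x + f x) ->
  (forall x, ((2 * nu)%:C)%C * y x = p x + m x) ->
  op_shift (S_graph Q tau) lam y f.
Proof.
move=> Ly Lf Pp Pm ye; have [my _] := Ly; have [mf _] := Lf.
have c2' : (2 : R[i]) != 0 by rewrite pnatr_eq0.
have E2 : ((2 * nu)%:C)%C = 2 * (nu%:C)%C :> R[i] by rewrite (rmorphM (real_complex R)) /= rmorph_nat.
have ndE : ((nu ^+ 2)%:C)%C = (nu%:C)%C * (nu%:C)%C :> R[i] by rewrite -(rmorphM (real_complex R)) expr2.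
have nu1 : (nu%:C)%C != 0 :> R[i] by rewrite eq_complex /= eqxx andbT gt_eqF.
have yE x : y x = (((2 * nu)%:C)%C)^-1 * (p x + m x) by rewrite -ye mulKf.
pose g x := f x + lam * y x.
have Lg : L2 g by apply: L2_add => //; exact: L2_scale.
exists g; last first.
  by split => //; apply: ae_all => x _; rewrite /g addrK.
apply/S_graphP => //; split => //.
exists y, (fun x => 2^-1 * p x + (- 2^-1) * m x); split.
- by apply: ae_all => x _.
- have := cprimZ (((2 * nu)%:C)%C)^-1 (cprimD Pp Pm).
  rewrite (_ : (fun x => _ * (p x + m x)) = y); last by apply/funext => x; rewrite yE.
  congr (cprim _ _); apply/funext => x; rewrite /Hp /Hm (yE x) E2.
  by field.
- have := cprimD (cprimZ 2^-1 Pp) (cprimZ (- 2^-1) Pm).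
  congr (cprim _ _); apply/funext => x; rewrite /Hp /Hm -ye bE /g /lam ndE.
  have -> : m x = ((2 * nu)%:C)%C * y x - p x by rewrite ye; ring.
  by rewrite E2; field.
Qed.

End GraphSystem.

(** * Solvability and bounds at the parameter -nu^2 *)

Section FixedRepresentation.
Context {R : realType}.
Notation mu := (@lebesgue_measure R).
Variables (nu N : R) (Q tau : R -> R[i]).
Hypotheses (mQ : cmeasurable Q) (mt : cmeasurable tau) (N0 : 0 <= N) (HQ : ub2 Q N) (Ht : ub1 tau N)
  (hnu : 1 + 648 * (cK * N + 1) <= nu).
Let b := bcoef nu Q tau.
Let lam : R[i] := - ((nu ^+ 2)%:C)%C.

Lemma nu_ge3 : 3 <= nu.
Proof. have := hnu; have : 0 <= cK * N by rewrite mulr_ge0// ltW// cK_gt0. lra. Qed.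

Lemma nu_gt0 : 0 < nu.
Proof. have := nu_ge3; lra. Qed.

Lemma op_shift_unique y1 y2 f : op_shift (S_graph Q tau) lam y1 f ->
  op_shift (S_graph Q tau) lam y2 f -> cae_eq y1 y2.
Proof.
move=> S1 S2; have n0 := nu_gt0.
have mb : cmeasurable b by exact: cmeasurable_bcoef.
have L1 : L2 y1 by case: S1 => g [].
have L2' : L2 y2 by case: S2 => g [].
have [p1 [m1 [P1 M1 e1]]] := op_shift_system n0 mQ mt S1.
have [p2 [m2 [P2 M2 e2]]] := op_shift_system n0 mQ mt S2.
pose p x := p1 x + (-1) * p2 x; pose m x := m1 x + (-1) * m2 x.
have mp : cmeasurable p.
  by have := cprim_measurable (cprimD P1 (cprimZ (-1) P2)).
have mm : cmeasurable m.
  by have := cprim_measurable (cprimD M1 (cprimZ (-1) M2)).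
have P : cprim p (fun x => (nu%:C)%C * p x + Hp Q b p m x).
  have := cprimD P1 (cprimZ (-1) P2); congr (cprim _ _); apply/funext => x.
  by rewrite /p /m /Hp -/b; ring.
have M : cprim m (fun x => - (nu%:C)%C * m x + Hm Q b p m x).
  have := cprimD M1 (cprimZ (-1) M2); congr (cprim _ _); apply/funext => x.
  by rewrite /p /m /Hm -/b; ring.
have e : {ae mu, forall x, ((2 * nu)%:C)%C * (y1 x - y2 x) = p x + m x}.
  by apply: ae_imply2 e1 e2 => x /= /(_ I) h1 /(_ I) h2; rewrite mulrBr h1 h2 /p /m; ring.
have /L2P1[mz fz] : L2 (fun x => ((2 * nu)%:C)%C * (y1 x - y2 x)) by apply: L2_scale; exact: L2_sub.
have fin : (\int[mu]_x (n1 (p x + m x) ^+ 2)%:E < +oo)%E.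
  rewrite (_ : (\int[mu]_x (n1 (p x + m x) ^+ 2)%:E = sqint1 (fun x => ((2 * nu)%:C)%C * (y1 x - y2 x))%R)%E)//.
  apply: ge0_ae_eq_integral; first exact: measurableT.
  - by apply: measurable_n1_sq; exact: cmeasurableD.
  - exact: measurable_n1_sq.
  - by move=> x _; rewrite lee_fin sqr_ge0.
  - by move=> x _; rewrite lee_fin sqr_ge0.
  - by apply: ae_imply e => x h _; rewrite h.
have k1 : 1 / 12 <= 1 / 12 :> R by [].
have Z := system_uniqueness nu_ge3 mQ mb (pot_small mQ mt N0 HQ Ht hnu) k1 P M fin.
apply: ae_imply e => x + _; have [-> ->] := Z x; rewrite addr0 => /eqP.
rewrite mulf_eq0 subr_eq0 => /orP[|/eqP//].
by rewrite eq_complex /= eqxx andbT mulf_eq0 pnatr_eq0 (gt_eqF nu_gt0).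
Qed.

(** The function F of the overview as a real number; [fine] loses nothing for [f] in L^2, where the
    integral is finite. *)
Definition majorant (f : R -> R[i]) x : R := fine (ckexp 1 f x).

Section Data.
Variable f : R -> R[i].
Hypothesis Lf : L2 f.

Let mf : measurable_fun [set: R] (fun s => n1 (f s)).
Proof. by apply: measurable_n1; case: Lf. Qed.

Let ffin : (\int[mu]_s (n1 (f s) ^+ 2)%:E < +oo)%E.
Proof. by have /L2P1[] := Lf. Qed.

Lemma majorantE x : (majorant f x)%:E = ckexp 1 f x.
Proof.
rewrite /majorant fineK// ge0_fin_numE; last by apply: kexp_ge0 => s; exact: n1_ge0.
by apply: kexp_lty => // s; exact: n1_ge0.
Qed.

Lemma majorant_ge0 x : 0 <= majorant f x.
Proof. by rewrite -lee_fin majorantE; apply: kexp_ge0 => s; exact: n1_ge0. Qed.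

Lemma majorant_weight : weight (majorant f).
Proof.
split; first exact: majorant_ge0.
move=> x s; rewrite -lee_fin EFinM !majorantE.
by apply: kexp_shift => // t; exact: n1_ge0.
Qed.

Lemma majorant_dom x : (ckexp nu f x <= (majorant f x)%:E)%E.
Proof.
rewrite majorantE; apply: kexp_nu => //; first by move=> s; exact: n1_ge0.
have := nu_ge3; lra.
Qed.

Lemma measurable_majorant : measurable_fun [set: R] (majorant f).
Proof.
apply: measurableT_comp => //; apply: measurable_kexp => // s; exact: n1_ge0.
Qed.

(** One factor 2 is the price of exchanging the modulus with [n1], the other is the bound of the
    kernel operator in L^2 given by [kexp_L2]. *)
Lemma majorant_L2 (y : R -> R[i]) c : 0 <= c -> cmeasurable y ->
  (forall x, n1 (y x) <= c * majorant f x) -> (L2norm y <= (4 * c)%:E * L2norm f)%E.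
Proof.
move=> c0 my hy; have [mf' _] := Lf.
have -> : 4 * c = 2 * (2 * c) by ring.
apply: L2norm_le1 => //; first exact: mulr_ge0.
apply: (@le_trans _ _ (\int[mu]_x (c ^+ 2 * majorant f x ^+ 2)%:E)%E).
  apply: ge0_le_integral; first exact: measurableT.
  - by move=> s _; rewrite lee_fin sqr_ge0.
  - exact: measurable_n1_sq.
  - by apply/measurable_EFinP; apply: measurable_funM => //; apply: measurable_funX; exact: measurable_majorant.
  - by move=> s _; rewrite lee_fin -exprMn lerXn2r ?nnegrE ?n1_ge0 ?mulr_ge0 ?majorant_ge0.
rewrite ge0_integralM ?sqr_ge0//; last 2 first.
- by apply: measurable_funX; exact: measurable_majorant.
- by move=> s; exact: sqr_ge0.
have -> : ((2 * c) ^+ 2)%:E = ((c ^+ 2)%:E * 4%:E)%E :> \bar R by rewrite -EFinM; congr _%:E; ring.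
rewrite -muleA; apply: lee_wpmul2l; first by rewrite lee_fin sqr_ge0.
have := kexp_L2 mf (fun s => n1_ge0 _).
by under [in X in (X <= _)%E -> _]eq_integral do rewrite -!/(ckexp _ _ _) -!majorantE -EFinM -expr2.
Qed.

Lemma system_solution : exists p m, [/\ dom (majorant f) 4 p m,
  (forall x, p x = cUp nu (rhsp Q b f p m) x), (forall x, m x = cDn nu (rhsm Q b f p m) x) &
  op_shift (S_graph Q tau) lam (fun x => (((2 * nu)^-1)%:C)%C * (p x + m x)) f].
Proof.
have [mf' _] := Lf; have n0 := nu_gt0.
have mb : cmeasurable b by exact: cmeasurable_bcoef.
have sV := pot_small mQ mt N0 HQ Ht hnu.
have k1 : 1 / 12 <= 1 / 12 :> R by [].
have four : 0 <= 4 :> R by [].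
have [p [m [d ep em]]] := system_existence mQ mb mf' sV majorant_weight majorant_dom k1.
exists p, m; split => //; have [mp mm dp dm] := d.
have my : cmeasurable (fun x => (((2 * nu)^-1)%:C)%C * (p x + m x)).
  by apply: cmeasurableM; [exact: cmeasurable_cst|exact: cmeasurableD].
have yle x : n1 ((((2 * nu)^-1)%:C)%C * (p x + m x)) <= 2 * majorant f x.
  rewrite n1_real ger0_norm ?invr_ge0 ?mulr_ge0 ?(ltW n0)//.
  have h := n1D (p x) (m x); have h1 := dp x; have h2 := dm x; have := nu_ge3 => h3.
  rewrite mulrC ler_pdivrMr ?mulr_gt0//.
  have : 2 * majorant f x * 6 <= 2 * majorant f x * (2 * nu).
    by apply: ler_wpM2l; [rewrite mulr_ge0 ?majorant_ge0|lra].
  have := majorant_ge0 x; lra.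
have Ly : L2 (fun x => (((2 * nu)^-1)%:C)%C * (p x + m x)).
  split => //; have two : 0 <= 2 :> R by [].
  apply: (le_lt_trans (majorant_L2 two my yle)).
  by case: Lf => _ h; rewrite lte_mul_pinfty// lee_fin mulr_ge0.
have ext (h k : R -> R[i]) : (forall x, h x = k x) -> h = k by move=> ?; apply/funext.
apply: (system_op_shift n0 mQ mt (p := p) (m := m) Ly Lf).
- have := cUp_cprim (rhsp_meas mQ mb mf' d) (rhsp_fin mQ mb mf' sV majorant_weight majorant_dom four d).
  rewrite -(ext _ _ ep); congr (cprim _ _); apply/funext => x; rewrite /rhsp -/b; ring.
- have := cDn_cprim (rhsm_meas mQ mb mf' d) (rhsm_fin mQ mb mf' sV majorant_weight majorant_dom four d).
  rewrite -(ext _ _ em); congr (cprim _ _); apply/funext => x; rewrite /rhsm -/b; ring.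
- move=> x; rewrite mulrA -(rmorphM (real_complex R)) /= mulfV ?mul1r//.
  by rewrite mulf_neq0// gt_eqF.
Qed.

End Data.

(** By uniqueness every solution is the one built by iteration, which is at most (4 F + 4 F) / (2
    nu) <= 2 F because nu >= 3; then 8 = 4 * 2. *)
Lemma op_shift_bound y f : op_shift (S_graph Q tau) lam y f -> (L2norm y <= 8%:E * L2norm f)%E.
Proof.
move=> S; have Lf : L2 f by case: S => g _ [].
have n0 := nu_gt0.
have [p [m [[mp mm dp dm] _ _ S']]] := system_solution Lf.
have [my _] : L2 y by case: S => g [].
have [my' _] : L2 (fun x => (((2 * nu)^-1)%:C)%C * (p x + m x)) by case: S' => g [].
rewrite (cae_eq_L2norm my my' (op_shift_unique S S')).
have -> : 8%:E = (4 * 2)%:E :> \bar R by congr _%:E; ring.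
apply: majorant_L2 => // x.
rewrite n1_real ger0_norm ?invr_ge0 ?mulr_ge0 ?(ltW n0)//.
have h := n1D (p x) (m x); have h1 := dp x; have h2 := dm x; have := nu_ge3 => h3.
rewrite mulrC ler_pdivrMr ?mulr_gt0//.
have : 2 * majorant f x * 6 <= 2 * majorant f x * (2 * nu).
  by apply: ler_wpM2l; [rewrite mulr_ge0 ?majorant_ge0|lra].
have := majorant_ge0 Lf x; lra.
Qed.

End FixedRepresentation.

(** The differences of the p and of the m components are at most 8 K d F with K = 2 cK + 1 + 2 cK N,
    so the difference of the solutions is at most 8 K d F as well; [majorant_L2] contributes the
    remaining factor 4. *)
Lemma op_shift_difference (R : realType) (nu N d : R) (Q tau Q' tau' y y' f : R -> R[i]) :
  cmeasurable Q -> cmeasurable tau -> cmeasurable Q' -> cmeasurable tau' -> 0 <= N ->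
  ub2 Q N -> ub1 tau N -> ub2 Q' N -> ub1 tau' N -> 1 + 648 * (cK * N + 1) <= nu -> 0 < d ->
  ub2 (fun x => Q x - Q' x) (d ^+ 2) -> ub1 (fun x => tau x - tau' x) d ->
  op_shift (S_graph Q tau) (- ((nu ^+ 2)%:C)%C) y f ->
  op_shift (S_graph Q' tau') (- ((nu ^+ 2)%:C)%C) y' f ->
  (L2norm (fun x => y x - y' x)%R <= (32 * (2 * cK + 1 + 2 * cK * N) * d)%:E * L2norm f)%E.
Proof.
move=> mQ mt mQ' mt' N0 HQ Ht HQ' Ht' hnu d0 HdQ Hdt S S'.
have Lf : L2 f by case: S => g _ [].
have n0 : 0 < nu := nu_gt0 N0 hnu; have n3 := nu_ge3 N0 hnu.
have [p [m [D ep em s]]] := system_solution mQ mt N0 HQ Ht hnu Lf.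
have [p' [m' [D' ep' em' s']]] := system_solution mQ' mt' N0 HQ' Ht' hnu Lf.
have [my _] : L2 y by case: S => g [].
have [my' _] : L2 y' by case: S' => g [].
set K := 2 * cK + 1 + 2 * cK * N.
have c0 := @cK_gt0 R.
have K0 : 0 <= K * d by rewrite /K mulr_ge0 ?(ltW d0)// !addr_ge0 ?mulr_ge0 ?(ltW c0).
have k1 : 1 / 12 <= 1 / 12 :> R by [].
have n2 : 2 <= nu by lra.
have [mf _] := Lf.
have [mdp mdm hp hm] := system_difference mQ (cmeasurable_bcoef nu mQ mt) mQ' (cmeasurable_bcoef nu mQ' mt') mf
  (pot_small mQ mt N0 HQ Ht hnu) (pot_small mQ' mt' N0 HQ' Ht' hnu)
  (pot_diff_small mQ mt mQ' mt' N0 HQ HQ' n2 d0 HdQ Hdt) (majorant_weight Lf) (majorant_dom N0 hnu Lf) k1 K0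
  D D' ep em ep' em'.
set z := fun x => (((2 * nu)^-1)%:C)%C * (p x + m x); set z' := fun x => (((2 * nu)^-1)%:C)%C * (p' x + m' x).
have mz : cmeasurable z by case: s => g [[? _]].
have mz' : cmeasurable z' by case: s' => g [[? _]].
rewrite (@cae_eq_L2norm _ _ (fun x => z x - z' x)); last 3 first.
- exact: cmeasurableB.
- exact: cmeasurableB.
- by apply: ae_imply2 (op_shift_unique mQ mt N0 HQ Ht hnu S s) (op_shift_unique mQ' mt' N0 HQ' Ht' hnu S' s') => x /= h1 h2 _; rewrite h1// h2.
have -> : 32 * K * d = 4 * (8 * (K * d)) by ring.
apply: majorant_L2 => //; first by rewrite mulr_ge0.
  exact: cmeasurableB.
move=> x; rewrite /z /z' -mulrBr n1_real ger0_norm ?invr_ge0 ?mulr_ge0 ?(ltW n0)//.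
have -> : p x + m x - (p' x + m' x) = (p x - p' x) + (m x - m' x) by ring.
have h := n1D (p x - p' x) (m x - m' x); have h1 := hp x; have h2 := hm x.
rewrite mulrC ler_pdivrMr ?mulr_gt0//.
have e0 : 0 <= 8 * (K * d) * majorant f x.
  by apply: mulr_ge0; [exact: mulr_ge0|exact: majorant_ge0].
have : 8 * (K * d) * majorant f x * 2 <= 8 * (K * d) * majorant f x * (2 * nu).
  by apply: ler_wpM2l => //; lra.
move: h h1 h2; rewrite -/K; lra.
Qed.

(** * Smooth step functions *)

Section Smooth.
Context {R : realType}.
Implicit Types (f g : R -> R) (x c a : R) (n k : nat).

(** Differentiability of order [n] with the derivatives exhibited one after another, which makes
    closure under products, inverses and composition with affine maps a plain induction. *)
Fixpoint Cn n f : Prop :=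
  if n is m.+1 then exists2 f', (forall x, is_derive x (1 : R) f (f' x)) & Cn m f' else True.

Lemma CnW n f : Cn n.+1 f -> Cn n f.
Proof.
by elim: n f => [//|n IH] f [f' hf /IH Cf']; exists f'.
Qed.

Lemma Cn_cst n c : Cn n (fun=> c).
Proof.
elim: n c => [//|n IH] c; exists (fun=> 0) => // x; exact: is_derive_cst.
Qed.

Lemma CnD n f g : Cn n f -> Cn n g -> Cn n (fun x => f x + g x).
Proof.
elim: n f g => [//|n IH] f g [f' hf Cf'] [g' hg Cg'].
by exists (fun x => f' x + g' x); [move=> x; exact: is_deriveD|exact: IH].
Qed.

Lemma CnM n f g : Cn n f -> Cn n g -> Cn n (fun x => f x * g x).
Proof.
elim: n f g => [//|n IH] f g Cf Cg.
have Cf0 := CnW Cf; have Cg0 := CnW Cg; move: Cf Cg => [f' hf Cf'] [g' hg Cg'].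
exists (fun x => f x * g' x + g x * f' x); first by move=> x; exact: is_deriveM.
by apply: CnD; exact: IH.
Qed.

Lemma CnV n f : (forall x, f x != 0) -> Cn n f -> Cn n (fun x => (f x)^-1).
Proof.
move=> f0; elim: n => [//|n IH] Cf.
have /IH Vf := CnW Cf; move: Cf => [f' hf Cf'].
exists (fun x => (-1) * ((f x)^-1 * (f x)^-1) * f' x).
  move=> x; have := is_deriveV (f0 x) (hf x); congr (is_derive _ _ _ _).
  by rewrite /GRing.scale /= expr2 invfM mulN1r.
apply: CnM => //; apply: CnM; first exact: Cn_cst.
exact: CnM.
Qed.

Lemma Cn_affine n f c a : Cn n f -> Cn n (fun x => f (c * (x - a))).
Proof.
elim: n f => [//|n IH] f [f' hf Cf'].
exists (fun x => f' (c * (x - a)) * c); last by apply: CnM; [exact: IH|exact: Cn_cst].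
move=> x; have h : is_derive x (1 : R) (fun x => c * (x - a)) c.
  rewrite -[X in is_derive _ _ _ X](mulr1 c).
  apply: (@is_deriveZ _ _ _ (fun x => x - a)); rewrite -[X in is_derive _ _ _ X](subr0 1).
  exact: is_deriveB.
exact: (@is_derive1_comp _ f (fun x => c * (x - a)) x _ _ (hf _) h).
Qed.

Lemma Cn_derivable n f x : Cn n.+1 f -> derivable (derive1n n f) x 1.
Proof.
elim: n f => [|n IH] f [f' hf Cf']; first by rewrite derive1n0; by case: (hf x).
rewrite derive1Sn; suff -> : derive1 f = f' by exact: IH.
by apply/funext => y; rewrite derive1E; by case: (hf y).
Qed.

(** The classical flat function exp(-1/x) with a power of 1/x in front: the derivative of a member
    of this family is a combination of two others, which gives smoothness by induction. *)
Definition flat k x : R := if 0 < x then x^-1 ^+ k * expR (- x^-1) else 0.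

Lemma flat_ge0 k x : 0 <= flat k x.
Proof. by rewrite /flat; case: ifPn => // x0; rewrite mulr_ge0 ?expR_ge0// exprn_ge0// invr_ge0 ltW. Qed.

(** With X = 1/x this is X^(k+2) <= (k+2)! exp X. Quadratic vanishing is what is needed for
    derivative 0 at the origin. *)
Lemma flat_le k x : flat k x <= (k.+2)`!%:R * x ^+ 2.
Proof.
rewrite /flat; case: ifPn => x0; last by rewrite mulr_ge0// sqr_ge0.
have X0 : 0 <= x^-1 by rewrite invr_ge0 ltW.
have fp : 0 < (k.+2)`!%:R :> R by rewrite ltr0n fact_gt0.
have h : x^-1 ^+ k.+2 <= (k.+2)`!%:R * expR (x^-1).
  rewrite mulrC -ler_pdivrMr//; apply: le_trans (expR_ge1Dxn k.+1 X0); lra.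
have -> : x^-1 ^+ k * expR (- x^-1) = x^-1 ^+ k.+2 * expR (- x^-1) * x ^+ 2.
  have e : x^-1 ^+ 2 * x ^+ 2 = 1 by rewrite -exprMn mulVf ?gt_eqF// expr1n.
  by rewrite -[k.+2]addn2 exprD; transitivity (x^-1 ^+ k * expR (- x^-1) * (x^-1 ^+ 2 * x ^+ 2)); [rewrite e mulr1|ring].
rewrite ler_wpM2r ?sqr_ge0// expRN ler_pdivrMr ?expR_gt0//.
Qed.

Lemma is_derive_quadratic f c : (forall x, `|f x| <= c * x ^+ 2) -> is_derive 0 (1 : R) f 0.
Proof.
move=> H; have f0 : f 0 = 0.
  by have := H 0; rewrite expr0n mulr0 normr_le0 => /eqP.
have c0 : 0 <= c by have := le_trans (normr_ge0 _) (H 1); rewrite expr1n mulr1.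
have L : (fun h : R => h^-1 *: (f (h *: (1 : R) + 0) - f 0)) @ 0^' --> (0 : R).
  apply/cvgrPdist_le => e e0; near=> h.
  rewrite sub0r normrN f0 subr0 addr0 /GRing.scale /= mulr1 normrM normfV.
  have h0 : h != 0 by near: h; exact: nbhs_dnbhs_neq.
  have nh : 0 < `|h| by rewrite normr_gt0.
  rewrite mulrC ler_pdivrMr//; apply: (le_trans (H h)).
  rewrite -real_normK ?num_real// expr2 mulrA ler_wpM2r//.
  have : `|h| <= e / (c + 1).
    near: h; apply: dnbhs0_le; rewrite divr_gt0//; lra.
  rewrite ler_pdivlMr; last lra.
  by have := normr_ge0 h; nra.
apply: DeriveDef; first by apply/cvg_ex; exists 0.
exact: cvg_lim L.
Unshelve. all: by end_near.
Qed.

Lemma flat_is_derive k x : is_derive x (1 : R) (flat k) (flat k.+2 x - k%:R * flat k.+1 x).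
Proof.
have [x0|] := ltP 0 x.
  have N : \near x, (fun y => y^-1 ^+ k * expR (- y^-1)) x = flat k x.
    near=> y; rewrite /flat; case: ifPn => //; rewrite -leNgt => /le_lt_trans h; exfalso.
    suff : y < y by rewrite ltxx.
    by apply: h; near: y; exact: lt_nbhsr.
  apply: (near_eq_is_derive N).
  have V : is_derive x (1 : R) (fun y => y^-1) (- (x^-1 ^+ 2)).
    have xn : x != 0 by rewrite gt_eqF.
    have := @is_deriveV _ id x 1 1 xn (is_derive_id _ _).
    congr (is_derive _ _ _ _); rewrite /GRing.scale /= mulr1 exprVn//.
  have D1 : is_derive x (1 : R) (fun y => y^-1 ^+ k) (- (k%:R * x^-1 ^+ k.+1)).
    have := @is_deriveX _ _ _ k _ _ _ V; congr (is_derive _ _ _ _); first by apply/funext => y; rewrite exprfctE.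
    rewrite /GRing.scale /=; case: k {N} => [|j]; first by rewrite !mul0r oppr0.
    by rewrite -[j.+2]addn2 exprD /=; ring.
  have D2 : is_derive x (1 : R) (fun y => expR (- y^-1)) (expR (- x^-1) * x^-1 ^+ 2).
    apply: (@is_derive1_comp _ expR (fun y => - y^-1)); rewrite -[X in is_derive _ _ _ X]opprK.
    exact: is_deriveN.
  have := is_deriveM D1 D2; congr (is_derive _ _ _ _).
  rewrite /flat x0 /GRing.scale /= -[k.+2]addn2 exprD -[k.+1]addn1 exprD; ring.
rewrite le_eqVlt => /orP[/eqP ->|x0].
  rewrite /flat ltxx mulr0 subr0.
  apply: (@is_derive_quadratic _ (k.+2)`!%:R) => x1.
  by rewrite ger0_norm; [exact: flat_le|exact: flat_ge0].
have N : \near x, (fun=> 0) x = flat k x.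
  near=> y; rewrite /flat; case: ifPn => // y0; exfalso.
  suff : y < y by rewrite ltxx.
  by apply: lt_trans y0; near: y; exact: lt_nbhsl.
apply: (near_eq_is_derive N).
rewrite /flat; have -> : 0 < x = false by apply/negbTE; rewrite -leNgt ltW.
by rewrite mulr0 subr0; exact: is_derive_cst.
Unshelve. all: by end_near.
Qed.

Lemma Cn_flat n k : Cn n (flat k).
Proof.
elim: n k => [//|n IH] k; exists (fun x => flat k.+2 x + (- k%:R) * flat k.+1 x).
  by move=> x; rewrite mulNr; exact: flat_is_derive.
apply: CnD => //; apply: CnM => //; exact: Cn_cst.
Qed.

(** The denominator is positive everywhere since x and 1 - x are never both nonpositive. *)
Definition step x : R := flat 0 x / (flat 0 x + flat 0 (1 - x)).

Lemma flat0_gt0 x : 0 < x -> 0 < flat 0 x.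
Proof. by move=> x0; rewrite /flat x0 expr0 mul1r expR_gt0. Qed.

Lemma flat0_eq0 x : x <= 0 -> flat 0 x = 0.
Proof. by move=> x0; rewrite /flat ltNge x0. Qed.

Lemma Cn_step n : Cn n step.
Proof.
have e : (fun x => flat 0 (1 - x)) = (fun x => flat 0 (-1 * (x - 1))).
  by apply/funext => x; congr (flat 0 _); ring.
apply: CnM; first exact: Cn_flat.
apply: CnV => [x|]; last first.
  by apply: CnD; [exact: Cn_flat|rewrite e; apply: Cn_affine; exact: Cn_flat].
rewrite gt_eqF//; have [x0|x0] := ltP 0 x.
  by rewrite ltr_pwDl ?flat0_gt0 ?flat_ge0.
by rewrite ltr_wpDl ?flat_ge0// flat0_gt0//; lra.
Qed.

Lemma step0 x : x <= 0 -> step x = 0.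
Proof. by move=> x0; rewrite /step flat0_eq0// mul0r. Qed.

Lemma step1 x : 1 <= x -> step x = 1.
Proof.
move=> x1; rewrite /step (flat0_eq0 (x := 1 - x)); last by lra.
by rewrite addr0 mulfV// gt_eqF// flat0_gt0//; lra.
Qed.

(** [rho] serves as a mollifier: it lives on [0, 1], and its mass is the total increase 1 of the
    step. *)
Lemma step_derivative : exists rho C, [/\ forall x, is_derive x (1 : R) step (rho x),
  continuous rho, forall x, `|rho x| <= C & forall x, (x < 0) || (1 < x) -> rho x = 0].
Proof.
have [rho hr [rho' hr' _]] := Cn_step 2.
have rc : continuous rho.
  by move=> x; apply: differentiable_continuous; apply/derivable1_diffP; by case: (hr' x).
have z x : (x < 0) || (1 < x) -> rho x = 0.
  move=> /orP[x0|x1].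
    have N : \near x, (fun=> 0) x = step x.
      near=> y; rewrite step0// ltW//; near: y; exact: lt_nbhsl.
    have D : is_derive x (1 : R) step 0 by apply: (near_eq_is_derive N); exact: is_derive_cst.
    by case: D => _ <-; case: (hr x) => _ ->.
  have N : \near x, (fun=> 1) x = step x.
    near=> y; rewrite step1// ltW//; near: y; exact: lt_nbhsr.
  have D : is_derive x (1 : R) step 0 by apply: (near_eq_is_derive N); exact: is_derive_cst.
  by case: D => _ <-; case: (hr x) => _ ->.
have rn : {within `[0, 1 : R], continuous (fun x => `|rho x|)}.
  apply: continuous_subspaceT => x; apply: continuous_comp; first exact: rc.
  exact: norm_continuous.
have [c _ hc] := EVT_max ler01 rn.
exists rho, `|rho c|; split => // x.
have [x0|x0] := ltP x 0; first by rewrite z ?x0// normr0.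
have [x1|x1] := ltP 1 x; first by rewrite z ?x1 ?orbT// normr0.
by apply: hc; rewrite in_itv /= x0.
Unshelve. all: by end_near.
Qed.

End Smooth.

(** * Du Bois-Reymond lemma *)

Section LocalIntegrals.
Context {R : realType}.
Notation mu := (@lebesgue_measure R).
Implicit Types (g h k phi : R -> R) (a b c x : R).

Lemma Rintegral_itv_split g a b c : (forall a b, mu.-integrable `[a, b] (EFin \o g)) ->
  a <= b -> b <= c ->
  \int[mu]_(x in `[a, c]) g x = \int[mu]_(x in `[a, b]) g x + \int[mu]_(x in `[b, c]) g x.
Proof.
move=> ig ab bc; have := @Rintegral_itvB R g (BLeft a) (BRight c) b (ig a c).
rewrite !bnd_simp => /(_ ab bc); rewrite Rintegral_itv_obnd_cbnd.
  by move=> <-; ring.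
by apply: integrableS (ig b c) => //; apply: subset_itvr; rewrite bnd_simp.
Qed.

Lemma rprim_exists g : measurable_fun [set: R] g ->
  (forall a b, mu.-integrable `[a, b] (EFin \o g)) -> exists G, rprim G g.
Proof.
move=> mg ig.
exists (fun x => if 0 <= x then \int[mu]_(t in `[0, x]) g t else - \int[mu]_(t in `[x, 0]) g t).
split => // a b ab; case: ifPn => b0; case: ifPn => a0.
- by rewrite (Rintegral_itv_split ig a0 ab); ring.
- by rewrite opprK (@Rintegral_itv_split _ a 0 b)//; [ring|rewrite ltW// ltNge].
- by move: b0; rewrite (le_trans a0 ab).
- rewrite (@Rintegral_itv_split _ a b 0)//; [ring|by rewrite ltW// ltNge].
Qed.

Lemma integrable_mul_continuous g phi a b : (forall a b, mu.-integrable `[a, b] (EFin \o g)) ->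
  continuous phi -> mu.-integrable `[a, b] (EFin \o (fun x => g x * phi x)).
Proof.
move=> ig cphi; have [ab|ba] := leP a b; last by rewrite set_itv_ge ?bnd_simp -?ltNge//; exact: integrable_set0.
have np : {within `[a, b], continuous (fun x => `|phi x|)}.
  apply: continuous_subspaceT => x; apply: continuous_comp; first exact: cphi.
  exact: norm_continuous.
have [c _ hc] := EVT_max ab np.
apply: (@integrableMl _ _ _ mu _ _ (EFin \o g) phi) => //.
  by apply: measurable_funTS; exact: continuous_measurable_fun.
exists `|phi c|; split; first exact: num_real.
move=> M hM x; rewrite /= => xab; apply: ltW; apply: le_lt_trans hM; exact: hc.
Qed.

Lemma Rintegral_support g a b : (forall x, ~ (a <= x <= b) -> g x = 0) ->
  \int[mu]_x g x = \int[mu]_(x in `[a, b]) g x.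
Proof.
move=> g0; rewrite [RHS]Rintegral_mkcond; congr (Rintegral _ _ _); apply/funext => x.
rewrite patchE; case: ifPn => // /negP; rewrite inE /= in_itv /= => h.
by rewrite g0.
Qed.

End LocalIntegrals.

Section DuBoisReymond.
Context {R : realType}.
Notation mu := (@lebesgue_measure R).
Variables (h k : R -> R).
Hypotheses (mh : measurable_fun [set: R] h) (mk : measurable_fun [set: R] k)
  (ih : forall a b : R, mu.-integrable `[a, b] (EFin \o h))
  (ik : forall a b : R, mu.-integrable `[a, b] (EFin \o k)).
(** The equation h' = k in the sense of distributions, tested on real functions and written on an
    interval containing their support. *)
Hypothesis weak : forall (phi phi' : R -> R) (K : R), (forall n, Cn n phi) ->
  (forall x, is_derive x (1 : R) phi (phi' x)) -> continuous phi' ->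
  (forall x, ~ (- K <= x <= K) -> phi x = 0) -> (forall x, ~ (- K <= x <= K) -> phi' x = 0) ->
  \int[mu]_(x in `[- K, K]) (h x * phi' x) + \int[mu]_(x in `[- K, K]) (k x * phi x) = 0.

(* With G' = k, testing g = h - G against the difference of two steps of width 1 / c located at a
   and b compares averages of g near a and near b; let c tend to +oo at Lebesgue points. *)
Lemma du_bois_reymond : exists2 W, rprim W k & {ae mu, forall x, h x = W x}.
Proof.
have [G Gk] := rprim_exists mk ik.
have cG : continuous G by apply: rAC_continuous; exact: rprim_AC Gk.
pose g x := h x - G x.
have mg : measurable_fun [set: R] g.
  by apply: measurable_funB => //; exact: continuous_measurable_fun.
have iG a b : mu.-integrable `[a, b] (EFin \o G).
  by apply: continuous_compact_integrable; [exact: segment_compact|exact: continuous_subspaceT].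
have ig a b : mu.-integrable `[a, b] (EFin \o g).
  exact: (@integrableB _ _ R mu _ _ (EFin \o h) (EFin \o G)).
have [rho [C [hrho crho rhoC rho0]]] := @step_derivative R.
pose psi (c a x : R) := c * rho (c * (x - a)).
have cpsi (c a : R) : continuous (psi c a).
  move=> x; apply: cvgM; first exact: cvg_cst.
  apply: (@continuous_comp _ _ _ (fun x => c * (x - a)) rho); last exact: crho.
  apply: cvgM; first exact: cvg_cst.
  by apply: cvgB; [exact: cvg_id|exact: cvg_cst].
have dpsi c a x : is_derive x (1 : R) (fun x => step (c * (x - a))) (psi c a x).
  have hd : is_derive x (1 : R) (fun x => c * (x - a)) c.
    rewrite -[X in is_derive _ _ _ X](mulr1 c).
    apply: (@is_deriveZ _ _ _ (fun x => x - a)); rewrite -[X in is_derive _ _ _ X](subr0 1).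
    exact: is_deriveB.
  have := @is_derive1_comp _ step (fun x => c * (x - a)) x _ _ (hrho _) hd.
  by congr (is_derive _ _ _ _); rewrite /psi mulrC.
have psi0 (c a x : R) : 1 <= c -> ~ (a <= x <= a + 1 / c) -> psi c a x = 0.
  move=> c1 nx; rewrite /psi rho0 ?mulr0//.
  have c0 : 0 < c by lra.
  apply/orP; move/negP: nx; rewrite negb_and -!ltNge => /orP[xa|ax].
    by left; rewrite pmulr_rlt0// subr_lt0.
  by right; move: ax; rewrite -ltrBrDl ltr_pdivrMr// mulrC.
have C0 : 0 <= C by apply: le_trans (rhoC 0).
have psiC (c a x : R) : 1 <= c -> `|psi c a x| <= c * C.
  move=> c1; rewrite /psi normrM ger0_norm; last lra.
  by rewrite ler_wpM2l//; lra.
have ibnd (c : R) : 1 <= c -> 1 / c <= 1 by move=> c1; rewrite ler_pdivrMr; lra.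
(* The mollifier has mass 1, is bounded by c C, and lives in the ball of radius 2 / c, whose measure
   is 4 / c. Hence averaging [g] against it misses [g a] by at most 4 C times the mean deviation
   over the ball. *)
have mollify (c a K : R) : 1 <= c -> `|a| + 1 <= K ->
    (`|\int[mu]_(x in `[- K, K]) (g x * psi c a x) - g a|%:E <= (4 * C)%:E * davg g a (2 / c))%E.
  move=> c1 aK; have c0 : 0 < c by lra.
  have [aK1 aK2] : a <= K - 1 /\ - K + 1 <= a by move: aK; have := ler_norm a; have := ler_norm (- a); rewrite normrN; lra.
  have one : \int[mu]_(x in `[- K, K]) psi c a x = 1.
    have [_ _ <-] := rprim_C1 (cpsi c a) (dpsi c a); last by lra.
    rewrite step1; last first.
      have : 1 * (K - a) <= c * (K - a) by rewrite ler_wpM2r//; lra.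
      lra.
    rewrite step0 ?subr0//; rewrite pmulr_rle0//; lra.
  have ipsi : mu.-integrable `[- K, K] (EFin \o psi c a).
    by apply: continuous_compact_integrable; [exact: segment_compact|exact: continuous_subspaceT].
  have -> : g a = \int[mu]_(x in `[- K, K]) (g a * psi c a x) by rewrite RintegralZl// one mulr1.
  rewrite -RintegralB//; last 2 first.
  - exact: integrable_mul_continuous.
  - by have := integrable_scale (g a) (measurable_itv `[- K, K]) ipsi.
  have iD : mu.-integrable `[- K, K] (EFin \o (fun x => g x * psi c a x - g a * psi c a x)).
    apply: (@integrableB _ _ R mu _ _ (EFin \o (fun x => g x * psi c a x)) (EFin \o (fun x => g a * psi c a x))) => //.
      exact: integrable_mul_continuous.
    exact: integrable_scale.
  have mD : measurable_fun [set: R] (fun x => g x * psi c a x - g a * psi c a x).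
    have mp : measurable_fun [set: R] (psi c a) by exact: continuous_measurable_fun.
    by apply: measurable_funB; apply: measurable_funM.
  rewrite EFin_normr_Rintegral//.
  apply: (le_trans (le_abse_integral _ _ _)) => //; first by apply/measurable_EFinP; exact: measurable_funTS.
  have B4 : (mu (ball a (2 / c)))%E = (4 / c)%:E.
    by rewrite lebesgue_measure_ball ?divr_ge0 ?(ltW c0)//; congr _%:E; field; rewrite gt_eqF.
  apply: (@le_trans _ _ ((c * C)%:E * \int[mu]_(y in ball a (2 / c)) `|((center (g a) \o g) y)%:E|)%E); last first.
    rewrite /davg /iavg B4 inver gt_eqF ?divr_gt0// muleA -EFinM.
    by rewrite (_ : 4 * C * (4 / c)^-1 = c * C)//; field; rewrite gt_eqF.
  have mN : measurable_fun [set: R] (fun y => `|g y - g a|).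
    by apply: measurableT_comp => //; exact: measurable_funB.
  rewrite (_ : (\int[mu]_(y in ball a (2 / c)) `|((center (g a) \o g) y)%:E|)%E = (\int[mu]_(y in ball a (2 / c)) (`|g y - g a|)%:E)%E)//.
  rewrite -ge0_integralM//; last 3 first.
  - exact: measurable_ball.
  - exact: measurable_funTS.
  - by rewrite mulr_ge0// ltW.
  rewrite integral_mkcond [leRHS]integral_mkcond; apply: ge0_le_integral; first exact: measurableT.
  - by move=> x _; apply: erestrict_ge0 => y _; rewrite abse_ge0.
  - apply/(measurable_restrictT _ _).1 => //; apply/measurable_EFinP; apply: measurableT_comp => //.
    exact: measurable_funTS.
  - apply/(measurable_restrictT _ _).1; first exact: measurable_ball.
    by apply/measurable_EFinP; apply: measurable_funTS; apply: measurable_funM.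
  - move=> x _; rewrite !patchE.
    have nn : (0 <= (c * C * `|g x - g a|)%:E :> \bar R)%E by rewrite lee_fin !mulr_ge0// ltW.
    have [xb|nxb] := pselect (ball a (2 / c) x).
      rewrite (mem_set xb); case: ifPn => // _.
      by rewrite /= lee_fin -mulrBl normrM mulrC ler_wpM2r// psiC.
    rewrite (memNset nxb); case: ifPn => // _.
    rewrite /= psi0 ?mulr0 ?subrr ?normr0// => /andP[ax xa]; apply: nxb.
    rewrite /ball /= distrC ger0_norm ?subr_ge0//.
    have : 1 / c < 2 / c by rewrite ltr_pM2r ?invr_gt0//; lra.
    lra.
(* The difference of the two steps vanishes outside [-K, K], so the weak equation combined with
   integration by parts of [G] times this test function shows that both mollified averages of [g]
   coincide. *)
have equal (a b c : R) : 1 <= c -> (`|g a - g b|%:E <= (4 * C)%:E * (davg g a (2 / c) + davg g b (2 / c)))%E.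
  move=> c1; have c0 : 0 < c by lra.
  pose K := `|a| + `|b| + 1.
  pose phi x := step (c * (x - a)) - step (c * (x - b)).
  pose phi' x := psi c a x - psi c b x.
  have ha : `|a| + 1 <= K by rewrite /K; have := normr_ge0 b; lra.
  have hb : `|b| + 1 <= K by rewrite /K; have := normr_ge0 a; lra.
  have Cphi n : Cn n phi.
    apply: CnD; first by apply: Cn_affine; exact: Cn_step.
    have := @CnM _ n (fun=> -1) _ (Cn_cst _ _) (Cn_affine c b (Cn_step n)).
    by congr (Cn _ _); apply/funext => x; rewrite mulN1r.
  have dphi x : is_derive x (1 : R) phi (phi' x) by exact: is_deriveB.
  have cphi' : continuous phi' by move=> x; apply: cvgB; exact: cpsi.
  have cphi : continuous phi.
    by move=> x; apply: differentiable_continuous; apply/derivable1_diffP; case: (dphi x).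
  have st (d x : R) : `|d| + 1 <= K -> x <= - K -> step (c * (x - d)) = 0.
    move=> dK xK; rewrite step0// pmulr_rle0//; have := ler_norm (- d); rewrite normrN; lra.
  have st' (d x : R) : `|d| + 1 <= K -> K <= x -> step (c * (x - d)) = 1.
    move=> dK xK; rewrite step1//; have := ler_norm d => dn.
    have : 1 * (x - d) <= c * (x - d) by rewrite ler_wpM2r//; lra.
    lra.
  have phi0 x : ~ (- K <= x <= K) -> phi x = 0.
    move/negP; rewrite negb_and -!ltNge => /orP[] /ltW xK.
      by rewrite /phi (st a)// (st b)// subrr.
    by rewrite /phi (st' a)// (st' b)// subrr.
  have phi0' x : ~ (- K <= x <= K) -> phi' x = 0.
    move=> nx; rewrite /phi' !psi0 ?subrr//.
      move=> /andP[h1 h2]; apply: nx; apply/andP.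
      have := ibnd c c1; have := ler_norm b; have := ler_norm (- b); rewrite normrN; move: hb; lra.
    move=> /andP[h1 h2]; apply: nx; apply/andP.
    have := ibnd c c1; have := ler_norm a; have := ler_norm (- a); rewrite normrN; move: ha; lra.
  have w := weak Cphi dphi cphi' phi0 phi0'.
  have := rprimM Gk (rprim_C1 cphi' dphi) => -[_ _ /(_ (- K) K)].
  have K0 : - K <= K by rewrite /K; have := normr_ge0 a; have := normr_ge0 b; lra.
  move/(_ K0); rewrite {1}/phi (st' a K)// (st' b K)// subrr mulr0 {1}/phi (st a (- K))// (st b (- K))// subrr mulr0 subrr.
  rewrite RintegralD//; last 2 first.
  - exact: integrable_mul_continuous.
  - exact: integrable_mul_continuous.
  move=> w2.
  have E : \int[mu]_(x in `[- K, K]) (g x * psi c a x) = \int[mu]_(x in `[- K, K]) (g x * psi c b x).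
    apply/eqP; rewrite -subr_eq0; apply/eqP.
    rewrite -RintegralB//; last 2 first.
    - exact: integrable_mul_continuous.
    - exact: integrable_mul_continuous.
    transitivity (\int[mu]_(x in `[- K, K]) (h x * phi' x - G x * phi' x)).
      by apply: eq_Rintegral => x _; rewrite /phi' /g; ring.
    rewrite RintegralB//; last 2 first.
    - exact: integrable_mul_continuous.
    - exact: integrable_mul_continuous.
    move: w w2; lra.
  have m1 := mollify c a K c1 ha; have m2 := mollify c b K c1 hb.
  have d0 d : (0 <= davg g d (2 / c))%E.
    by rewrite /davg /iavg mule_ge0 ?inve_ge0// integral_ge0.
  rewrite ge0_muleDr//; apply: le_trans (leeD m1 m2).
  rewrite -EFinD lee_fin E.
  set I := \int[mu]_(x in _) _; rewrite (distrC I (g a)).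
  have -> : g a - g b = (g a - I) + (I - g b) by ring.
  exact: ler_normD.
have aeL : {ae mu, forall x, lebesgue_pt g x}.
  have [Gam Gg] := rprim_exists mg ig.
  exact: lebesgue_differentiation (rprim_locally Gg).
have eq a b : lebesgue_pt g a -> lebesgue_pt g b -> g a = g b.
  move=> /fine_cvgP[fa ca] /fine_cvgP[fb cb]; apply/eqP; rewrite -subr_eq0 -normr_eq0 eq_le normr_ge0 andbT.
  apply/ler_addgt0Pr => e e0; rewrite add0r.
  (* Makes 4 C (d + d) at most [e], also when C = 0. *)
  pose d := e / (8 * C + 1).
  have d0 : 0 < d by rewrite divr_gt0//; lra.
  move/cvgrPdist_lt : ca => /(_ _ d0) ca; move/cvgrPdist_lt : cb => /(_ _ d0) cb.
  have [r [r0 r2] [[fa' ca'] [fb' cb']]] : exists2 r, 0 < r /\ r <= 2 &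
      (davg g a r \is a fin_num /\ `|0 - fine (davg g a r)| < d) /\
      (davg g b r \is a fin_num /\ `|0 - fine (davg g b r)| < d).
    have : \forall r \near 0^'+, (0 < r /\ r <= 2) /\ ((davg g a r \is a fin_num /\ `|0 - fine (davg g a r)| < d) /\
      (davg g b r \is a fin_num /\ `|0 - fine (davg g b r)| < d)).
      near=> r; split; split.
      - by near: r; exact: nbhs_right_gt.
      - by near: r; exact: nbhs_right_le.
      - by split; near: r.
      - by split; near: r.
    by move=> /filter_ex[r []]; exists r.
  have c1 : 1 <= 2 / r by rewrite ler_pdivlMr//; lra.
  have := equal a b (2 / r) c1.
  have -> : 2 / (2 / r) = r by field; rewrite gt_eqF.
  rewrite -(fineK fa') -(fineK fb') -EFinD -EFinM lee_fin => /le_trans; apply.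
  have A1 : fine (davg g a r) < d by apply: le_lt_trans ca'; rewrite sub0r normrN ler_norm.
  have B1 : fine (davg g b r) < d by apply: le_lt_trans cb'; rewrite sub0r normrN ler_norm.
  have : 4 * C * (fine (davg g a r) + fine (davg g b r)) <= 4 * C * (d + d).
    by rewrite ler_wpM2l ?mulr_ge0//; lra.
  have : (8 * C + 1) * d = e by rewrite /d mulrC divfK// gt_eqF//; lra.
  lra.
(* Almost every point is a Lebesgue point and the line is not negligible; the value of [g] at one of
   them is the constant to add to [G]. *)
have [b Lb] : exists b, lebesgue_pt g b.
  apply: contrapT => nb.
  have : mu.-negligible [set: R].
    apply: negligibleS aeL => x _ /= Lx; apply: nb; by exists x.
  move=> [N [mN N0 sN]]; have := @lebesgue_measure_itv R `]-oo, +oo[.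
  rewrite /= set_itvNyy => muT.
  have : (mu [set: R] <= mu N)%E by apply: le_measure; rewrite ?inE.
  by rewrite N0 muT.
exists (fun x => G x + g b).
  have := rprimD Gk (rprim_cst (g b)); congr (rprim _ _); apply/funext => x; exact: addr0.
by apply: ae_imply aeL => x Lx; rewrite -(eq x b Lx Lb) /g; ring.
Unshelve. all: by end_near.
Qed.

End DuBoisReymond.

(** * Independence of the representation *)

Section LocallyIntegrable.
Context {R : realType}.
Notation mu := (@lebesgue_measure R).
Implicit Types (f g psi : R -> R[i]) (N K : R).

(** Common ground of the L^2_unif coefficient [Q] and the L^1_unif coefficient [tau]: all that the
    pairing with test functions uses. *)
Definition cloc f := cmeasurable f /\ forall a b : R, (\int[mu]_(x in `[a, b]) (n1 (f x))%:E < +oo)%E.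

Lemma ub1D f g N M : cmeasurable f -> cmeasurable g -> ub1 f N -> ub1 g M -> ub1 (fun x => f x + g x) (N + M).
Proof.
move=> mf mg hf hg t; rewrite EFinD; apply: le_trans (leeD (hf t) (hg t)).
have mnf := measurable_n1 mf; have mng := measurable_n1 mg.
rewrite -ge0_integralD//; last 4 first.
- by move=> x _; rewrite lee_fin n1_ge0.
- by apply/measurable_EFinP; exact: measurable_funTS.
- by move=> x _; rewrite lee_fin n1_ge0.
- by apply/measurable_EFinP; exact: measurable_funTS.
apply: ge0_le_integral => //.
- by move=> x _; rewrite lee_fin n1_ge0.
- by apply/measurable_EFinP; apply: measurable_funTS; apply: measurable_n1; exact: cmeasurableD.
- by apply: emeasurable_funD; apply/measurable_EFinP; exact: measurable_funTS.
- by move=> x _; rewrite -EFinD lee_fin n1D.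
Qed.

Lemma ub2D f g N M : cmeasurable f -> cmeasurable g -> ub2 f N -> ub2 g M ->
  ub2 (fun x => f x + g x) (2 * N + 2 * M).
Proof.
move=> mf mg hf hg t.
have mnf : measurable_fun [set: R] (fun x => n1 (f x) ^+ 2) by apply: measurable_funX; exact: measurable_n1.
have mng : measurable_fun [set: R] (fun x => n1 (g x) ^+ 2) by apply: measurable_funX; exact: measurable_n1.
apply: (@le_trans _ _ (\int[mu]_(x in `[t, (t + 1)%R]) ((2 * n1 (f x) ^+ 2)%:E + (2 * n1 (g x) ^+ 2)%:E))%E).
  apply: ge0_le_integral => //.
  - by move=> x _; rewrite lee_fin sqr_ge0.
  - apply/measurable_EFinP; apply: measurable_funTS; apply: measurable_funX; apply: measurable_n1; exact: cmeasurableD.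
  - by apply: emeasurable_funD; apply/measurable_EFinP; apply: measurable_funTS; exact: measurable_funM.
  - move=> x _; rewrite -EFinD lee_fin; apply: le_trans (sqrD_le2 _ _).
    by rewrite lerXn2r ?nnegrE ?addr_ge0 ?n1_ge0// n1D.
rewrite ge0_integralD//; last 4 first.
- by move=> x _; rewrite lee_fin mulr_ge0 ?sqr_ge0.
- by apply/measurable_EFinP; apply: measurable_funTS; exact: measurable_funM.
- by move=> x _; rewrite lee_fin mulr_ge0 ?sqr_ge0.
- by apply/measurable_EFinP; apply: measurable_funTS; exact: measurable_funM.
rewrite !ge0_integralM//; try by move=> x; exact: sqr_ge0.
- apply: (@le_trans _ _ (2%:E * N%:E + 2%:E * M%:E)%E); first by apply: leeD; apply: lee_wpmul2l.
  by rewrite -!EFinM -EFinD.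
- exact: measurable_funTS.
- exact: measurable_funTS.
Qed.

Lemma ub1N f N : ub1 f N -> ub1 (fun x => - f x) N.
Proof. by move=> h t; under eq_integral do rewrite n1N. Qed.

Lemma ub2N f N : ub2 f N -> ub2 (fun x => - f x) N.
Proof. by move=> h t; under eq_integral do rewrite n1N. Qed.

Lemma Lunif_meas (p : R) f : Lunif p f -> cmeasurable f.
Proof. by move=> [[]]. Qed.

Lemma Lunif1D f g : Lunif 1 f -> Lunif 1 g -> Lunif 1 (fun x => f x + g x).
Proof.
move=> Lf Lg; have [N _ hN] := Lunif1P Lf; have [M _ hM] := Lunif1P Lg.
have mf := Lunif_meas Lf; have mg := Lunif_meas Lg.
by apply: (@ub1_Lunif _ _ (N + M)); [exact: cmeasurableD|exact: ub1D].
Qed.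

Lemma Lunif2D f g : Lunif 2 f -> Lunif 2 g -> Lunif 2 (fun x => f x + g x).
Proof.
move=> Lf Lg; have [N _ hN] := Lunif2P Lf; have [M _ hM] := Lunif2P Lg.
have mf := Lunif_meas Lf; have mg := Lunif_meas Lg.
by apply: (@ub2_Lunif _ _ (2 * N + 2 * M)); [exact: cmeasurableD|exact: ub2D].
Qed.

Lemma Lunif1N f : Lunif 1 f -> Lunif 1 (fun x => - f x).
Proof.
move=> Lf; have [N _ hN] := Lunif1P Lf; have mf := Lunif_meas Lf.
by apply: (@ub1_Lunif _ _ N); [exact: cmeasurableN|exact: ub1N].
Qed.

Lemma Lunif2N f : Lunif 2 f -> Lunif 2 (fun x => - f x).
Proof.
move=> Lf; have [N _ hN] := Lunif2P Lf; have mf := Lunif_meas Lf.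
by apply: (@ub2_Lunif _ _ N); [exact: cmeasurableN|exact: ub2N].
Qed.

Lemma Lunif1_cloc f : Lunif 1 f -> cloc f.
Proof.
move=> Lf; have mf := Lunif_meas Lf; have [N _ hN] := Lunif1P Lf; split => // a b.
by apply: (local_of_ub _ _ (measurable_n1 mf) _ hN) => s; exact: n1_ge0.
Qed.

Lemma Lunif2_cloc f : Lunif 2 f -> cloc f.
Proof.
move=> Lf; have mf := Lunif_meas Lf; have [N _ hN] := Lunif2P Lf; split => // a b.
have mn := measurable_n1 mf.
have mn2 : measurable_fun [set: R] (fun s => n1 (f s) ^+ 2) by exact: measurable_funX.
apply: (@le_lt_trans _ _ (\int[mu]_(x in `[a, b]) (1 + (n1 (f x) ^+ 2)%:E))%E).
  apply: ge0_le_integral => //.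
  - by move=> x _; rewrite lee_fin n1_ge0.
  - by apply/measurable_EFinP; exact: measurable_funTS.
  - by apply: emeasurable_funD => //; apply/measurable_EFinP; exact: measurable_funTS.
  - move=> x _; rewrite -EFinD lee_fin; have := sqr_ge0 (n1 (f x) - 1); rewrite sqrrB expr1n mulr1.
    have := n1_ge0 (f x); lra.
rewrite ge0_integralD//; last 2 first.
- by move=> x _; rewrite lee_fin sqr_ge0.
- by apply/measurable_EFinP; exact: measurable_funTS.
rewrite lte_add_pinfty//.
  by rewrite integral_cst//= mul1e lebesgue_measure_itv /=; case: ifP => _; rewrite ?ltry// -EFinB ltry.
by apply: (local_of_ub _ _ mn2 _ hN) => s; exact: sqr_ge0.
Qed.

Lemma re_n1 (z : R[i]) : `|complex.Re z| <= n1 z.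
Proof. by rewrite /n1 lerDl. Qed.

Lemma im_n1 (z : R[i]) : `|complex.Im z| <= n1 z.
Proof. by rewrite /n1 lerDr. Qed.

Lemma cloc_proj (pr : R[i] -> R) f a b : (forall z, `|pr z| <= n1 z) ->
  measurable_fun [set: R] (fun x => pr (f x)) -> cloc f ->
  mu.-integrable `[a, b] (EFin \o (fun x => pr (f x))).
Proof.
move=> hpr mp [mf lf]; apply/integrableP; split.
  by apply/measurable_EFinP; exact: measurable_funTS.
apply: le_lt_trans (lf a b); apply: ge0_le_integral => //.
- by apply/measurable_EFinP; apply: measurableT_comp => //; exact: measurable_funTS.
- by apply/measurable_EFinP; apply: measurable_funTS; exact: measurable_n1.
- by move=> x _; rewrite /= lee_fin.
Qed.

Lemma cloc_mul_integrable f psi (K M : R) : cloc f -> cmeasurable psi -> (forall x, n1 (psi x) <= M) ->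
  (forall x, K < `|x| -> psi x = 0) ->
  mu.-integrable [set: R] (EFin \o re (fun x => f x * psi x)) /\
  mu.-integrable [set: R] (EFin \o im (fun x => f x * psi x)).
Proof.
move=> [mf lf] mpsi hM hK.
have [m1 m2] := cmeasurableM mf mpsi.
have M0 : 0 <= M by apply: le_trans (hM 0); exact: n1_ge0.
have fin : (\int[mu]_x (n1 (f x * psi x))%:E < +oo)%E.
  apply: (@le_lt_trans _ _ (\int[mu]_(x in `[(- K)%R, K]) (M * n1 (f x))%:E)%E).
    rewrite [leRHS]integral_mkcond; apply: ge0_le_integral; first exact: measurableT.
    - by move=> x _; rewrite lee_fin n1_ge0.
    - by apply/measurable_EFinP; apply: measurable_n1; exact: cmeasurableM.
    - apply/(measurable_restrictT _ _).1 => //; apply/measurable_EFinP; apply: measurable_funTS.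
      by apply: measurable_funM => //; exact: measurable_n1.
    - move=> x _; rewrite patchE; case: ifPn => [_|].
        by rewrite lee_fin (le_trans (n1M _ _))// mulrC ler_wpM2r// n1_ge0.
      move/negP; rewrite inE /= in_itv /= -ler_norml => /negP; rewrite -ltNge => h.
      by rewrite hK// mulr0 n10.
  rewrite ge0_integralM//; last 2 first.
  - by apply: measurable_funTS; exact: measurable_n1.
  - by move=> s; exact: n1_ge0.
  by rewrite lte_mul_pinfty// lf.
split; apply/integrableP; (split; first exact/measurable_EFinP);
  apply: le_lt_trans fin; apply: ge0_le_integral => //.
- by apply/measurable_EFinP; exact: measurableT_comp.
- by apply/measurable_EFinP; apply: measurable_n1; exact: cmeasurableM.
- by move=> x _; rewrite /= lee_fin; exact: re_n1.
- by apply/measurable_EFinP; exact: measurableT_comp.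
- by apply/measurable_EFinP; apply: measurable_n1; exact: cmeasurableM.
- by move=> x _; rewrite /= lee_fin; exact: im_n1.
Qed.

End LocallyIntegrable.

Section Representations.
Context {R : realType}.
Notation mu := (@lebesgue_measure R).
Implicit Types (Q tau : R -> R[i]) (q : (R -> R[i]) -> R[i]).

Lemma bounded_support (psi : R -> R) K : continuous psi -> (forall x, K < `|x| -> psi x = 0) ->
  exists M, forall x, `|psi x| <= M.
Proof.
move=> cpsi hK.
have np : {within `[- `|K|, `|K|], continuous (fun x => `|psi x|)}.
  apply: continuous_subspaceT => x; apply: continuous_comp; first exact: cpsi.
  exact: norm_continuous.
have [|c _ hc] := EVT_max _ np; first by have := normr_ge0 K; lra.
exists `|psi c| => x; have [h|h] := leP `|x| `|K|; last first.
  by rewrite hK ?normr0//; apply: le_lt_trans h; exact: ler_norm.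
by apply: hc; rewrite in_itv /= -ler_norml.
Qed.

Lemma derive1_support (psi : R -> R) K : (forall x, derivable psi x 1) ->
  (forall x, K < `|x| -> psi x = 0) -> forall x, K < `|x| -> derive1 psi x = 0.
Proof.
move=> dpsi hK x Kx; rewrite derive1E.
have N : \near x, (fun=> 0) x = psi x.
  near=> y; rewrite hK//; near: y.
  by apply: (@cvgr_gt _ _ _ _ (fun y => `|y|) `|x|) => //; exact: norm_continuous.
have D : is_derive x (1 : R) psi 0 by apply: (near_eq_is_derive N); exact: is_derive_cst.
by case: D.
Unshelve. all: by end_near.
Qed.

Lemma derivable_continuous (psi : R -> R) : (forall x, derivable psi x 1) -> continuous psi.
Proof. by move=> d x; apply: differentiable_continuous; apply/derivable1_diffP; exact: d. Qed.

Lemma test_bounds (phi : R -> R[i]) : test_function phi -> exists K M,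
  [/\ cmeasurable phi, cmeasurable (cderive phi),
      forall x, n1 (phi x) <= M, forall x, n1 (cderive phi x) <= M &
      (forall x, K < `|x| -> phi x = 0) /\ (forall x, K < `|x| -> cderive phi x = 0)].
Proof.
move=> [dphi [K hK]].
have d0 x : derivable (re phi) x 1 by have [h _] := dphi 0%N x; rewrite derive1n0 in h.
have d1 x : derivable (im phi) x 1 by have [_ h] := dphi 0%N x; rewrite derive1n0 in h.
have d2 x : derivable (derive1 (re phi)) x 1 by have [h _] := dphi 1%N x; rewrite derive1n1 in h.
have d3 x : derivable (derive1 (im phi)) x 1 by have [_ h] := dphi 1%N x; rewrite derive1n1 in h.
have c0 := derivable_continuous d0; have c1 := derivable_continuous d1.
have c2 := derivable_continuous d2; have c3 := derivable_continuous d3.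
have s0 x : K < `|x| -> re phi x = 0 by move=> /hK; rewrite /re => ->.
have s1 x : K < `|x| -> im phi x = 0 by move=> /hK; rewrite /im => ->.
have s2 := derive1_support d0 s0; have s3 := derive1_support d1 s1.
have [M0 h0] := bounded_support c0 s0; have [M1 h1] := bounded_support c1 s1.
have [M2 h2] := bounded_support c2 s2; have [M3 h3] := bounded_support c3 s3.
exists K, (Num.max (M0 + M1) (M2 + M3)); split.
- by split; exact: continuous_measurable_fun.
- by split; exact: continuous_measurable_fun.
- by move=> x; rewrite le_max; apply/orP; left; exact: (lerD (h0 x) (h1 x)).
- by move=> x; rewrite le_max; apply/orP; right; exact: (lerD (h2 x) (h3 x)).
- split => // x Kx; rewrite /cderive /cderiven.
  by rewrite !derive1n1 s2// s3.
Qed.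

Lemma cintegralD (f g : R -> R[i]) :
  mu.-integrable [set: R] (EFin \o re f) /\ mu.-integrable [set: R] (EFin \o im f) ->
  mu.-integrable [set: R] (EFin \o re g) /\ mu.-integrable [set: R] (EFin \o im g) ->
  cintegral (fun x => f x + g x) = cintegral f + cintegral g.
Proof.
move=> [f1 f2] [g1 g2]; rewrite /cintegral.
have := RintegralD measurableT f1 g1; have := RintegralD measurableT f2 g2.
rewrite (_ : (fun x => re f x + re g x) = re (fun x => f x + g x)); last first.
  by apply/funext => x; rewrite /re; case: (f x); case: (g x).
rewrite (_ : (fun x => im f x + im g x) = im (fun x => f x + g x)); last first.
  by apply/funext => x; rewrite /im; case: (f x); case: (g x).
by move=> -> ->.
Qed.

Lemma cintegralN (f : R -> R[i]) :
  mu.-integrable [set: R] (EFin \o re f) /\ mu.-integrable [set: R] (EFin \o im f) ->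
  cintegral (fun x => - f x) = - cintegral f.
Proof.
move=> [f1 f2]; rewrite /cintegral.
have := RintegralZl (-1) measurableT f1; have := RintegralZl (-1) measurableT f2.
rewrite (_ : (fun x => -1 * re f x) = re (fun x => - f x)); last first.
  by apply/funext => x; rewrite /re; case: (f x) => a b /=; rewrite mulN1r.
rewrite (_ : (fun x => -1 * im f x) = im (fun x => - f x)); last first.
  by apply/funext => x; rewrite /im; case: (f x) => a b /=; rewrite mulN1r.
by move=> -> ->; rewrite !mulN1r.
Qed.

Lemma represents_add q q' Q tau Q' tau' : cloc Q -> cloc tau -> cloc Q' -> cloc tau' ->
  represents q Q tau -> represents q' Q' tau' ->
  represents (fun phi => q phi + q' phi) (fun x => Q x + Q' x) (fun x => tau x + tau' x).
Proof.
move=> lQ lt lQ' lt' h h' phi tphi; rewrite h// h'//.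
have [K [M [m0 m1 b0 b1 [s0 s1]]]] := test_bounds tphi.
under [in X in _ = - X + _]eq_fun do rewrite mulrDl.
under [in X in _ = _ + X]eq_fun do rewrite mulrDl.
rewrite !cintegralD; first ring.
- exact: cloc_mul_integrable lt m0 b0 s0.
- exact: cloc_mul_integrable lt' m0 b0 s0.
- exact: cloc_mul_integrable lQ m1 b1 s1.
- exact: cloc_mul_integrable lQ' m1 b1 s1.
Qed.

Lemma represents_opp q Q tau : cloc Q -> cloc tau -> represents q Q tau ->
  represents (fun phi => - q phi) (fun x => - Q x) (fun x => - tau x).
Proof.
move=> lQ lt h phi tphi; rewrite h//.
have [K [M [m0 m1 b0 b1 [s0 s1]]]] := test_bounds tphi.
under [in X in _ = - X + _]eq_fun do rewrite mulNr.
under [in X in _ = _ + X]eq_fun do rewrite mulNr.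
rewrite !cintegralN; first ring.
- exact: cloc_mul_integrable lt m0 b0 s0.
- exact: cloc_mul_integrable lQ m1 b1 s1.
Qed.

Lemma Hm1_rep_add q q' Q tau Q' tau' : Hm1_rep q Q tau -> Hm1_rep q' Q' tau' ->
  Hm1_rep (fun phi => q phi + q' phi) (fun x => Q x + Q' x) (fun x => tau x + tau' x).
Proof.
move=> [LQ Lt r] [LQ' Lt' r']; split; [exact: Lunif2D|exact: Lunif1D|].
by apply: represents_add => //; [exact: Lunif2_cloc|exact: Lunif1_cloc|exact: Lunif2_cloc|exact: Lunif1_cloc].
Qed.

Lemma Hm1_rep_opp q Q tau : Hm1_rep q Q tau ->
  Hm1_rep (fun phi => - q phi) (fun x => - Q x) (fun x => - tau x).
Proof.
move=> [LQ Lt r]; split; [exact: Lunif2N|exact: Lunif1N|].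
by apply: represents_opp => //; [exact: Lunif2_cloc|exact: Lunif1_cloc].
Qed.

Lemma Hm1_rep_sub q q' Q tau Q' tau' : Hm1_rep q Q tau -> Hm1_rep q' Q' tau' ->
  Hm1_rep (fun phi => q phi - q' phi) (fun x => Q x - Q' x) (fun x => tau x - tau' x).
Proof. by move=> r /Hm1_rep_opp r'; exact: Hm1_rep_add. Qed.

(* [pr] stands for the real and the imaginary part. *)
Lemma represents_proj (pr : R[i] -> R) q Q1 tau1 Q2 tau2 :
  (forall z, `|pr z| <= n1 z) -> (forall f, cmeasurable f -> measurable_fun [set: R] (fun x => pr (f x))) ->
  (forall z (t : R), pr (z * Complex t 0) = pr z * t) ->
  (forall z w, pr (z - w) = pr z - pr w) -> (forall z w, pr (- z + w) = - pr z + pr w) ->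
  (forall f, pr (cintegral f) = \int[mu]_x pr (f x)) ->
  cloc Q1 -> cloc tau1 -> cloc Q2 -> cloc tau2 -> represents q Q1 tau1 -> represents q Q2 tau2 ->
  exists2 W, rprim W (fun x => pr (tau1 x - tau2 x)) & {ae mu, forall x, pr (Q2 x - Q1 x) = W x}.
Proof.
move=> pr1 prm prM prB prND prI lQ1 lt1 lQ2 lt2 r1 r2.
have [mQ1 _] := lQ1; have [mQ2 _] := lQ2; have [mt1 _] := lt1; have [mt2 _] := lt2.
have iQ1 a b := cloc_proj a b pr1 (prm _ mQ1) lQ1.
have iQ2 a b := cloc_proj a b pr1 (prm _ mQ2) lQ2.
have it1 a b := cloc_proj a b pr1 (prm _ mt1) lt1.
have it2 a b := cloc_proj a b pr1 (prm _ mt2) lt2.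
have eQ : (fun x => pr (Q2 x - Q1 x)) = (fun x => pr (Q2 x) - pr (Q1 x)) by apply/funext => x.
have et : (fun x => pr (tau1 x - tau2 x)) = (fun x => pr (tau1 x) - pr (tau2 x)) by apply/funext => x.
apply: du_bois_reymond.
- by apply: prm; exact: cmeasurableB.
- by apply: prm; exact: cmeasurableB.
- move=> a b; rewrite eQ.
  exact: (@integrableB _ _ R mu _ _ (EFin \o (fun x => pr (Q2 x))) (EFin \o (fun x => pr (Q1 x)))).
- move=> a b; rewrite et.
  exact: (@integrableB _ _ R mu _ _ (EFin \o (fun x => pr (tau1 x))) (EFin \o (fun x => pr (tau2 x)))).
move=> phi phi' K Cphi dphi cphi' s0 s1.
have cphi : continuous phi by apply: derivable_continuous => x; case: (dphi x).
(* Real-valued test functions suffice, because taking the real or imaginary part commutes with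
   multiplication by a real number. *)
pose Phi (x : R) : R[i] := Complex (phi x) 0.
have tPhi : test_function Phi.
  split; last first.
    exists K => x Kx; rewrite /Phi s0// -ler_norml; apply/negP; by rewrite -ltNge.
  have e1 : re Phi = phi by []. have e2 : im Phi = (fun=> 0) by [].
  by rewrite e1 e2 => n x; split; apply: Cn_derivable; [exact: Cphi|exact: Cn_cst].
have ePhi : cderive Phi = (fun x => Complex (phi' x) 0).
  apply/funext => x; rewrite /cderive /cderiven /derive1n /=; congr Complex.
    by rewrite derive1E; case: (dphi x).
  by rewrite derive1_cst.
have := r1 _ tPhi; rewrite (r2 _ tPhi) => /(congr1 pr); rewrite !prND !prI ePhi.
have sup (f : R -> R) (g : R -> R) : (forall x, ~ (- K <= x <= K) -> g x = 0) ->
    \int[mu]_x (f x * g x) = \int[mu]_(x in `[- K, K]) (f x * g x).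
  by move=> hg; apply: Rintegral_support => x nx; rewrite hg// mulr0.
have con (f : R -> R[i]) (g : R -> R) : (forall x, ~ (- K <= x <= K) -> g x = 0) ->
    \int[mu]_x pr (f x * Complex (g x) 0) = \int[mu]_(x in `[- K, K]) (pr (f x) * g x).
  by move=> hg; under eq_Rintegral do rewrite prM; exact: sup.
rewrite !con//.
under [in X in _ -> X + _ = _]eq_Rintegral do rewrite prB mulrBl.
under [in X in _ -> _ + X = _]eq_Rintegral do rewrite prB mulrBl.
rewrite !RintegralB//; try exact: integrable_mul_continuous.
lra.
Qed.

Lemma represents_unique q Q1 tau1 Q2 tau2 :
  cloc Q1 -> cloc tau1 -> cloc Q2 -> cloc tau2 -> represents q Q1 tau1 -> represents q Q2 tau2 ->
  exists2 W, cprim W (fun x => tau1 x - tau2 x) & {ae mu, forall x, Q2 x - Q1 x = W x}.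
Proof.
move=> lQ1 lt1 lQ2 lt2 r1 r2.
have [|||||W1 P1 E1] := @represents_proj (@complex.Re R) q Q1 tau1 Q2 tau2 (@re_n1 R) _ _ _ _ _ lQ1 lt1 lQ2 lt2 r1 r2.
- by move=> f [].
- by move=> [a b] t /=; rewrite mulr0 subr0.
- by move=> [a b] [c d].
- by move=> [a b] [c d].
- by [].
have [|||||W2 P2 E2] := @represents_proj (@complex.Im R) q Q1 tau1 Q2 tau2 (@im_n1 R) _ _ _ _ _ lQ1 lt1 lQ2 lt2 r1 r2.
- by move=> f [].
- by move=> [a b] t /=; rewrite mulr0 add0r.
- by move=> [a b] [c d].
- by move=> [a b] [c d].
- by [].
exists (fun x => Complex (W1 x) (W2 x)); first by split.
by apply: ae_imply2 E1 E2 => x; case: (Q2 x - Q1 x) => a b /= -> ->.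
Qed.

(* The quasi-derivatives are related by u2 = u1 - W y. *)
Lemma S_graph_rep q Q1 tau1 Q2 tau2 y f : Hm1_rep q Q1 tau1 -> Hm1_rep q Q2 tau2 ->
  S_graph Q1 tau1 y f -> S_graph Q2 tau2 y f.
Proof.
move=> [LQ1 Lt1 r1] [LQ2 Lt2 r2].
have mQ1 := Lunif_meas LQ1; have mt1 := Lunif_meas Lt1.
have mQ2 := Lunif_meas LQ2; have mt2 := Lunif_meas Lt2.
have [W PW EW] := represents_unique (Lunif2_cloc LQ1) (Lunif1_cloc Lt1) (Lunif2_cloc LQ2) (Lunif1_cloc Lt2) r1 r2.
have mW := cprim_measurable PW.
move=> /(S_graphP _ _ mQ1 mt1)[Ly Lf [y0 [u [yy0 P0 P1]]]].
have [my _] := Ly; have [mf _] := Lf.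
have m0 := cprim_measurable P0; have mu0 := cprim_measurable P1.
apply/S_graphP => //; split => //; exists y0, (fun x => u x + (-1) * (W x * y0 x)).
have mu2 : cmeasurable (fun x => u x + (-1) * (W x * y0 x)).
  by apply: cmeasurableD => //; apply: cmeasurableM; [exact: cmeasurable_cst|exact: cmeasurableM].
have e x : Q2 x - Q1 x = W x -> Q2 x = Q1 x + W x by move=> <-; ring.
split => //.
  apply: (cprim_ae P0); first by apply: cmeasurableD => //; exact: cmeasurableM.
  by apply: ae_imply EW => x /e ->; ring.
apply: (cprim_ae (cprimD P1 (cprimZ (-1) (cprimM PW P0)))).
  apply: cmeasurableB => //; apply: cmeasurableB; first exact: cmeasurableM.
  by apply: cmeasurableM => //; apply: cmeasurableD => //; exact: cmeasurableM.
by apply: ae_imply EW => x /e ->; ring.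
Qed.

Lemma schrodingerE q Q tau : Hm1_rep q Q tau -> schrodinger q = S_graph Q tau.
Proof.
move=> r; apply/funext => y; apply/funext => f; apply/propext; split.
  by move=> [Q' [tau' [r' h]]]; exact: S_graph_rep r' r h.
by move=> h; exists Q, tau.
Qed.

End Representations.

(** * Convergence in H^{-1}_unif *)

Section EConvergence.
Context {R : realType}.

Lemma cvge0_le (u : nat -> \bar R) : (forall n, 0 <= u n)%E ->
  (forall e : R, 0 < e -> \forall n \near \oo, (u n <= e%:E)%E) -> u n @[n --> \oo] --> 0%E.
Proof.
move=> u0 h; apply/fine_cvgP; split.
  near=> n; rewrite ge0_fin_numE//; apply: (@le_lt_trans _ _ 1%:E); last by rewrite ltry.
  by near: n; exact: h.
apply/cvgrPdist_le => e e0; near=> n; rewrite sub0r normrN.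
have hn : (u n <= e%:E)%E by near: n; exact: h.
have fn : u n \is a fin_num by rewrite ge0_fin_numE//; apply: (le_lt_trans hn); rewrite ltry.
by rewrite ger0_norm ?fine_ge0// -lee_fin fineK.
Unshelve. all: by end_near.
Qed.

Lemma cvge0_near (u : nat -> \bar R) (e : R) : (forall n, 0 <= u n)%E -> u n @[n --> \oo] --> 0%E ->
  0 < e -> \forall n \near \oo, (u n <= e%:E)%E.
Proof.
move=> u0 /fine_cvgP[fu /cvgrPdist_le hu] e0; near=> n.
have fn : u n \is a fin_num by near: n.
rewrite -(fineK fn) lee_fin; have : `|0 - fine (u n)| <= e by near: n; exact: hu.
by rewrite sub0r normrN; apply: le_trans; exact: ler_norm.
Unshelve. all: by end_near.
Qed.

End EConvergence.

Section NormEquivalence.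
Context {R : realType}.
Implicit Types (q : (R -> R[i]) -> R[i]) (Q tau : R -> R[i]).

Lemma Lunif_norm_ge0 (p : R) (f : R -> R[i]) : (0 <= Lunif_norm p f)%E.
Proof. exact: poweR_ge0. Qed.

Lemma Hm1_norm_ge0 q : (0 <= Hm1_norm q)%E.
Proof.
by apply: le_ereal_inf_tmp => _ [Q [tau [_ ->]]]; rewrite adde_ge0// Lunif_norm_ge0.
Qed.

Lemma Hm1_norm_le q Q tau : Hm1_rep q Q tau ->
  (Hm1_norm q <= Lunif_norm 2 Q + Lunif_norm 1 tau)%E.
Proof. by move=> r; apply: ereal_inf_lbound; exists Q, tau. Qed.

Lemma Hm1_norm_approx q (e : R) : (exists Q tau, Hm1_rep q Q tau) -> 0 < e ->
  exists Q tau, Hm1_rep q Q tau /\ (Lunif_norm 2 Q + Lunif_norm 1 tau <= Hm1_norm q + e%:E)%E.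
Proof.
move=> [Q0 [tau0 r0]] e0.
have fin : Hm1_norm q \is a fin_num.
  rewrite ge0_fin_numE ?Hm1_norm_ge0//; apply: (le_lt_trans (Hm1_norm_le r0)).
  by case: r0 => [[_ h1] [_ h2] _]; rewrite lte_add_pinfty.
have [_ [Q [tau [r ->]]] h] := lb_ereal_inf_adherent e0 fin.
by exists Q, tau; split => //; exact: ltW.
Qed.

(** In one direction, choose a representation of q_n - q within 1/(n+1) of the infimum and add it to
    one fixed representation of q. In the other, the difference of given representations is a
    competitor in the infimum. *)
Lemma Hm1_convergenceP q (q_ : nat -> (R -> R[i]) -> R[i]) :
  (exists Q tau, Hm1_rep q Q tau) -> (forall n, exists Q tau, Hm1_rep (q_ n) Q tau) ->
  Hm1_norm (fun phi => q_ n phi - q phi) @[n --> \oo] --> 0%E <->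
  exists (Q tau : R -> R[i]) (Q_ tau_ : nat -> R -> R[i]),
     [/\ Hm1_rep q Q tau,
         forall n : nat, Hm1_rep (q_ n) (Q_ n) (tau_ n),
         Lunif_norm 2 (fun x => Q_ n x - Q x) @[n --> \oo] --> 0%E &
         Lunif_norm 1 (fun x => tau_ n x - tau x) @[n --> \oo] --> 0%E].
Proof.
move=> [Q [tau r]] r_; split; last first.
  move=> [P [sigma [P_ [sigma_ [rP rP_ c2 c1]]]]]; apply: cvge0_le => [n|e e0]; first exact: Hm1_norm_ge0.
  have e20 : 0 < e / 2 by rewrite divr_gt0.
  have h2 := cvge0_near (fun n => Lunif_norm_ge0 2 _) c2 e20.
  have h1 := cvge0_near (fun n => Lunif_norm_ge0 1 _) c1 e20.
  near=> n; apply: (le_trans (Hm1_norm_le (Hm1_rep_sub (rP_ n) rP))).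
  have -> : e%:E = ((e / 2)%:E + (e / 2)%:E)%E :> \bar R by rewrite -EFinD -splitr.
  by apply: leeD; near: n.
move=> cv.
have /choice[D hD] : forall n, exists Dd : (R -> R[i]) * (R -> R[i]),
    Hm1_rep (fun phi => q_ n phi - q phi) Dd.1 Dd.2 /\
    (Lunif_norm 2 Dd.1 + Lunif_norm 1 Dd.2 <= Hm1_norm (fun phi => q_ n phi - q phi)%R + (n.+1%:R^-1)%:E)%E.
  move=> n; have [Qn [tn rn]] := r_ n.
  have ex : exists Q tau, Hm1_rep (fun phi => q_ n phi - q phi) Q tau.
    by exists (fun x => Qn x - Q x), (fun x => tn x - tau x); exact: Hm1_rep_sub.
  have n0 : 0 < n.+1%:R^-1 :> R by rewrite invr_gt0.
  by have [D [d h]] := Hm1_norm_approx ex n0; exists (D, d).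
have cvD (e : R) : 0 < e -> \forall n \near \oo,
    (Lunif_norm 2 (D n).1 + Lunif_norm 1 (D n).2 <= e%:E)%E.
  move=> e0; have e20 : 0 < e / 2 by rewrite divr_gt0.
  have h := cvge0_near (fun n => Hm1_norm_ge0 _) cv e20.
  near=> n; have [_ hn] := hD n; apply: (le_trans hn).
  have -> : e%:E = ((e / 2)%:E + (e / 2)%:E)%E :> \bar R by rewrite -EFinD -splitr.
  apply: leeD; first by near: n.
  by rewrite lee_fin ltW//; near: n; exact: (near_infty_natSinv_lt (PosNum e20)).
exists Q, tau, (fun n x => (D n).1 x + Q x), (fun n x => (D n).2 x + tau x); split => //.
- move=> n; have [rn _] := hD n; have := Hm1_rep_add rn r.
  by under [X in Hm1_rep X _ _ -> _]eq_fun do rewrite subrK.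
- apply: cvge0_le => [n|e e0]; first exact: Lunif_norm_ge0.
  apply: filterS (cvD e e0) => n; under [X in _ -> (Lunif_norm _ X <= _)%E]eq_fun do rewrite addrK.
  by apply: le_trans; rewrite leeDl// Lunif_norm_ge0.
- apply: cvge0_le => [n|e e0]; first exact: Lunif_norm_ge0.
  apply: filterS (cvD e e0) => n; under [X in _ -> (Lunif_norm _ X <= _)%E]eq_fun do rewrite addrK.
  by apply: le_trans; rewrite leeDr// Lunif_norm_ge0.
Unshelve. all: by end_near.
Qed.

End NormEquivalence.

(** * Passing from one spectral parameter to another *)

Section L2seminorm.
Context {R : realType}.
Notation mu := (@lebesgue_measure R).
Implicit Types (f g y : R -> R[i]) (z : R[i]).

(** Real-valued, so that estimates become real arithmetic; an infinite norm is sent to 0, so [nmE]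
    and the estimates derived from it require membership in L^2. *)
Definition nm f : R := fine (L2norm f).
Definition modulus z : R := ComplexField.Normc.normc z.

Lemma nmE f : L2 f -> L2norm f = (nm f)%:E.
Proof. by move=> /L2norm_fin[r _ e]; rewrite /nm e. Qed.

Lemma nm_ge0 f : 0 <= nm f.
Proof. exact: fine_ge0 (L2norm_ge0 f). Qed.

Lemma modulus_ge0 z : 0 <= modulus z.
Proof. exact: (cmod_ge0 (fun=> z) 0). Qed.

Lemma nmD f g : L2 f -> L2 g -> nm (fun x => f x + g x) <= nm f + nm g.
Proof.
move=> Lf Lg; have [mf _] := Lf; have [mg _] := Lg.
by rewrite -lee_fin EFinD -!nmE//; [exact: L2norm_add|exact: L2_add].
Qed.

Lemma nmZ z f : L2 f -> nm (fun x => z * f x) = modulus z * nm f.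
Proof.
move=> Lf; have [mf _] := Lf; apply: EFin_inj; rewrite EFinM -!nmE//; last exact: L2_scale.
exact: L2norm_scale.
Qed.

Lemma nm_eq0 f g : L2 f -> L2 g -> nm (fun x => f x - g x) <= 0 -> cae_eq f g.
Proof.
move=> Lf Lg h; have [mf _] := Lf; have [mg _] := Lg.
apply: L2norm_sub_eq0 => //; rewrite nmE; last exact: L2_sub.
by congr _%:E; apply/eqP; rewrite eq_le h nm_ge0.
Qed.

Lemma nm_triangle f g y : L2 f -> L2 g -> L2 y ->
  nm (fun x => f x - y x) <= nm (fun x => f x - g x) + nm (fun x => g x - y x).
Proof.
move=> Lf Lg Ly; have := nmD (L2_sub Lf Lg) (L2_sub Lg Ly).
by under [X in nm X <= _ -> _]eq_fun do rewrite addrA subrK.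
Qed.

End L2seminorm.

Section LinearOperator.
Context {R : realType}.
Implicit Types (T : operator R) (f g y : R -> R[i]) (z lam : R[i]).

(** The last clause says that the graph is saturated under almost everywhere equality, that is, a
    relation between classes. *)
Definition linear_operator T :=
  [/\ forall y f, T y f -> L2 y /\ L2 f,
      forall z y f y' f', T y f -> T y' f' -> T (fun x => z * y x + y' x) (fun x => z * f x + f' x) &
      forall y f y' f', T y f -> cae_eq y y' -> cae_eq f f' -> L2 y' -> L2 f' -> T y' f'].

Section Shift.
Variable T : operator R.
Hypothesis linT : linear_operator T.

Lemma op_shiftP lam y f : op_shift T lam y f <-> L2 f /\ T y (fun x => f x + lam * y x).
Proof.
have [TL2 _ Tae] := linT; split.
  move=> [g Tg [Lf e]]; split => //; have [Ly Lg] := TL2 _ _ Tg.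
  apply: (Tae _ _ _ _ Tg) => //; first by apply: ae_all => x _.
    by apply: ae_imply e => x /= e _; rewrite e// subrK.
  by apply: L2_add => //; exact: L2_scale.
move=> [Lf Tf]; exists (fun x => f x + lam * y x) => //; split => //.
by apply: ae_all => x _; rewrite addrK.
Qed.

Lemma op_shift_L2 lam y f : op_shift T lam y f -> L2 y /\ L2 f.
Proof. by have [TL2 _ _] := linT; move=> [g /TL2[Ly _] [Lf _]]. Qed.

Lemma op_shift_lin lam z y f y' f' : op_shift T lam y f -> op_shift T lam y' f' ->
  op_shift T lam (fun x => z * y x + y' x) (fun x => z * f x + f' x).
Proof.
have [TL2 Tlin Tae] := linT; move=> /op_shiftP[Lf S] /op_shiftP[Lf' S']; apply/op_shiftP; split.
  by apply: L2_add => //; exact: L2_scale.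
have := Tlin z _ _ _ _ S S'; congr (T _ _); apply/funext => x; ring.
Qed.

Lemma op_shift_sub lam y f y' f' : op_shift T lam y f -> op_shift T lam y' f' ->
  op_shift T lam (fun x => y x - y' x) (fun x => f x - f' x).
Proof.
move=> S S'; have := op_shift_lin (-1) S' S.
by congr (op_shift _ _ _ _); apply/funext => x; ring.
Qed.

Lemma op_shift_ae lam y f y' f' : op_shift T lam y f -> cae_eq y y' -> cae_eq f f' ->
  L2 y' -> L2 f' -> op_shift T lam y' f'.
Proof.
have [_ _ Tae] := linT; move=> /op_shiftP[Lf S] ey ef Ly' Lf'; apply/op_shiftP; split => //.
apply: (Tae _ _ _ _ S) => //; last by apply: L2_add => //; exact: L2_scale.
by apply: ae_imply2 ey ef => x /= e1 e2 _; rewrite e1// e2.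
Qed.

Lemma op_shift_shift lam lam' y f : op_shift T lam y f ->
  op_shift T lam' y (fun x => f x + (lam - lam') * y x).
Proof.
have [TL2 _ _] := linT; move=> /op_shiftP[Lf S]; apply/op_shiftP; split.
  by apply: L2_add => //; apply: L2_scale; have [] := TL2 _ _ S.
by move: S; congr (T _ _); apply/funext => x; ring.
Qed.

End Shift.

End LinearOperator.

(** * Neumann iteration at the new spectral parameter *)

Section ResolventStep.
Context {R : realType}.
Variables (T T' : operator R) (lam0 lam : R[i]) (M eps : R).
Hypotheses (linT : linear_operator T) (linT' : linear_operator T').
Let zeta := lam - lam0.
Hypotheses (M0 : 0 <= M) (eps0 : 0 <= eps)
  (exT0 : forall f, L2 f -> exists y, op_shift T lam0 y f)
  (unT0 : forall y1 y2 f, op_shift T lam0 y1 f -> op_shift T lam0 y2 f -> cae_eq y1 y2)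
  (exT0' : forall f, L2 f -> exists y, op_shift T' lam0 y f)
  (close : forall y y' f, op_shift T' lam0 y f -> op_shift T lam0 y' f ->
     nm (fun x => y x - y' x) <= eps * nm f)
  (exT : forall f, L2 f -> exists y, op_shift T lam y f)
  (bndT : forall y f, op_shift T lam y f -> nm y <= M * nm f).
(** Gap between the resolvents at [lam] per unit of the shifted right-hand side [f + zeta y]: [eps]
    is the gap at [lam0], and carrying it through the resolvent of [T] at [lam] adds the term with
    [modulus zeta * M]. *)
Let kappa := (1 + modulus zeta * M) * eps.
Hypotheses (kappa1 : kappa <= 1) (kappaz : kappa * modulus zeta <= 4^-1).

Lemma kappa_ge0 : 0 <= kappa.
Proof. by rewrite mulr_ge0// addr_ge0// mulr_ge0// modulus_ge0. Qed.

(* With h = f + zeta y and z = (T - lam0)^-1 h, one has (T - lam) z = f + zeta (y - z). *)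
Lemma resolvent_close y y0 f : op_shift T' lam y f -> op_shift T lam y0 f ->
  nm (fun x => y x - y0 x) <= kappa * (nm f + modulus zeta * nm y).
Proof.
move=> S S0; have [Ly Lf] := op_shift_L2 linT' S; have [Ly0 _] := op_shift_L2 linT S0.
have Sh := op_shift_shift linT' lam0 S; rewrite -/zeta in Sh.
have [_ Lh] := op_shift_L2 linT' Sh.
have [z Sz] := exT0 Lh; have [Lz _] := op_shift_L2 linT Sz.
have hd := close Sh Sz.
have Sz' := op_shift_shift linT lam Sz.
have hz := bndT (op_shift_sub linT Sz' S0).
have e : (fun x => f x + zeta * y x + (lam0 - lam) * z x - f x) = (fun x => zeta * (y x - z x)).
  by apply/funext => x; rewrite /zeta; ring.
rewrite e nmZ in hz; last exact: L2_sub.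
have hh : nm (fun x => f x + zeta * y x) <= nm f + modulus zeta * nm y.
  by rewrite -nmZ//; apply: nmD => //; exact: L2_scale.
apply: (le_trans (nm_triangle Ly Lz Ly0)).
have mz := modulus_ge0 zeta.
have h1 : eps * nm (fun x => f x + zeta * y x) <= eps * (nm f + modulus zeta * nm y) by rewrite ler_wpM2l.
have h2 : M * (modulus zeta * nm (fun x => y x - z x)) <= M * (modulus zeta * (eps * (nm f + modulus zeta * nm y))).
  by do 2 (apply: ler_wpM2l => //); lra.
rewrite /kappa; move: h1 h2 hd hz; set X := nm f + _; lra.
Qed.

(** An a priori estimate: comparison with the solution for [T] gives |y| <= |f| + |y| / 4 + M |f|,
    and the term |y| / 4 is absorbed. *)
Lemma resolvent_bound y f : op_shift T' lam y f -> nm y <= 2 * (M + 1) * nm f.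
Proof.
move=> S; have [Ly Lf] := op_shift_L2 linT' S.
have [y0 S0] := exT Lf; have [Ly0 _] := op_shift_L2 linT S0.
have h := resolvent_close S S0; have hb := bndT S0.
have t : nm y <= nm (fun x => y x - y0 x) + nm y0.
  have := nmD (L2_sub Ly Ly0) Ly0.
  by under [X in nm X <= _ -> _]eq_fun do rewrite subrK.
have h1 : kappa * nm f <= 1 * nm f by rewrite ler_wpM2r// nm_ge0.
have h2 : kappa * modulus zeta * nm y <= 4^-1 * nm y by rewrite ler_wpM2r// nm_ge0.
have := nm_ge0 y; have := nm_ge0 f; move: h; rewrite mulrDr mulrA; lra.
Qed.

Lemma resolvent_difference y y0 f : op_shift T' lam y f -> op_shift T lam y0 f ->
  nm (fun x => y x - y0 x) <= kappa * (1 + 2 * modulus zeta * (M + 1)) * nm f.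
Proof.
move=> S S0; apply: (le_trans (resolvent_close S S0)); rewrite -mulrA ler_wpM2l ?kappa_ge0//.
have := resolvent_bound S => h.
have : modulus zeta * nm y <= modulus zeta * (2 * (M + 1) * nm f) by rewrite ler_wpM2l// modulus_ge0.
lra.
Qed.

Lemma resolvent_unique y1 y2 f : op_shift T' lam y1 f -> op_shift T' lam y2 f -> cae_eq y1 y2.
Proof.
move=> S1 S2; have [L1 Lf] := op_shift_L2 linT' S1; have [L2' _] := op_shift_L2 linT' S2.
apply: nm_eq0 => //; apply: (le_trans (resolvent_bound (op_shift_sub linT' S1 S2))).
suff -> : nm (fun x => f x - f x) = 0 by rewrite mulr0.
have -> : (fun x => f x - f x) = (fun x => 0 * f x) by apply/funext => x; rewrite subrr mul0r.
rewrite nmZ// /modulus (_ : ComplexField.Normc.normc 0 = 0) ?mul0r//.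
exact: ComplexField.Normc.normc0.
Qed.

(* One step of the Neumann iteration for [(T' - lam) y = f]: its fixed points are solutions. *)
Definition neumann f y y' := exists a z w, [/\ op_shift T' lam0 a (fun x => f x + zeta * y x),
  op_shift T lam0 z (fun x => f x + zeta * y x),
  op_shift T lam w (fun x => f x + zeta * (a x - z x)) & y' = (fun x => w x + (a x - z x))].

Lemma neumann_total f y : L2 f -> L2 y -> exists y', neumann f y y'.
Proof.
move=> Lf Ly; have Lh : L2 (fun x => f x + zeta * y x) by apply: L2_add => //; exact: L2_scale.
have [a Sa] := exT0' Lh; have [z Sz] := exT0 Lh.
have [La _] := op_shift_L2 linT' Sa; have [Lz _] := op_shift_L2 linT Sz.
have [|w Sw] := @exT (fun x => f x + zeta * (a x - z x)).
  by apply: L2_add => //; apply: L2_scale; exact: L2_sub.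
by exists (fun x => w x + (a x - z x)), a, z, w.
Qed.

Lemma neumann_L2 f y y' : neumann f y y' -> L2 y'.
Proof.
move=> [a [z [w [Sa Sz Sw ->]]]].
have [La _] := op_shift_L2 linT' Sa; have [Lz _] := op_shift_L2 linT Sz; have [Lw _] := op_shift_L2 linT Sw.
by apply: L2_add => //; exact: L2_sub.
Qed.

(** The step is affine in [y] with Lipschitz constant [kappa * modulus zeta]; the ratio 1/4 is the
    decay that [L2_complete] asks for. *)
Lemma neumann_contract f y1 y1' y2 y2' : L2 y1 -> L2 y2 -> neumann f y1 y1' -> neumann f y2 y2' ->
  nm (fun x => y1' x - y2' x) <= 4^-1 * nm (fun x => y1 x - y2 x).
Proof.
move=> L1 L2' [a1 [z1 [w1 [Sa1 Sz1 Sw1 ->]]]] [a2 [z2 [w2 [Sa2 Sz2 Sw2 ->]]]].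
have [La1 _] := op_shift_L2 linT' Sa1; have [Lz1 _] := op_shift_L2 linT Sz1; have [Lw1 _] := op_shift_L2 linT Sw1.
have [La2 _] := op_shift_L2 linT' Sa2; have [Lz2 _] := op_shift_L2 linT Sz2; have [Lw2 _] := op_shift_L2 linT Sw2.
have e1 : (fun x => f x + zeta * y1 x - (f x + zeta * y2 x)) = (fun x => zeta * (y1 x - y2 x)).
  by apply/funext => x; ring.
have Sa := op_shift_sub linT' Sa1 Sa2; rewrite e1 in Sa.
have Sz := op_shift_sub linT Sz1 Sz2; rewrite e1 in Sz.
pose d x := (a1 x - a2 x) - (z1 x - z2 x).
have Ld : L2 d by apply: L2_sub; exact: L2_sub.
have hd : nm d <= eps * (modulus zeta * nm (fun x => y1 x - y2 x)).
  by rewrite -nmZ; [exact: close|exact: L2_sub].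
have e2 : (fun x => f x + zeta * (a1 x - z1 x) - (f x + zeta * (a2 x - z2 x))) = (fun x => zeta * d x).
  by apply/funext => x; rewrite /d; ring.
have Sw := op_shift_sub linT Sw1 Sw2; rewrite e2 in Sw.
have hw := bndT Sw; rewrite nmZ// in hw.
have -> : (fun x => w1 x + (a1 x - z1 x) - (w2 x + (a2 x - z2 x))) = (fun x => (w1 x - w2 x) + d x).
  by apply/funext => x; rewrite /d; ring.
apply: (le_trans (nmD (L2_sub Lw1 Lw2) Ld)).
set Y := nm (fun x => y1 x - y2 x) in hd *.
have mz := modulus_ge0 zeta.
have h2 : M * (modulus zeta * nm d) <= M * (modulus zeta * (eps * (modulus zeta * Y))).
  by do 2 (apply: ler_wpM2l => //).
have h3 : kappa * modulus zeta * Y <= 4^-1 * Y by rewrite ler_wpM2r// nm_ge0.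
move: h3 h2 hd hw; rewrite /kappa; lra.
Qed.

(** If y = w + (a - z), then w solves (T - lam0) w = f + zeta y, the equation of z. Uniqueness at
    [lam0] gives w = z, hence y = a, and the equation of a with respect to T' is the one wanted. *)
Lemma neumann_fixed f y y' : neumann f y y' -> L2 f -> L2 y -> cae_eq y y' -> op_shift T' lam y f.
Proof.
move=> N Lf Ly e; have Ly' := neumann_L2 N; case: N => a [z [w [Sa Sz Sw y'E]]].
have [La _] := op_shift_L2 linT' Sa; have [Lz _] := op_shift_L2 linT Sz; have [Lw _] := op_shift_L2 linT Sw.
have Lh : L2 (fun x => f x + zeta * y x) by apply: L2_add => //; exact: L2_scale.
have Sw0 : op_shift T lam0 w (fun x => f x + zeta * y x).
  apply: (op_shift_ae linT (op_shift_shift linT lam0 Sw)) => //; first by apply: ae_all => x _.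
  by apply: ae_imply e => x h _; rewrite h// y'E -/zeta; ring.
have wz := unT0 Sw0 Sz.
have ya : cae_eq a y.
  by apply: ae_imply2 wz e => x h1 h2 _; rewrite h2// y'E h1//; ring.
have Sy := op_shift_ae linT' Sa ya (ae_all (fun x _ => erefl)) Ly Lh.
have := op_shift_shift linT' lam Sy; congr (op_shift _ _ _ _).
by apply/funext => x; rewrite /zeta; ring.
Qed.

Lemma resolvent_exists f : L2 f -> exists y, op_shift T' lam y f.
Proof.
move=> Lf.
(* The step is a relation between representatives; a function is chosen once, with an arbitrary
   value outside L^2. *)
have /choice[Phi hPhi] : forall y, exists y', L2 y -> neumann f y y'.
  move=> y; have [Ly|nLy] := pselect (L2 y); last by exists y.
  by have [y' N] := neumann_total Lf Ly; exists y'.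
pose u k := iter k Phi (fun=> 0).
have Lu k : L2 (u k).
  by elim: k => [|k IH]; [exact: L2_0|exact: neumann_L2 (hPhi _ IH)].
pose c := nm (fun x => u 1%N x - u 0%N x).
have du k : nm (fun x => u k.+1 x - u k x) <= c * 4^-1 ^+ k.
  elim: k => [|k IH]; first by rewrite expr0 mulr1.
  apply: (le_trans (neumann_contract (Lu k.+1) (Lu k) (hPhi _ (Lu k.+1)) (hPhi _ (Lu k)))).
  by rewrite exprS mulrCA ler_wpM2l.
have [|y Ly [C hC]] := L2_complete (nm_ge0 _ : 0 <= c) Lu.
  by move=> k; rewrite nmE ?lee_fin ?du//; exact: L2_sub.
have hC' k : nm (fun x => y x - u k x) <= C * 2^-1 ^+ k.
  by rewrite -lee_fin -nmE//; exact: L2_sub.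
have N := hPhi _ Ly; have LP := neumann_L2 N.
exists y; apply: (neumann_fixed N) => //.
(* Iterate k + 1 is within C 2^-k / 2 of the limit and within C 2^-k / 4 of the image of the limit,
   for every k. *)
apply: nm_eq0 => //; apply: (@le_half_exp _ _ _ C) => k; rewrite add0r.
apply: (le_trans (nm_triangle Ly (Lu k.+1) LP)).
have h1 := hC' k.+1; have h2 := neumann_contract (Lu k) Ly (hPhi _ (Lu k)) N.
have h3 : nm (fun x => u k x - y x) = nm (fun x => y x - u k x).
  rewrite /nm -(L2norm_opp (fun x => y x - u k x)); congr (fine (L2norm _)).
  by apply/funext => x; rewrite opprB.
rewrite h3 in h2; have h4 := hC' k.
have n0 := le_trans (nm_ge0 _) h4.
move: h1; rewrite exprS; rewrite -/(u k.+1) in h2 *.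
move: h2 h4 n0; rewrite -[Phi (u k)]/(u k.+1); lra.
Qed.

End ResolventStep.

(** * Norm resolvent convergence *)

Section Convergence.
Context {R : realType}.
Notation mu := (@lebesgue_measure R).
Implicit Types (Q tau f y : R -> R[i]).

Lemma S_graph_linear Q tau : cmeasurable Q -> cmeasurable tau -> linear_operator (S_graph Q tau).
Proof.
move=> mQ mt; split.
- by move=> y f [].
- move=> z y f y' f' /(S_graphP _ _ mQ mt)[Ly Lf [y0 [u [e P0 P1]]]].
  move=> /(S_graphP _ _ mQ mt)[Ly' Lf' [y0' [u' [e' P0' P1']]]].
  apply/S_graphP => //; split; try by apply: L2_add => //; exact: L2_scale.
  exists (fun x => z * y0 x + y0' x), (fun x => z * u x + u' x); split.
  + by apply: ae_imply2 e e' => x /= h h' _; rewrite h// h'.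
  + have := cprimD (cprimZ z P0) P0'; congr (cprim _ _); apply/funext => x; ring.
  + have := cprimD (cprimZ z P1) P1'; congr (cprim _ _); apply/funext => x; ring.
- move=> y f y' f' /(S_graphP _ _ mQ mt)[Ly Lf [y0 [u [e P0 P1]]]] ey ef Ly' Lf'.
  have [mf' _] := Lf'.
  apply/S_graphP => //; split => //; exists y0, u; split => //.
    by apply: ae_imply2 ey e => x /= h h' _; rewrite -h// h'.
  have m0 := cprim_measurable P0; have m1 := cprim_measurable P1.
  apply: (cprim_ae P1); last by apply: ae_imply ef => x /= ->.
  apply: cmeasurableB => //; apply: cmeasurableB; first exact: cmeasurableM.
  by apply: cmeasurableM => //; apply: cmeasurableD => //; exact: cmeasurableM.
Qed.

Lemma nm_sym f g : nm (fun x => f x - g x) = nm (fun x => g x - f x).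
Proof.
rewrite /nm -(L2norm_opp (fun x => g x - f x)); congr (fine (L2norm _)).
by apply/funext => x; rewrite opprB.
Qed.

Lemma nm0 : nm (fun _ : R => 0 : R[i]) = 0.
Proof.
have -> : (fun _ : R => 0) = (fun x => 0 * (fun=> 0) x) :> (R -> R[i]) by apply/funext => x; rewrite mul0r.
by rewrite nmZ; [rewrite /modulus (ComplexField.Normc.normc0 R) mul0r|exact: L2_0].
Qed.

Lemma ub1_le f (N M : R) : N <= M -> ub1 f N -> ub1 f M.
Proof. by move=> NM h t; apply: (le_trans (h t)); rewrite lee_fin. Qed.

Lemma ub2_le f (N M : R) : N <= M -> ub2 f N -> ub2 f M.
Proof. by move=> NM h t; apply: (le_trans (h t)); rewrite lee_fin. Qed.

(** The threshold for [nu] involves only [N], so one parameter serves all representations with the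
    same uniform bounds. *)
Lemma resolvent_set_nonempty (nu N : R) Q tau : cmeasurable Q -> cmeasurable tau -> 0 <= N ->
  ub2 Q N -> ub1 tau N -> 1 + 648 * (cK * N + 1) <= nu ->
  resolvent_set (S_graph Q tau) (- ((nu ^+ 2)%:C)%C).
Proof.
move=> mQ mt N0 HQ Ht hnu; split.
- move=> f Lf; have [p [m [_ _ _ S]]] := system_solution mQ mt N0 HQ Ht hnu Lf; by eexists; exact: S.
- move=> y1 y2 f; exact: (op_shift_unique mQ mt N0 HQ Ht hnu).
- exists 8 => y f; exact: (op_shift_bound mQ mt N0 HQ Ht hnu).
Qed.

Section Sequence.
Variables (Q tau : R -> R[i]) (Q_ tau_ : nat -> R -> R[i]).
Hypotheses (LQ : Lunif 2 Q) (Lt : Lunif 1 tau)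
  (LQ_ : forall n, Lunif 2 (Q_ n)) (Lt_ : forall n, Lunif 1 (tau_ n))
  (cQ : Lunif_norm 2 (fun x => Q_ n x - Q x) @[n --> \oo] --> 0%E)
  (ct : Lunif_norm 1 (fun x => tau_ n x - tau x) @[n --> \oo] --> 0%E).

Let mQ : cmeasurable Q := Lunif_meas LQ.
Let mt : cmeasurable tau := Lunif_meas Lt.
Let mQ_ n : cmeasurable (Q_ n) := Lunif_meas (LQ_ n).
Let mt_ n : cmeasurable (tau_ n) := Lunif_meas (Lt_ n).

Lemma uniform_bounds : exists2 N : R, 0 <= N & [/\ ub2 Q N, ub1 tau N &
  forall d : R, 0 < d <= 1 -> \forall n \near \oo, [/\ ub2 (Q_ n) N, ub1 (tau_ n) N,
    ub2 (fun x => Q_ n x - Q x) (d ^+ 2) & ub1 (fun x => tau_ n x - tau x) d]].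
Proof.
have [N1 N10 h1] := Lunif2P LQ; have [N2 N20 h2] := Lunif1P Lt.
(* One bound for the limit and the late terms: writing Q_n = (Q_n - Q) + Q costs 2 d^2 + 2 N1, and
   tau_n costs d + N2, with d <= 1. *)
pose N := 2 * 1 + 2 * N1 + N2; exists N; first by rewrite /N; lra.
split; [by apply: ub2_le h1; rewrite /N; lra|by apply: ub1_le h2; rewrite /N; lra|].
(* Half of [d] absorbs the factor 2 between the modulus and [n1], for both exponents. *)
move=> d /andP[d0 d1]; have d20 : 0 < d / 2 by rewrite divr_gt0.
have e1 := cvge0_near (fun n => Lunif_norm_ge0 2 _) cQ d20.
have e2 := cvge0_near (fun n => Lunif_norm_ge0 1 _) ct d20.
near=> n.
have f1 : ub2 (fun x => Q_ n x - Q x) (d ^+ 2).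
  apply: (@ub2_le _ (2 * (d / 2) ^+ 2)).
    by have := sqr_ge0 d; rewrite exprMn exprVn; lra.
  apply: Lunif2_ub2; [exact: ltW|exact: cmeasurableB|by near: n].
have f2 : ub1 (fun x => tau_ n x - tau x) d.
  apply: (@ub1_le _ (2 * (d / 2))); first lra.
  by apply: Lunif1_ub1; [exact: cmeasurableB|near: n].
split => //.
  apply: (@ub2_le _ (2 * d ^+ 2 + 2 * N1)).
    have : d ^+ 2 <= 1 by rewrite expr_le1// ltW.
    by rewrite /N; lra.
  by have := ub2D (cmeasurableB (mQ_ n) mQ) mQ f1 h1; under [X in ub2 X _ -> _]eq_fun do rewrite subrK.
apply: (@ub1_le _ (d + N2)); first by rewrite /N; lra.
by have := ub1D (cmeasurableB (mt_ n) mt) mt f2 h2; under [X in ub1 X _ -> _]eq_fun do rewrite subrK.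
Unshelve. all: by end_near.
Qed.

(** The auxiliary parameter [lam0] is fixed through the common bound [N] before the distance [d] is
    chosen, so the gap at [lam0] is of order [d] with a constant independent of n, and [d] can be
    made small enough for the transfer to [lam]. *)
Lemma resolvent_convergence (lam : R[i]) (e : R) : resolvent_set (S_graph Q tau) lam -> 0 < e ->
  \forall n \near \oo, resolvent_set (S_graph (Q_ n) (tau_ n)) lam /\
    forall y y0 f, op_shift (S_graph (Q_ n) (tau_ n)) lam y f -> op_shift (S_graph Q tau) lam y0 f ->
      nm (fun x => y x - y0 x) <= e * nm f.
Proof.
move=> [exT unT [M1 bnd]] e0.
have [N N0 [HQ Ht near_bounds]] := uniform_bounds.
pose nu := 1 + 648 * (cK * N + 1).
pose lam0 : R[i] := - ((nu ^+ 2)%:C)%C.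
have [exT0 unT0 _] := resolvent_set_nonempty mQ mt N0 HQ Ht (lexx nu).
(* The bound provided by [resolvent_set] carries no sign. *)
pose M := Num.max M1 0.
have M0 : 0 <= M by rewrite le_max lexx orbT.
have linT := S_graph_linear mQ mt.
have bndT y f : op_shift (S_graph Q tau) lam y f -> nm y <= M * nm f.
  move=> S; have [Ly Lf] := op_shift_L2 linT S; have := bnd _ _ S.
  rewrite !nmE// -EFinM lee_fin => /le_trans; apply.
  by rewrite ler_wpM2r ?nm_ge0// le_max lexx.
have mz := modulus_ge0 (lam - lam0); set z := modulus (lam - lam0) in mz.
pose K : R := 2 * cK + 1 + 2 * cK * N.
have c0 := @cK_gt0 R.
have K0 : 0 < K.
  have : 0 <= 2 * cK * N by rewrite !mulr_ge0// ltW.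
  by rewrite /K; lra.
pose A := (1 + z * M) * (32 * K).
have zM : 0 <= z * M by rewrite mulr_ge0.
have A0 : 0 < A by rewrite /A mulr_gt0//; lra.
pose B := 1 + 2 * z * (M + 1).
have B0 : 0 < B.
  have : 0 <= 2 * z * (M + 1) by rewrite !mulr_ge0//; lra.
  by rewrite /B; lra.
(* Three demands on the gap at [lam]: at most 1, at most 1/4 after multiplication by [z], and at
   most [e] after multiplication by [B]. Using z + 1 covers the case lam = lam0. *)
pose t := Num.min 1 (Num.min ((4 * (z + 1))^-1) (e / B)).
have z4 : 0 < 4 * (z + 1) by lra.
have t0 : 0 < t by rewrite !lt_min ltr01 invr_gt0 z4 divr_gt0.
pose d := Num.min 1 (t / A).
have d0 : 0 < d by rewrite lt_min ltr01 divr_gt0.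
have d1 : 0 < d <= 1 by rewrite d0 ge_min lexx.
have kt : (1 + z * M) * (32 * K * d) <= t.
  rewrite mulrA -/A mulrC -ler_pdivlMr//; by rewrite ge_min lexx orbT.
have kappa1 : (1 + z * M) * (32 * K * d) <= 1 by apply: (le_trans kt); rewrite ge_min lexx.
have kappaz : (1 + z * M) * (32 * K * d) * z <= 4^-1.
  have : t * z <= 4^-1.
    have tz : t <= (4 * (z + 1))^-1 by rewrite !ge_min lexx orbT.
    apply: (@le_trans _ _ ((4 * (z + 1))^-1 * z)); first by rewrite ler_wpM2r.
    by rewrite mulrC ler_pdivrMr//; lra.
  by apply: le_trans; rewrite ler_wpM2r.
have kappae : (1 + z * M) * (32 * K * d) * B <= e.
  rewrite -ler_pdivlMr//; apply: (le_trans kt); by rewrite !ge_min lexx !orbT.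
have eps0 : 0 <= 32 * K * d by rewrite !mulr_ge0// ltW.
apply: filterS (near_bounds d d1) => n [HQn Htn HdQ Hdt].
have linT' := S_graph_linear (mQ_ n) (mt_ n).
have [exT0' _ _] := resolvent_set_nonempty (mQ_ n) (mt_ n) N0 HQn Htn (lexx nu).
have close y y' f : op_shift (S_graph (Q_ n) (tau_ n)) lam0 y f -> op_shift (S_graph Q tau) lam0 y' f ->
    nm (fun x => y x - y' x) <= 32 * K * d * nm f.
  move=> S S'; have [Ly Lf] := op_shift_L2 linT' S; have [Ly' _] := op_shift_L2 linT S'.
  have := op_shift_difference (mQ_ n) (mt_ n) mQ mt N0 HQn Htn HQ Ht (lexx nu) d0 HdQ Hdt S S'.
  by rewrite !nmE//; exact: L2_sub.
split; [split|].
- exact: (resolvent_exists linT linT' M0 exT0 unT0 exT0' close exT bndT kappaz).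
- exact: (resolvent_unique linT linT' M0 eps0 exT0 close exT bndT kappa1 kappaz).
- exists (2 * (M + 1)) => y f S; have [Ly Lf] := op_shift_L2 linT' S.
  rewrite !nmE// -EFinM lee_fin.
  exact: (resolvent_bound linT linT' M0 eps0 exT0 close exT bndT kappa1 kappaz S).
- move=> y y0 f S S0.
  apply: (le_trans (resolvent_difference linT linT' M0 eps0 exT0 close exT bndT kappa1 kappaz S S0)).
  by rewrite ler_wpM2r// nm_ge0.
Qed.

End Sequence.

Lemma resolventP (T : operator R) (lam : R[i]) f : resolvent_set T lam -> L2 f ->
  op_shift T lam (resolvent T lam f) f.
Proof. by move=> [ex _ _] /ex[y Sy]; rewrite /resolvent; apply: (@xgetPex _ _ [set y | op_shift T lam y f]); exists y. Qed.

Lemma opnorm_ge0 (B : (R -> R[i]) -> (R -> R[i])) : (0 <= opnorm B)%E.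
Proof.
apply: (@le_trans _ _ (L2norm (B (fun=> 0)))); first exact: L2norm_ge0.
apply: ereal_sup_ubound; exists (fun=> 0) => //=; split; first exact: L2_0.
by rewrite nmE; [rewrite nm0 lee_fin ler01|exact: L2_0].
Qed.

End Convergence.

Theorem theoremB (R : realType) (q : (R -> R[i]) -> R[i])
    (q_ : nat -> (R -> R[i]) -> R[i])
    (hq : Hm1_unif q) (hq_ : forall n : nat, Hm1_unif (q_ n)) :
  (Hm1_norm (fun phi => q_ n phi - q phi) @[n --> \oo] --> 0%E
   <->
   exists (Q tau : R -> R[i]) (Q_ tau_ : nat -> R -> R[i]),
     [/\ Hm1_rep q Q tau,
         forall n : nat, Hm1_rep (q_ n) (Q_ n) (tau_ n),
         Lunif_norm 2 (fun x => Q_ n x - Q x) @[n --> \oo] --> 0%E &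
         Lunif_norm 1 (fun x => tau_ n x - tau x) @[n --> \oo] --> 0%E])
  /\
  (Hm1_norm (fun phi => q_ n phi - q phi) @[n --> \oo] --> 0%E ->
   (exists lambda : R[i], resolvent_set (schrodinger q) lambda) /\
   forall lambda : R[i], resolvent_set (schrodinger q) lambda ->
     (\forall n \near \oo, resolvent_set (schrodinger (q_ n)) lambda) /\
     opnorm (fun f x => resolvent (schrodinger q) lambda f x
                        - resolvent (schrodinger (q_ n)) lambda f x)
       @[n --> \oo] --> 0%E).
Proof.
have [_ rq] := hq; have rq_ n : exists Q tau, Hm1_rep (q_ n) Q tau by have [] := hq_ n.
have equiv := Hm1_convergenceP rq rq_; split => //.
move=> /equiv[Q [tau [Q_ [tau_ [r r_ cQ ct]]]]].
have [LQ Lt _] := r.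
have LQ_ n : Lunif 2 (Q_ n) by have [] := r_ n.
have Lt_ n : Lunif 1 (tau_ n) by have [] := r_ n.
have mQ := Lunif_meas LQ; have mt := Lunif_meas Lt.
rewrite (schrodingerE r); split.
  have [N N0 [HQ Ht _]] := uniform_bounds LQ Lt LQ_ Lt_ cQ ct.
  by eexists; exact: (resolvent_set_nonempty mQ mt N0 HQ Ht (lexx _)).
move=> lam rho.
have conv (e : R) := resolvent_convergence LQ Lt LQ_ Lt_ cQ ct rho (e := e).
split.
  by apply: filterS (conv 1 ltr01) => n [h _]; rewrite (schrodingerE (r_ n)).
apply: cvge0_le => [n|e e0]; first exact: opnorm_ge0.
apply: filterS (conv e e0) => n [rho_n h]; rewrite (schrodingerE (r_ n)).
apply: ge_ereal_sup => _ [f [Lf f1] <-].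
(* [resolvent] picks arbitrary representatives, which is harmless because the estimate [h] holds for
   any pair of solutions. *)
have S := resolventP rho Lf; have S' := resolventP rho_n Lf.
have linT := S_graph_linear mQ mt.
have linT' := S_graph_linear (Lunif_meas (LQ_ n)) (Lunif_meas (Lt_ n)).
have [L1 _] := op_shift_L2 linT S; have [L2' _] := op_shift_L2 linT' S'.
rewrite nmE; last exact: L2_sub.
rewrite nm_sym lee_fin; apply: (le_trans (h _ _ _ S' S)).
by rewrite ler_piMr ?(ltW e0)//; move: f1; rewrite nmE// lee_fin.
Qed.
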